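(* For every $0\le t<1$ and $x\in\mathbb{R}$, $$V(t,x):=\sup_{t\le\tau_1\le\tau_2<1}\mathbb{E}_{t,x}\left[X_{\tau_2}-X_{\tau_1}\right]$$ equals $V^*(t,x)$, where $$V^*(t,x)=\begin{cases}\sqrt{1-t}\,\sqrt{2\pi}\,\Phi\!\left(-\frac{x}{\sqrt{1-t}}\right)e^{x^2/(2(1-t))}\,v(C^* ), & x>C^*\sqrt{1-t},\\ f(t,x), & x\le C^*\sqrt{1-t}.\end{cases}$$ Moreover, the pair $$\tau_1^*:=\inf\{s\ge t: X_s\le C^*\sqrt{1-s}\},\qquad \tau_2^*:=\inf\{s\ge\tau_1^*: X_s\ge B^*\sqrt{1-s}\}$$ is optimal, i.e. attains the supremum defining $V(t,x)$.
   Context: For $0\le t<1$ and $x\in\mathbb{R}$, let $\{X_s\}_{t\le s\le1}$ be the Brownian bridge solving $\mathrm{d}X_s=-\frac{X_s}{1-s}\mathrm{d}s+\mathrm{d}W_s$ for $t\le s<1$, with $X_t=x$. Here $W$ is a standard Brownian motion. Write $\mathbb{P}_{t,x},\mathbb{E}_{t,x}$ for probability and expectation under $X_t=x$. The supremum is over pairs of stopping times $t\le\tau_1\le\tau_2<1$ a.s. with respect to the filtration generated by $X$. $\Phi$ denotes the standard normal distribution function. $B^*\approx0.84$ is the unique positive solution of $\sqrt{2\pi}(1-B^2)e^{B^2/2}\Phi(B)=B$. Define $U(t,x)=\sqrt{2\pi(1-t)}(1-(B^* )^2)e^{x^2/(2(1-t))}\Phi(x/\sqrt{1-t})$ if $x<B^*\sqrt{1-t}$,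 and $U(t,x)=x$ otherwise. Set $f(t,x):=U(t,x)-x$. For $C\le B^*$ define $$v(C):=\frac{1}{\Phi(-C)}\left[(1-(B^* )^2)\Phi(C)-C\frac{e^{-C^2/2}}{\sqrt{2\pi}}\right],$$ $$u(C):=1-(B^* )^2-(1-C^2)\Phi(-C)-\frac{C}{\sqrt{2\pi}}e^{-C^2/2}.$$ $C^*$ is the unique negative zero of $u$; it is the maximizer of $v$ on $(-\infty,B^*]$. *)

(* Defs.v *)
From HB Require Import structures.
From mathcomp Require Import all_boot all_order all_algebra.
From mathcomp Require Import all_classical all_reals all_analysis.
From mathcomp Require Import normal_distribution.

Set Implicit Arguments.
Unset Strict Implicit.
Unset Printing Implicit Defensive.

Import Order.TTheory GRing.Theory Num.Def Num.Theory.
Import numFieldNormedType.Exports.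

Local Open Scope classical_set_scope.
Local Open Scope ring_scope.

Section Defs.
Context {R : realType}.

Definition Phi (y : R) : R := fine (normal_prob 0 1 `]-oo, y]).

Definition U_fun (B t y : R) : R :=
  if y < B * Num.sqrt (1 - t) then
    Num.sqrt (pi *+ 2 * (1 - t)) * (1 - B ^+ 2)
      * expR (y ^+ 2 / ((1 - t) *+ 2)) * Phi (y / Num.sqrt (1 - t))
  else y.

Definition f_fun (B t y : R) : R := U_fun B t y - y.

Definition v_fun (B c : R) : R :=
  (Phi (- c))^-1 * ((1 - B ^+ 2) * Phi c
                    - c * expR (- (c ^+ 2) / 2) / Num.sqrt (pi *+ 2)).

Definition u_fun (B c : R) : R :=
  1 - B ^+ 2 - (1 - c ^+ 2) * Phi (- c)
    - c / Num.sqrt (pi *+ 2) * expR (- (c ^+ 2) / 2).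

Definition Vstar (B C t y : R) : R :=
  if C * Num.sqrt (1 - t) < y then
    Num.sqrt (1 - t) * Num.sqrt (pi *+ 2) * Phi (- (y / Num.sqrt (1 - t)))
      * expR (y ^+ 2 / ((1 - t) *+ 2)) * v_fun B C
  else f_fun B t y.

Context {d : measure_display} {Omega : measurableType d}.

Definition standard_BM (P : probability Omega R) (W : R -> Omega -> R) : Prop :=
  [/\ (forall w, W 0 w = 0),
      (forall s, measurable_fun setT (W s)),
      (forall w, {within `[0, +oo[, continuous (fun s => W s w)}) &
      (forall (n : nat) (s : nat -> R) (A : nat -> set R),
          0 <= s 0%N ->
          (forall i, (i < n)%N -> s i < s i.+1) ->
          (forall i, measurable (A i)) ->
          P (\bigcap_(i in [set i | (i < n)%N])
               [set w | W (s i.+1) w - W (s i) w \in A i])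
          = (\prod_(i < n) normal_prob 0 (Num.sqrt (s i.+1 - s i)) (A i))%E)].

(** X solves dX_s = - X_s/(1-s) ds + dW_s on [t,1) with X_t = x
    (additive noise: the integral equation is pathwise). *)
Definition bridge_SDE (W X : R -> Omega -> R) (t x : R) : Prop :=
  forall w, forall s, t <= s < 1 ->
    X s w = x - (\int[lebesgue_measure]_(u in `[t, s]) (X u w / (1 - u)))
              + (W s w - W t w).

Definition nat_filtration (X : R -> Omega -> R) (t s : R) : set (set Omega) :=
  <<s [set E | exists u (A : set R), [/\ t <= u <= s, measurable A &
                                          E = X u @^-1` A]] >>.

Definition stopping_time (X : R -> Omega -> R) (t : R) (tau : Omega -> R) : Prop :=
  forall s, t <= s < 1 -> nat_filtration X t s [set w | tau w <= s].

Definition admissible (P : probability Omega R) (X : R -> Omega -> R) (t : R)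
    (tau1 tau2 : Omega -> R) : Prop :=
  [/\ stopping_time X t tau1, stopping_time X t tau2 &
      {ae P, forall w, t <= tau1 w /\ tau1 w <= tau2 w /\ tau2 w < 1}].

Definition gain (P : probability Omega R) (X : R -> Omega -> R)
    (tau1 tau2 : Omega -> R) : \bar R :=
  (\int[P]_w (X (tau2 w) w - X (tau1 w) w)%:E)%E.

Definition value (P : probability Omega R) (X : R -> Omega -> R) (t : R) : \bar R :=
  ereal_sup [set g | exists tau1 tau2,
               admissible P X t tau1 tau2 /\ g = gain P X tau1 tau2].

Definition hit_time (X : R -> Omega -> R) (s0 : R) (cond : R -> R -> bool)
    (w : Omega) : R :=
  let S := [set s | s0 <= s < 1 /\ cond s (X s w)] in
  if pselect (S !=set0) is left _ then inf S else 1.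

Definition tau1_star (X : R -> Omega -> R) (C t : R) (w : Omega) : R :=
  hit_time X t (fun s y => y <= C * Num.sqrt (1 - s)) w.

Definition tau2_star (X : R -> Omega -> R) (B C t : R) (w : Omega) : R :=
  hit_time X (tau1_star X C t w) (fun s y => B * Num.sqrt (1 - s) <= y) w.

End Defs.

(* Main.v *)
(** Put [r = 1 / (1 - s)] and [Y = X / (1 - s)]. Then [dY = dW / (1 - s)], so [Y] is a Brownian
    motion in the clock [r], and [X = Y / r]. The functions
    [G (r, +-y) = \int_0^oo exp (+-l y - l^2 r / 2) dl] are mixtures of exponential martingales;
    with [z = y / sqrt r = x / sqrt (1 - s)] and [m z = sqrt (2 pi) exp (z^2 / 2) Phi z] one has
    [G (r, y) = m z / sqrt r]. With [a = 1 - B^2] and [v = v (C)], which equals [B^2 - C^2],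
    [U] is [a G (r, y)] for [z < B] and [y / r] otherwise, while [V*] is [v G (r, -y)] for [z > C]
    and [a G (r, y) - y / r] otherwise.

    [U] and [V*] are supermartingales. On one side of the boundary they are dominated everywhere
    by a multiple of [G (r, +-y)] which they equal at the start of the time step. On the other side,
    Taylor bounds on [m] at the boundary dominate the increment by a combination of [dY] and
    [dY^2 - dr], whose conditional means are at most [0]; no Ito formula is involved. As [X <= U]
    and [U - X <= V*], stopping on finite grids gives [E (X_tau2 - X_tau1) <= V*], and the bound
    [X^2 <= G (r, y) + G (r, -y)] carries this to the limit of fine grids.

    For the hitting times, [G (r, -y)] is bounded up to [tau1] and [G (r, y)] between [tau1] and
    [tau2]. Hence [E X_tau2 = E (a G_tau2) = E (a G_tau1)], and [a G - X] equals [v G (r, -y)] on the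
    boundary [z = C]. Both times are below [1] because an increment of [Y] exceeds a given multiple of
    the square root of its variance with conditional probability bounded away from [0]. *)
Require Import Defs.
From HB Require Import structures.
From mathcomp Require Import all_boot all_order all_algebra.
From mathcomp Require Import all_classical all_reals all_analysis.
From mathcomp Require Import normal_distribution gauss_integral measurable_realfun.
From mathcomp Require Import ring lra.

Import Order.TTheory GRing.Theory Num.Def Num.Theory.
Import numFieldNormedType.Exports.
Local Open Scope classical_set_scope.
Local Open Scope ring_scope.

(** * Gaussian Laplace integrals *)

(** Independence of the increments of [W] is given only on products of Borel sets over finite
    strictly increasing grids, whereas stopping times refer to the filtration of [X]. The link is
    [slope_exp]: for an event [A] known at time [s], the increment [D] of [Y] satisfies E (1_A exp
    (l D)) = exp (l^2 h / 2) P(A). It is the only distributional input afterwards: the martingale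
    property of [G], the first two moments of [D] and the lower bound on large increments are all
    drawn from it by varying [l].

    The supermartingale inequalities hold for steps of any length, not up to an o(h) error, so
    nothing accumulates along a grid. The price is that a step may cross a boundary, where [U] and
    the value function have a kink in the second derivative. Value matching and smooth fit remove
    the terms of order 0 and 1, and the remaining square has to be absorbed by the drift of the
    stopped branch.

    The paths of [X] are given neither continuous nor measurable, and the integral in the equation
    has a default value when its integrand is not integrable; regularity has to be extracted from
    the equation first. *)

(* Locked: unification would otherwise compare the integrals defining [lap 0 z] and [lap 1 z]. *)
HB.lock Definition lap {R : realType} (k : nat) (z : R) : R :=
  \int[@lebesgue_measure R]_(l in `[0, +oo[) (l ^+ k * expR (l * z - l ^+ 2 / 2)).

Section analysis.
Context {R : realType}.
Local Notation mu := (@lebesgue_measure R).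
Implicit Types B C x y z c l : R.

Lemma le_of_derive (f df : R -> R) (a b : R) : a <= b ->
  (forall x, is_derive x 1 f (df x)) ->
  (forall x, a < x < b -> 0 <= df x) -> f a <= f b.
Proof.
rewrite le_eqVlt => /predU1P[->//|ab] fdf df0.
have cf : {within `[a, b], continuous f}.
  apply: derivable_within_continuous => x _.
  by have [] := fdf x.
have [c cab fE] := MVT ab (fun x _ => fdf x) cf.
rewrite -subr_ge0 fE mulr_ge0 ?subr_ge0 ?(ltW ab)// df0//.
Qed.

Lemma expR_taylor2_derive x :
  is_derive x 1 (fun x => expR x - (1 + x + x ^+ 2 / 2)) (expR x - (1 + x)).
Proof.
apply: is_derive_eq.
by rewrite /GRing.scale /=; field.
Qed.

Lemma expR_ge_taylor2 x : 0 <= x -> 1 + x + x ^+ 2 / 2 <= expR x.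
Proof.
move=> x0; rewrite -subr_ge0.
have := le_of_derive _ _ 0 x x0 expR_taylor2_derive.
rewrite expR0 expr0n /= mul0r !addr0 subrr; apply => y _.
by rewrite subr_ge0 expR_ge1Dx.
Qed.

Lemma expR_le_taylor2 x : x <= 0 -> expR x <= 1 + x + x ^+ 2 / 2.
Proof.
move=> x0; rewrite -subr_le0.
have := le_of_derive _ _ x 0 x0 expR_taylor2_derive.
rewrite expR0 expr0n /= mul0r !addr0 subrr; apply => y _.
by rewrite subr_ge0 expR_ge1Dx.
Qed.

(** The right-hand side is the square of exp (x/2) - exp (-x/2). For x >= 0 the second order Taylor
    bounds of the two exponentials point in opposite directions and their even terms cancel, so this
    difference is at least x. *)
Lemma sqr_le_expRDN x : x ^+ 2 <= expR x + expR (- x) - 2.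
Proof.
wlog x0 : x / 0 <= x => [hw|].
  have [/hw//|/ltW x0] := leP 0 x.
  by have := hw (- x); rewrite oppr_ge0 sqrrN opprK [expR (- x) + _]addrC; apply.
have h1 := expR_ge_taylor2 (x / 2) (divr_ge0 x0 (ler0n _ 2)).
have h2 : expR (- (x / 2)) <= 1 - x / 2 + (- (x / 2)) ^+ 2 / 2.
  by apply: expR_le_taylor2; rewrite oppr_le0 divr_ge0.
have ex : expR x = expR (x / 2) * expR (x / 2) by rewrite -expRD -splitr.
have eNx : expR (- x) = expR (- (x / 2)) * expR (- (x / 2)).
  by rewrite -expRD -opprD -splitr.
rewrite ex eNx; have h3 := expRxMexpNx_1 (x / 2).
move: h1 h2 h3; set u := expR (x / 2); set v := expR _ => h1 h2 h3.
have -> : u * u + v * v - 2 = (u - v) ^+ 2 by rewrite sqrrB h3; ring.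
rewrite ler_sqr ?nnegrE//; first by lra.
by lra.
Qed.

Lemma continuous_gauss_tilt k z :
  continuous (fun l : R => l ^+ k * expR (l * z - l ^+ 2 / 2)).
Proof.
move=> l; apply: cvgM; first exact: exprn_continuous.
apply: continuous_comp; last exact: continuous_expR.
apply: cvgB; first by apply: cvgM; [exact: cvg_id|exact: cvg_cst].
apply: cvgM; [exact: exprn_continuous|exact: cvg_cst].
Qed.

Lemma integrable_gauss_tilt0 z :
  mu.-integrable setT (EFin \o (fun l => expR (l * z - l ^+ 2 / 2))).
Proof.
have s2 : Num.sqrt (pi *+ 2) != 0 :> R by rewrite gt_eqF// sqrtr_gt0 mulrn_wgt0 ?pi_gt0.
have := integrableZl measurableT (expR (z ^+ 2 / 2) * Num.sqrt (pi *+ 2)) (integrable_normal_pdf z 1).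
apply: eq_integrable => // l _ /=.
rewrite -EFinM normal_pdfE ?oner_eq0// /normal_peak /normal_fun expr1n mul1r.
rewrite -mulrA (mulrA (Num.sqrt _)) mulfV// mul1r -expRD; congr (EFin (expR _)).
by field.
Qed.

Lemma integrable_gauss_tilt k z : (k <= 2)%N ->
  mu.-integrable `[0%R, +oo[
    (EFin \o (fun l => l ^+ k * expR (l * z - l ^+ 2 / 2))).
Proof.
move=> k2.
(* For k <= 2 and l >= 0 the power l^k is at most 2 exp l, which only shifts [z] to [z + 1]. *)
have i1 : mu.-integrable `[0%R, +oo[
    (EFin \o (fun l => 2 * expR (l * (z + 1) - l ^+ 2 / 2))).
  apply: (integrableZl _ 2 (integrableS measurableT _ _
    (integrable_gauss_tilt0 (z + 1)))) => //.
apply: le_integrable i1 => //.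
  apply/measurable_EFinP; apply: measurable_funTS.
  by apply: continuous_measurable_fun; exact: continuous_gauss_tilt.
move=> l /=; rewrite in_itv /= andbT => l0.
rewrite lee_fin !ger0_norm; last 2 first.
  by rewrite mulr_ge0// expR_ge0.
  by rewrite mulr_ge0 ?exprn_ge0// expR_ge0.
have -> : expR (l * (z + 1) - l ^+ 2 / 2) = expR (l * z - l ^+ 2 / 2) * expR l.
  by rewrite -expRD; congr expR; ring.
rewrite [leLHS]mulrC mulrCA ler_wpM2l ?expR_ge0//.
have l1 := expR_ge_taylor2 l l0.
have ll := sqr_ge0 l; have l2 := sqr_ge0 (l - 1).
case: k k2 => [|[|[|//]]] _; rewrite ?expr0 ?expr1; nra.
Qed.

Lemma lap_ge0 k z : 0 <= lap k z.
Proof.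
rewrite lap.unlock; apply: Rintegral_ge0 => l /=; rewrite in_itv/= andbT => l0.
by rewrite mulr_ge0 ?exprn_ge0 ?expR_ge0.
Qed.

Lemma integrable_gauss_tiltZ k c z : (k <= 2)%N ->
  mu.-integrable `[0%R, +oo[
    (EFin \o (fun l => c * (l ^+ k * expR (l * z - l ^+ 2 / 2)))).
Proof.
by move=> k2; apply: (integrableZl _ c (integrable_gauss_tilt k z k2)).
Qed.

Lemma integrable_gauss_tilt_quad c0 c1 c2 z :
  mu.-integrable `[0%R, +oo[
    (EFin \o (fun l => (c0 + c1 * l + c2 * l ^+ 2) * expR (l * z - l ^+ 2 / 2))).
Proof.
apply: eq_integrable (integrableD _ (integrableD _ (integrable_gauss_tiltZ 0 c0 z isT) (integrable_gauss_tiltZ 1 c1 z isT)) (integrable_gauss_tiltZ 2 c2 z isT)) => //.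
by move=> l _ /=; congr EFin; rewrite expr0 expr1; ring.
Qed.

Lemma lap_quad c0 c1 c2 z :
  \int[mu]_(l in `[0, +oo[)
    ((c0 + c1 * l + c2 * l ^+ 2) * expR (l * z - l ^+ 2 / 2))
  = c0 * lap 0 z + c1 * lap 1 z + c2 * lap 2 z.
Proof.
rewrite lap.unlock -!RintegralZl//; try exact: integrable_gauss_tilt.
rewrite -RintegralD//; [|exact: (integrable_gauss_tiltZ 0 c0 z isT)|exact: (integrable_gauss_tiltZ 1 c1 z isT)].
rewrite -RintegralD//; [|exact: (integrableD _ (integrable_gauss_tiltZ 0 c0 z isT) (integrable_gauss_tiltZ 1 c1 z isT))|exact: (integrable_gauss_tiltZ 2 c2 z isT)].
by apply: eq_Rintegral => l _; rewrite expr0 expr1; ring.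
Qed.

Lemma gauss_tilt_shift z c l :
  expR (l * z - l ^+ 2 / 2) = expR (l * (z - c)) * expR (l * c - l ^+ 2 / 2).
Proof. by rewrite -expRD; congr expR; ring. Qed.

(** [lap 1] and [lap 2] are the first two derivatives of [lap 0], but nothing is differentiated
    under the integral: this and the next two Taylor bounds integrate a pointwise bound on exp (l (z
    - c)) against the weight at [c]. *)
Lemma lap0_ge_tangent z c : lap 0 c + lap 1 c * (z - c) <= lap 0 z.
Proof.
have -> : lap 0 c + lap 1 c * (z - c) = 1 * lap 0 c + (z - c) * lap 1 c + 0 * lap 2 c by ring.
rewrite -lap_quad lap.unlock; apply: le_Rintegral => //.
- exact: integrable_gauss_tilt_quad.
- exact: integrable_gauss_tilt.
move=> l _; rewrite expr0 mul1r mul0r addr0 (gauss_tilt_shift z c).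
by rewrite ler_wpM2r ?expR_ge0// [_ * l]mulrC expR_ge1Dx.
Qed.

Lemma lap0_ge_taylor2 z c : c <= z ->
  lap 0 c + lap 1 c * (z - c) + lap 2 c / 2 * (z - c) ^+ 2 <= lap 0 z.
Proof.
move=> cz.
have -> : lap 0 c + lap 1 c * (z - c) + lap 2 c / 2 * (z - c) ^+ 2 =
  1 * lap 0 c + (z - c) * lap 1 c + ((z - c) ^+ 2 / 2) * lap 2 c by field.
rewrite -lap_quad lap.unlock; apply: le_Rintegral => //.
- exact: integrable_gauss_tilt_quad.
- exact: integrable_gauss_tilt.
move=> l /=; rewrite in_itv/= andbT => l0.
rewrite expr0 mul1r (gauss_tilt_shift z c) ler_wpM2r ?expR_ge0//.
apply: le_trans (expR_ge_taylor2 _ _); last by rewrite mulr_ge0// subr_ge0.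
by rewrite exprMn; lra.
Qed.

Lemma lap0_le_taylor2 z c : z <= c ->
  lap 0 z <= lap 0 c + lap 1 c * (z - c) + lap 2 c / 2 * (z - c) ^+ 2.
Proof.
move=> zc.
have -> : lap 0 c + lap 1 c * (z - c) + lap 2 c / 2 * (z - c) ^+ 2 =
  1 * lap 0 c + (z - c) * lap 1 c + ((z - c) ^+ 2 / 2) * lap 2 c by field.
rewrite -lap_quad lap.unlock; apply: le_Rintegral => //.
- exact: integrable_gauss_tilt.
- exact: integrable_gauss_tilt_quad.
move=> l /=; rewrite in_itv/= andbT => l0.
rewrite expr0 mul1r (gauss_tilt_shift z c) ler_wpM2r ?expR_ge0//.
apply: le_trans (expR_le_taylor2 _ _) _; first by rewrite mulr_ge0_le0// subr_le0.
by rewrite exprMn; lra.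
Qed.

(** On a half-line the fundamental theorem is applied to a nonnegative integrand, but the integrands
    below change sign near 0. Hence the split at [c], with the compact version on the left. *)
Lemma Rintegral0y_FTC (F f : R -> R) (c : R) : 0 < c ->
  (forall x, is_derive x 1 F (f x)) -> continuous f ->
  (forall x, c <= x -> 0 <= f x) -> F x @[x --> +oo] --> 0 ->
  mu.-integrable `[0%R, +oo[ (EFin \o f) ->
  \int[mu]_(x in `[0, +oo[) f x = - F 0.
Proof.
move=> c0 Ff cf f0 Fy intf.
have cF : continuous F by move=> x; apply/differentiable_continuous/derivable1_diffP; have [] := Ff x.
have split_itv : `[0%R, +oo[%classic = `[0%R, c]%classic `|` `]c, +oo[%classic.
  by rewrite -itv_bndbnd_setU// bnd_simp ltW.
have i0 : mu.-integrable `[0%R, c] (EFin \o f).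
  by apply: integrableS intf => //; rewrite split_itv.
rewrite /Rintegral split_itv integral_setU//=; last 2 first.
- by rewrite -split_itv; have /integrableP[] := intf.
- apply/disj_setPS => x /= []; rewrite !in_itv/= andbT => /andP[_ xc] cx.
  by move: (lt_le_trans cx xc); rewrite ltxx.
rewrite (@continuous_FTC2 _ f F)//; last 3 first.
- by apply: continuous_subspaceT.
- split => [x _||]; first by have [] := Ff x.
    by apply: cvg_at_right_filter; exact: cF.
  by apply: cvg_at_left_filter; exact: cF.
- by move=> x _; rewrite derive1E; apply: derive_val.
rewrite integral_itv_obnd_cbnd; last first.
  by apply: measurable_funTS; apply/measurable_EFinP; exact: continuous_measurable_fun.
rewrite (@ge0_continuous_FTC2y _ f F c 0)//; first by rewrite -!EFinB -EFinD /=; ring.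
- by apply: continuous_subspaceT.
- by apply: cvg_at_right_filter; exact: cF.
- by move=> x _; rewrite derive1E; apply: derive_val.
Qed.

Lemma gauss_tilt_cvg0 z : (l + 1) * expR (l * z - l ^+ 2 / 2) @[l --> +oo] --> 0.
Proof.
apply/cvgrPdist_lt => e e0; near=> l.
have l1 : 4 * `|z| + 1 < l by near: l; apply: nbhs_pinfty_gt; rewrite num_real.
have l2 : 8 / e < l by near: l; apply: nbhs_pinfty_gt; rewrite num_real.
have z0 := normr_ge0 z; have zz := ler_norm z.
have l0 : 0 < l by lra.
rewrite sub0r normrN ger0_norm ?mulr_ge0 ?expR_ge0//; last by lra.
(* Once l exceeds 4|z| + 1 the exponent is at most -l^2/4, and exp (l^2/4) >= 1 + l^2/4. This gives
   l^2 E <= 4, hence l (l + 1) E <= 8 < l e. *)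
have h : (1 + l ^+ 2 / 4) * expR (l * z - l ^+ 2 / 2) <= 1.
  rewrite -[leRHS](expRxMexpNx_1 (l ^+ 2 / 4)) ler_pM ?expR_ge0//.
  - by nra.
  - exact: expR_ge1Dx.
  - by rewrite ler_expR; nra.
have ex := expR_ge0 (l * z - l ^+ 2 / 2).
move: l2; rewrite ltr_pdivrMr// => l2.
have lz : l * z <= l * `|z| by rewrite ler_wpM2l// ltW.
rewrite -(ltr_pM2l l0).
apply: (@le_lt_trans _ _ 8); last by [].
move: h; set E := expR _ in ex * => h.
have : l ^+ 2 * E <= 4 by nra.
nra.
Unshelve. all: by end_near. Qed.

Lemma gauss_tilt_cvg0' z : expR (l * z - l ^+ 2 / 2) @[l --> +oo] --> 0.
Proof.
apply: (@squeeze_cvgr _ _ _ _ (fun=> 0) (fun l => (l + 1) * expR (l * z - l ^+ 2 / 2))).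
- near=> l; rewrite expR_ge0 ler_peMl ?expR_ge0// lerDr.
  by near: l; apply: nbhs_pinfty_ge; rewrite num_real.
- exact: cvg_cst.
- exact: gauss_tilt_cvg0.
Unshelve. all: by end_near. Qed.

Lemma is_derive_gauss_tilt z l : is_derive l 1
  (fun l => expR (l * z - l ^+ 2 / 2)) ((z - l) * expR (l * z - l ^+ 2 / 2)).
Proof.
apply: is_derive_eq.
by rewrite /GRing.scale /=; field.
Qed.

Lemma continuous_quad_gauss_tilt c0 c1 c2 z :
  continuous (fun l => (c0 + c1 * l + c2 * l ^+ 2) * expR (l * z - l ^+ 2 / 2)).
Proof.
have ce : continuous (fun l => expR (l * z - l ^+ 2 / 2)).
  move=> l; apply/differentiable_continuous/derivable1_diffP.
  by have [] := is_derive_gauss_tilt z l.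
move=> l; apply: cvgM; last exact: ce.
apply: cvgD; last by apply: cvgM; [exact: cvg_cst|exact: exprn_continuous].
by apply: cvgD; [exact: cvg_cst|apply: cvgM; [exact: cvg_cst|exact: cvg_id]].
Qed.

(** Integration by parts: (l - z) exp (l z - l^2/2) is a total derivative. Together with [lap2E]
    this is the differential equation m' = z m + 1 and its derivative, through which every
    smooth-fit computation becomes algebra. *)
Lemma lap1E z : lap 1 z = z * lap 0 z + 1.
Proof.
suff : lap 1 z - z * lap 0 z = 1 by move=> <-; ring.
have -> : lap 1 z - z * lap 0 z = (- z) * lap 0 z + 1 * lap 1 z + 0 * lap 2 z by ring.
rewrite -lap_quad; transitivity (- (- expR (0 * z - 0 ^+ 2 / 2))); last first.
  by rewrite mul0r expr0n /= mul0r subr0 expR0 opprK.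
apply: (@Rintegral0y_FTC (fun l => - expR (l * z - l ^+ 2 / 2)) _ (`|z| + 1)).
- by rewrite ltr_wpDl.
- by move=> x; apply: is_derive_eq; rewrite /GRing.scale /=; field.
- exact: continuous_quad_gauss_tilt.
- move=> x zx; rewrite mulr_ge0 ?expR_ge0//.
  by have := ler_norm z; lra.
- by rewrite -oppr0; apply: cvgN; exact: gauss_tilt_cvg0'.
- exact: integrable_gauss_tilt_quad.
Qed.

Lemma lap2E z : lap 2 z = z * lap 1 z + lap 0 z.
Proof.
suff : lap 2 z - z * lap 1 z - lap 0 z = 0 by move=> h; rewrite -[LHS]subr0 -h; ring.
have -> : lap 2 z - z * lap 1 z - lap 0 z = (- 1) * lap 0 z + (- z) * lap 1 z + 1 * lap 2 z by ring.
rewrite -lap_quad; transitivity (- (- (0 * expR (0 * z - 0 ^+ 2 / 2)))); last first.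
  by rewrite mul0r !oppr0.
apply: (@Rintegral0y_FTC (fun l => - (l * expR (l * z - l ^+ 2 / 2))) _ (`|z| + 1)).
- by rewrite ltr_wpDl.
- by move=> x; apply: is_derive_eq; rewrite /GRing.scale /=; field.
- exact: continuous_quad_gauss_tilt.
- move=> x zx; rewrite mulr_ge0 ?expR_ge0//.
  by have := ler_norm z; have := normr_ge0 z; nra.
- rewrite -oppr0; apply: cvgN.
  have -> : (fun l => l * expR (l * z - l ^+ 2 / 2)) =
    (fun l => (l + 1) * expR (l * z - l ^+ 2 / 2) - expR (l * z - l ^+ 2 / 2)).
    by apply/funext => l; ring.
  by rewrite -[0 in X in _ --> X](subr0 0); apply: cvgB;
    [exact: gauss_tilt_cvg0|exact: gauss_tilt_cvg0'].
- exact: integrable_gauss_tilt_quad.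
Qed.

Lemma normal_pdf01E x : normal_pdf 0 1 x = (Num.sqrt (pi *+ 2))^-1 * expR (- (x ^+ 2) / 2) :> R.
Proof.
by rewrite normal_pdfE ?oner_eq0// /normal_peak /normal_fun expr1n mul1r subr0 mulNr.
Qed.

Lemma is_derive_Phi z : is_derive z 1 (@Phi R) (normal_pdf 0 1 z).
Proof.
have zz1 : z < z + 1 by rewrite ltrDl.
have [] := @continuous_FTC1 R (normal_pdf 0 1) -oo%O z (z + 1) zz1.
- by apply: integrableS (integrable_normal_pdf 0 1).
- by rewrite ltNyr.
- exact: continuous_normal_pdf (oner_neq0 _) z.
by move=> dF <-; rewrite derive1E; exact: derivableP.
Qed.

Lemma ge0_integral_affine (G : R -> R) (a b : R) : 0 < a -> continuous G ->
  (forall x, 0 <= G x) ->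
  (\int[mu]_(x in `[b, +oo[) (G x)%:E =
   \int[mu]_(x in `[0%R, +oo[) (G (a * x + b) * a)%:E)%E.
Proof.
move=> a0 cG G0.
have dF x : is_derive x 1 (fun x : R => a * x + b) a.
  by apply: is_derive_eq; rewrite /GRing.scale /=; ring.
have dFE : (fun x : R => a * x + b)^`()%classic = cst a.
  by apply/funext => x; rewrite derive1E; apply: derive_val.
have cF : continuous (fun x : R => a * x + b).
  by move=> x; apply/differentiable_continuous/derivable1_diffP; have [] := dF x.
have := @increasing_ge0_integration_by_substitutiony R (fun x => a * x + b) G 0.
rewrite dFE mulr0 add0r; apply.
- by move=> x y _ _ xy; rewrite ltrD2r ltr_pM2l.
- by move=> x _; exact: cst_continuous.
- exact: is_cvg_cst.
- exact: is_cvg_cst.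
- split; last by apply: cvg_at_right_filter; exact: cF.
  by move=> x _; have [] := dF x.
- apply/cvgryPge => A; near=> x.
  have : (A - b) / a <= x by near: x; apply: nbhs_pinfty_ge; rewrite num_real.
  by rewrite ler_pdivrMr// => h; lra.
- exact: continuous_subspaceT.
- by [].
Unshelve. all: by end_near. Qed.

Lemma lapE k z : (k <= 2)%N ->
  ((lap k z)%:E = \int[mu]_(l in `[0%R, +oo[) (l ^+ k * expR (l * z - l ^+ 2 / 2))%:E)%E.
Proof.
by move=> k2; rewrite lap.unlock /Rintegral fineK//; apply: integrable_fin_num => //; exact: integrable_gauss_tilt.
Qed.

Lemma lap0_Phi z : lap 0 z = Num.sqrt (pi *+ 2) * expR (z ^+ 2 / 2) * Phi z.
Proof.
have s2 : Num.sqrt (pi *+ 2) != 0 :> R by rewrite gt_eqF// sqrtr_gt0 mulrn_wgt0 ?pi_gt0.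
have cG : continuous (normal_pdf 0 1 : R -> R) by exact: continuous_normal_pdf (oner_neq0 _).
have G0 x : 0 <= normal_pdf 0 1 x :> R := normal_pdf_ge0 0 1 x.
have GN : (normal_pdf 0 1 : R -> R) \o -%R = normal_pdf 0 1.
  by apply/funext => x /=; rewrite !normal_pdf01E sqrrN.
rewrite /Phi /normal_prob -[X in `]-oo, X]]opprK ge0_integration_by_substitutionNy//; last first.
  exact: continuous_subspaceT.
rewrite GN (@ge0_integral_affine _ 1)//.
transitivity (Num.sqrt (pi *+ 2) * expR (z ^+ 2 / 2) *
  fine (((Num.sqrt (pi *+ 2) * expR (z ^+ 2 / 2))^-1)%:E * (lap 0 z)%:E)%E).
  by rewrite /= mulrA mulfV ?mul1r// mulf_neq0// gt_eqF ?expR_gt0.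
congr (_ * fine _); rewrite lapE// -integralZl//; last exact: integrable_gauss_tilt.
apply: eq_integral => l _; rewrite -EFinM mulr1 mul1r expr0 mul1r normal_pdf01E invfM.
by rewrite -mulrA -expRN -expRD; congr (EFin (_ * expR _)); field.
Qed.

Definition G (r y : R) := lap 0 (y / Num.sqrt r) / Num.sqrt r.

Lemma G_integral r y : 0 < r ->
  ((G r y)%:E = \int[mu]_(l in `[0%R, +oo[) (expR (l * y - l ^+ 2 * r / 2))%:E)%E.
Proof.
move=> r0; have s0 : 0 < Num.sqrt r by rewrite sqrtr_gt0.
have ce : continuous (fun l => expR (l * y - l ^+ 2 * r / 2)).
  move=> l; apply/differentiable_continuous/derivable1_diffP.
  by apply: ex_derive.
rewrite (@ge0_integral_affine _ (Num.sqrt r)^-1 0) ?invr_gt0//.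
rewrite /G EFinM lapE// -integralZr//; last exact: integrable_gauss_tilt.
apply: eq_integral => l _; rewrite -EFinM expr0 mul1r addr0; congr (EFin (expR _ * _)).
by rewrite exprMn exprVn sqr_sqrtr ?ltW//; field; rewrite !gt_eqF.
Qed.

(** If m vanished at [z], the tangent inequality at [z - 1] would force both m and m' to vanish
    there, against m' = z m + 1. *)
Lemma lap0_gt0 z : 0 < lap 0 z.
Proof.
rewrite lt_neqAle lap_ge0 andbT; apply/eqP => z0.
have := lap0_ge_tangent z (z - 1); rewrite -z0 lap1E.
have := lap_ge0 0 (z - 1); have := lap_ge0 1 (z - 1); rewrite lap1E.
set m := lap 0 _ => h1 h2 h3.
have m0 : m = 0 by lra.
by move: h3; rewrite m0; lra.
Qed.

Lemma sqrt_2pi_gt0 : 0 < Num.sqrt (pi *+ 2) :> R.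
Proof. by rewrite sqrtr_gt0 mulrn_wgt0 ?pi_gt0. Qed.

Lemma Phi_gt0 z : 0 < Phi z.
Proof.
have := lap0_gt0 z.
by rewrite lap0_Phi pmulr_rgt0// mulr_gt0 ?expR_gt0 ?sqrt_2pi_gt0.
Qed.

Lemma PhiN z : Phi (- z) = 1 - Phi z.
Proof.
have cG : continuous (normal_pdf 0 1 : R -> R) by exact: continuous_normal_pdf (oner_neq0 _).
have G0 x : 0 <= normal_pdf 0 1 x :> R := normal_pdf_ge0 0 1 x.
have GN : (normal_pdf 0 1 : R -> R) \o -%R = normal_pdf 0 1.
  by apply/funext => x /=; rewrite !normal_pdf01E sqrrN.
have -> : Phi (- z) = fine (normal_prob 0 1 `]z, +oo[).
  rewrite /Phi /normal_prob ge0_integration_by_substitutionNy ?GN//; last first.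
    exact: continuous_subspaceT.
  rewrite integral_itv_obnd_cbnd//; apply/measurable_EFinP; apply: measurable_funTS.
  exact: measurable_normal_pdf.
rewrite -setCitvl probability_setC//= fineB//.
exact: fin_num_measure.
Qed.

Lemma lap0DN z : lap 0 z + lap 0 (- z) = Num.sqrt (pi *+ 2) * expR (z ^+ 2 / 2).
Proof. by rewrite !lap0_Phi sqrrN PhiN; ring. Qed.

Lemma upper_boundary_eq B :
  Num.sqrt (pi *+ 2) * (1 - B ^+ 2) * expR (B ^+ 2 / 2) * Phi B = B ->
  (1 - B ^+ 2) * lap 0 B = B.
Proof. by move=> h; rewrite -[RHS]h lap0_Phi; ring. Qed.

(** Value matching at [C]: this is what the formula for [v_fun] encodes, for any [C]. The choice of
    [C] as a zero of [u_fun] enters only through the slope. *)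
Lemma v_fun_lap B C : v_fun B C * lap 0 (- C) = (1 - B ^+ 2) * lap 0 C - C.
Proof.
have P0 : Phi (- C) != 0 by rewrite gt_eqF ?Phi_gt0.
have s0 : Num.sqrt (pi *+ 2) != 0 :> R by rewrite gt_eqF ?sqrt_2pi_gt0.
rewrite !lap0_Phi sqrrN /v_fun mulNr expRN.
have e0 : expR (C ^+ 2 / 2) != 0 by rewrite gt_eqF ?expR_gt0.
by field; rewrite P0 s0 e0.
Qed.

Lemma lower_boundary_eq B C : u_fun B C = 0 ->
  (1 - B ^+ 2) * (lap 0 C + lap 0 (- C)) = (1 - C ^+ 2) * lap 0 (- C) + C.
Proof.
have s0 : Num.sqrt (pi *+ 2) != 0 :> R by rewrite gt_eqF ?sqrt_2pi_gt0.
have e0 : expR (C ^+ 2 / 2) != 0 by rewrite gt_eqF ?expR_gt0.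
rewrite /u_fun mulNr expRN => u0.
rewrite lap0DN lap0_Phi sqrrN.
have -> : 1 - B ^+ 2 = (1 - C ^+ 2) * Phi (- C) + C / Num.sqrt (pi *+ 2) * (expR (C ^+ 2 / 2))^-1.
  by rewrite -[LHS](subr0 _) -[X in _ - X]u0; ring.
by field; rewrite s0 e0.
Qed.

(** This closed form of v is what turns value matching at [C] into smooth fit, see [v_slope]. *)
Lemma v_fun_eq B C : u_fun B C = 0 -> v_fun B C = B ^+ 2 - C ^+ 2.
Proof.
move=> /lower_boundary_eq h.
have l0 : lap 0 (- C) != 0 by rewrite gt_eqF ?lap0_gt0.
apply: (mulIf l0); rewrite v_fun_lap.
by move: h; move: (lap 0 C) (lap 0 (- C)) => p q; lra.
Qed.

(** In [lower_boundary_eq] the left side is positive and the summand [C] is negative, so (1 - C^2)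
    m(-C) is positive. The bound feeds the condition b^2 <= 2 of [kink_bound]. *)
Lemma lower_boundary_gtN1 B C : C < 0 -> u_fun B C = 0 -> 0 < 1 - B ^+ 2 -> C ^+ 2 < 1.
Proof.
move=> C0 /lower_boundary_eq; have := lap0_gt0 (- C); have := lap0_gt0 C.
move: (lap 0 C) (lap 0 (- C)) (1 - B ^+ 2) => p q a; nra.
Qed.

End analysis.
Global Opaque Phi.

(** * Value matching, smooth fit and convexity at the two boundaries *)

Section boundaries.
Context {R : realType}.
Implicit Types z : R.
Variables B C a v : R.
Hypotheses (B0 : 0 < B) (aE : a = 1 - B ^+ 2) (lB : a * lap 0 B = B).
Hypotheses (C0 : C < 0) (vE : v = B ^+ 2 - C ^+ 2).
Hypothesis vC : v * lap 0 (- C) = a * lap 0 C - C.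

Lemma a_gt0 : 0 < a.
Proof. by have l0 := lap0_gt0 B; rewrite -(pmulr_lgt0 _ l0) lB. Qed.

(** Smooth fit at [B]. It follows from value matching alone, because the coefficient is 1 - B^2 and
    m' = z m + 1. The tangent of the convex function a m at [B] is therefore the diagonal, which is
    [le_lap0]. *)
Lemma slope_lap0B : a * lap 1 B = 1.
Proof. by rewrite lap1E mulrDr mulrCA lB aE; ring. Qed.

Lemma le_lap0 z : z <= a * lap 0 z.
Proof.
have := lap0_ge_tangent z B; rewrite -(ler_pM2l a_gt0).
have -> : a * (lap 0 B + lap 1 B * (z - B)) = a * lap 0 B + a * lap 1 B * (z - B) by ring.
by rewrite slope_lap0B lB mul1r addrC subrK.
Qed.

(** After value matching and smooth fit only the second order term is left; its constant is half of
    a m''(B) = 2 B. *)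
Lemma lap0_le_below z : z <= B -> a * lap 0 z - z <= B * (z - B) ^+ 2.
Proof.
have l2 : a * lap 2 B = 2 * B by rewrite lap2E mulrDr mulrCA slope_lap0B lB; ring.
move=> /lap0_le_taylor2; rewrite -(ler_pM2l a_gt0).
have -> : a * (lap 0 B + lap 1 B * (z - B) + lap 2 B / 2 * (z - B) ^+ 2) =
   a * lap 0 B + a * lap 1 B * (z - B) + a * lap 2 B / 2 * (z - B) ^+ 2 by ring.
rewrite slope_lap0B l2 lB.
by move: (a * lap 0 z) => w; lra.
Qed.

Lemma v_gt0 : 0 < v.
Proof.
have l0 := lap0_gt0 (- C).
by rewrite -(pmulr_lgt0 _ l0) vC subr_gt0 (lt_trans C0)// mulr_gt0 ?a_gt0 ?lap0_gt0.
Qed.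

(** Smooth fit at [C]. By m' = z m + 1 and value matching both sides become C a m(C) - B^2, and v =
    B^2 - C^2 is exactly the value that makes this work. *)
Lemma v_slope : - (v * lap 1 (- C)) = a * lap 1 C - 1.
Proof.
rewrite !lap1E.
transitivity (C * (v * lap 0 (- C)) - v); first ring.
rewrite vC vE aE; ring.
Qed.

(** Excess of the continuation branch of [Vf] over its stopping branch, in units of 1 / sqrt r. It
    vanishes to first order at [C]. *)
Definition qfun z := v * lap 0 (- z) - a * lap 0 z + z.

(** The two Laplace functions are evaluated at -z <= -C and z >= C, so that the Taylor bounds go up
    for the first and down for the second. The constant is half of v m''(-C) - a m''(C) = -2 C. *)
Lemma qfun_le_above z : C <= z -> qfun z <= - C * (z - C) ^+ 2.
Proof.
move=> Cz.
have h1 : lap 0 (- z) <= lap 0 (- C) + lap 1 (- C) * (- z - - C) + lap 2 (- C) / 2 * (- z - - C) ^+ 2.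
  by apply: lap0_le_taylor2; rewrite lerN2.
have h2 := lap0_ge_taylor2 z C Cz.
rewrite -(ler_pM2l v_gt0) in h1; rewrite -(ler_pM2l a_gt0) in h2.
have e3 : v * lap 2 (- C) = a * lap 2 C - 2 * C.
  rewrite !lap2E; transitivity (C * (- (v * lap 1 (- C))) + v * lap 0 (- C)); first ring.
  by rewrite vC v_slope; ring.
have {}h1 : v * lap 0 (- z) <= v * lap 0 (- C) + (- (v * lap 1 (- C))) * (z - C) + v * lap 2 (- C) / 2 * (z - C) ^+ 2.
  by apply: le_trans h1 _; rewrite le_eqVlt; apply/orP; left; apply/eqP; field.
have {}h2 : a * lap 0 C + a * lap 1 C * (z - C) + a * lap 2 C / 2 * (z - C) ^+ 2 <= a * lap 0 z.
  by apply: le_trans h2; rewrite le_eqVlt; apply/orP; left; apply/eqP; field.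
move: h1 h2; rewrite /qfun e3 vC v_slope.
move: (v * lap 0 (- z)) (a * lap 0 z) (a * lap 2 C) (a * lap 0 C) (a * lap 1 C).
by move=> p1 p2 p3 p4 p5; lra.
Qed.

(* [qfun z] divided by [sqrt (2 pi) * expR (z ^+ 2 / 2)]; its derivative has the sign of [C ^+ 2 - z ^+ 2]. *)
Let pfun z := (1 - C ^+ 2) * (1 - Phi z) - a + z * normal_pdf 0 1 z.

Let qfun_pfun z : qfun z = Num.sqrt (pi *+ 2) * expR (z ^+ 2 / 2) * pfun z.
Proof.
have s0 : Num.sqrt (pi *+ 2) != 0 :> R by rewrite gt_eqF ?sqrt_2pi_gt0.
have e0 : expR (z ^+ 2 / 2) != 0 by rewrite gt_eqF ?expR_gt0.
rewrite /qfun /pfun !lap0_Phi sqrrN PhiN normal_pdf01E mulNr expRN vE aE.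
by field; rewrite s0 e0.
Qed.

Let is_derive_pfun z : is_derive z 1 pfun ((C ^+ 2 - z ^+ 2) * normal_pdf 0 1 z).
Proof.
have dphi : is_derive z 1 (normal_pdf 0 1 : R -> R) (- z * normal_pdf 0 1 z).
  have -> : normal_pdf 0 1 = (fun x : R => (Num.sqrt (pi *+ 2))^-1 * expR (- (x ^+ 2) / 2)).
    by apply/funext => x; rewrite normal_pdf01E.
  by apply: is_derive_eq; rewrite /GRing.scale /=; field; rewrite gt_eqF ?sqrt_2pi_gt0.
have dPhi := is_derive_Phi z.
by apply: is_derive_eq; rewrite /GRing.scale /=; ring.
Qed.

(** [pfun] decreases up to [C], increases on [C, -C] and decreases afterwards. It vanishes at [C],
    which settles the first two pieces; on the third it is bounded below by its value at [B], which
    is nonnegative because a m(B) = B leaves only v m(-B). This is why the claim stops at [B]. *)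
Lemma qfun_ge0 z : z <= B -> 0 <= qfun z.
Proof.
move=> zB.
have s0 : 0 < Num.sqrt (pi *+ 2) :> R by exact: sqrt_2pi_gt0.
have qp x : (0 <= qfun x) = (0 <= pfun x).
  by rewrite qfun_pfun pmulr_rge0// mulr_gt0// expR_gt0.
have pC : 0 <= pfun C by rewrite -qp /qfun vC addrAC subrK subrr.
have phi0 x : 0 <= normal_pdf 0 1 x :> R := normal_pdf_ge0 0 1 x.
have dN (x : R) : is_derive x 1 (fun y : R => - pfun y) (- ((C ^+ 2 - x ^+ 2) * normal_pdf 0 1 x)).
  by have d := is_derive_pfun x; apply: is_deriveN.
rewrite qp; have [zC|Cz] := leP z C.
  apply: (le_trans pC); rewrite -lerN2.
  apply: (le_of_derive _ _ z C zC dN) => x /andP[zx xC].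
  rewrite -mulNr opprB mulr_ge0//.
  have -> : x ^+ 2 - C ^+ 2 = (C - x) * (- C - x) by ring.
  by apply: mulr_ge0; rewrite subr_ge0 ltW// (lt_trans xC)// (lt_trans C0)// oppr_gt0.
have [zC|CNz] := leP z (- C).
  apply: (le_trans pC).
  apply: (le_of_derive _ _ C z (ltW Cz) is_derive_pfun) => x /andP[Cx xz].
  rewrite mulr_ge0//.
  have -> : C ^+ 2 - x ^+ 2 = (x - C) * (- C - x) by ring.
  by apply: mulr_ge0; rewrite subr_ge0 ltW// (lt_le_trans xz).
have pB : 0 <= pfun B.
  by rewrite -qp /qfun lB subrK mulr_ge0 ?lap_ge0// ltW ?v_gt0.
apply: (le_trans pB); rewrite -lerN2.
apply: (le_of_derive _ _ z B zB dN) => x /andP[zx xB].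
rewrite -mulNr opprB mulr_ge0//.
have -> : x ^+ 2 - C ^+ 2 = (x - C) * (x - - C) by ring.
by apply: mulr_ge0; rewrite subr_ge0 ltW// ?(lt_trans Cz)// (lt_trans CNz).
Qed.

End boundaries.

(** * The boundary functions *)

Section step_bounds.
Context {R : realType}.
Implicit Types r y d : R.

(** The left side is the linear reward after the step plus the quadratic penalty of the Taylor
    bounds. On the right, the coefficients of [d] and [d ^+ 2] are those of the expanded left side,
    so that terms with conditional mean at most 0 carry all the dependence on [d]. *)
Lemma kink_bound (b r r' y d : R) : 0 < b -> b ^+ 2 <= 2 -> 0 < r -> r <= r' ->
  b * Num.sqrt r <= y ->
  (y + d) / r' + b / Num.sqrt r' * (b * (1 - Num.sqrt r / Num.sqrt r') - d / Num.sqrt r') ^+ 2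
  <= y / r + (r'^-1 - 2 * b ^+ 2 * (1 - Num.sqrt r / Num.sqrt r') / r') * d
     + b / (Num.sqrt r' * r') * (d ^+ 2 - (r' - r)).
Proof.
move=> b0 b2 r0 rr by_.
have r'0 : 0 < r' by exact: lt_le_trans rr.
have rE : r = Num.sqrt r ^+ 2 by rewrite sqr_sqrtr// ltW.
have r'E : r' = Num.sqrt r' ^+ 2 by rewrite sqr_sqrtr// ltW.
have ss : Num.sqrt r <= Num.sqrt r' by exact: ler_wsqrtr.
have s0 : 0 < Num.sqrt r by rewrite sqrtr_gt0.
have s'0 : 0 < Num.sqrt r' by rewrite sqrtr_gt0.
move: (Num.sqrt r) (Num.sqrt r') by_ ss s0 s'0 rE r'E => s s' by_ ss s0 s'0 -> ->.
rewrite -subr_ge0.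
(* The difference is free of [d]. Its first summand is the drift gained by starting beyond the
   boundary; the second is nonnegative because s' + s >= 2 s >= b^2 s. *)
have -> : y / s ^+ 2 + ((s' ^+ 2)^-1 - 2 * b ^+ 2 * (1 - s / s') / s' ^+ 2) * d
     + b / (s' * s' ^+ 2) * (d ^+ 2 - (s' ^+ 2 - s ^+ 2))
  - ((y + d) / s' ^+ 2 + b / s' * (b * (1 - s / s') - d / s') ^+ 2) =
  (y - b * s) * ((s' - s) * (s' + s) / (s * s') ^+ 2)
  + b / (s * s' ^+ 3) * ((s' - s) ^+ 2 * (s' + s - b ^+ 2 * s)).
  by field; rewrite !gt_eqF.
rewrite addr_ge0// mulr_ge0 ?subr_ge0//.
- by rewrite divr_ge0 ?exprn_even_ge0// mulr_ge0 ?subr_ge0// addr_ge0 ?ltW.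
- by rewrite divr_ge0 ?mulr_ge0 ?exprn_ge0 ?ltW.
- rewrite mulr_ge0 ?exprn_even_ge0// subr_ge0.
  apply: (@le_trans _ _ (2 * s)); first by rewrite ler_wpM2r// ltW.
  by rewrite mulr_natl mulr2n lerD2r.
Qed.

(** If the step ends below the boundary, the shortfall is nonnegative and is largest for a start
    exactly on the boundary, y = b sqrt r, where it equals the base on the right. *)
Lemma sqr_shortfall (b r r' y d : R) : 0 < r -> 0 < r' ->
  b * Num.sqrt r <= y -> (y + d) / Num.sqrt r' <= b ->
  ((y + d) / Num.sqrt r' - b) ^+ 2 <=
  (b * (1 - Num.sqrt r / Num.sqrt r') - d / Num.sqrt r') ^+ 2.
Proof.
move=> r0 r'0 by_ yd.
have s'0 : 0 < Num.sqrt r' by rewrite sqrtr_gt0.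
have h : b - (y + d) / Num.sqrt r' <=
    b * (1 - Num.sqrt r / Num.sqrt r') - d / Num.sqrt r'.
  have : b * Num.sqrt r / Num.sqrt r' <= y / Num.sqrt r' by rewrite ler_pM2r ?invr_gt0.
  by rewrite mulrBr mulrA mulrDl mulr1; move: (_ / _) (_ / _) (_ / _) => p q w; lra.
rewrite -sqrrN opprB ler_sqr ?nnegrE ?subr_ge0//.
by rewrite -subr_ge0; apply: le_trans h; rewrite subr_ge0.
Qed.

Lemma G_gt0 r y : 0 < r -> 0 < G r y.
Proof. by move=> r0; rewrite divr_gt0 ?lap0_gt0// sqrtr_gt0. Qed.

Lemma continuous_lap0 : continuous (lap 0 : R -> R).
Proof.
have -> : lap 0 = (fun z : R => Num.sqrt (pi *+ 2) * expR (z ^+ 2 / 2) * Phi z).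
  by apply/funext => z; rewrite lap0_Phi.
move=> z; apply/differentiable_continuous/derivable1_diffP.
by have dPhi := is_derive_Phi z; apply: ex_derive.
Qed.

(** With z = y / sqrt r the right side is sqrt (2 pi) exp (z^2/2) / sqrt r and the left side z^2 /
    r. It remains to use r >= sqrt r, sqrt (2 pi) >= 2 and exp (z^2/2) >= z^2/2. *)
Lemma sqr_le_G r y : 1 <= r -> (y / r) ^+ 2 <= G r y + G r (- y).
Proof.
move=> r1; have r0 : 0 < r by exact: lt_le_trans r1.
have s1 : 1 <= Num.sqrt r by rewrite -[leLHS]sqrtr1 ler_wsqrtr.
have s0 : 0 < Num.sqrt r by exact: lt_le_trans s1.
rewrite /G -mulrDl mulNr lap0DN ler_pdivlMr//.
have -> : (y / r) ^+ 2 = (y / Num.sqrt r) ^+ 2 / r.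
  by rewrite !expr_div_n sqr_sqrtr ?ltW//; field; rewrite gt_eqF.
move: (y / Num.sqrt r) => z.
apply: (@le_trans _ _ (z ^+ 2)).
  rewrite -mulrA ler_piMr ?sqr_ge0//.
  by rewrite -{1}(sqr_sqrtr (ltW r0)) expr2 invfM mulfVK ?gt_eqF// invf_le1.
apply: (@le_trans _ _ (2 * (z ^+ 2 / 2))); first by rewrite mulrC divfK.
apply: ler_pM => //; first by rewrite divr_ge0 ?sqr_ge0.
  have <- : Num.sqrt (2 ^+ 2) = 2 :> R by rewrite sqrtr_sqr ger0_norm.
  rewrite ler_wsqrtr// -mulr_natr.
  have := @pi_ge2 R; lra.
by apply: le_trans (expR_ge1Dx _); rewrite lerDr.
Qed.

Section boundaries.
Variables B C a v : R.
Hypotheses (B0 : 0 < B) (aE : a = 1 - B ^+ 2) (lB : a * lap 0 B = B).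
Hypotheses (C0 : C < 0) (vE : v = B ^+ 2 - C ^+ 2) (C1 : C ^+ 2 < 1).
Hypothesis vC : v * lap 0 (- C) = a * lap 0 C - C.

(* The paper's [U] and [V*] in the coordinates [r = (1 - t)^-1], [y = x / (1 - t)]. *)
Definition Uf r y := if y < B * Num.sqrt r then a * G r y else y / r.
Definition Vf r y := if C * Num.sqrt r < y then v * G r (- y) else a * G r y - y / r.

Let a0 : 0 < a := a_gt0 B a B0 lB.
Let v0 : 0 < v := v_gt0 B C a v B0 lB C0 vC.

Lemma divr_sqrt r y : 0 < r -> y / r = (y / Num.sqrt r) / Num.sqrt r.
Proof. by move=> r0; rewrite -{1}(sqr_sqrtr (ltW r0)) expr2 invfM mulrA. Qed.

Lemma le_aG r y : 0 < r -> y / r <= a * G r y.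
Proof.
move=> r0; rewrite divr_sqrt// /G mulrA ler_pM2r ?invr_gt0 ?sqrtr_gt0//.
exact: (le_lap0 B a B0 aE lB).
Qed.

Lemma Uf_ge r y : 0 < r -> y / r <= Uf r y.
Proof. by move=> r0; rewrite /Uf; case: ifP => // _; exact: le_aG. Qed.

Lemma Uf_le r y : 0 < r -> Uf r y <= a * G r y.
Proof. by move=> r0; rewrite /Uf; case: ifP => // _; exact: le_aG. Qed.

Lemma Uf_ge0 r y : 0 < r -> 0 <= Uf r y.
Proof.
move=> r0; rewrite /Uf; case: ltP => [_|By].
  by rewrite ltW// mulr_gt0// G_gt0.
by rewrite divr_ge0 ?(ltW r0)// (le_trans _ By)// mulr_ge0 ?sqrtr_ge0 ?ltW.
Qed.

Lemma Uf_le_quad r y b : 0 < r -> 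
  (y / Num.sqrt r <= B -> (y / Num.sqrt r - B) ^+ 2 <= b) -> 0 <= b ->
  Uf r y <= y / r + B / Num.sqrt r * b.
Proof.
move=> r0 hb b0; have s0 : 0 < Num.sqrt r by rewrite sqrtr_gt0.
rewrite /Uf; case: ltP => [yB|_]; last first.
  by rewrite lerDl mulr_ge0// divr_ge0 ?ltW.
have zB : y / Num.sqrt r <= B by rewrite ler_pdivrMr// ltW.
rewrite -lerBlDl divr_sqrt// /G mulrA -mulrBl mulrAC ler_pM2r ?invr_gt0//.
apply: le_trans (lap0_le_below B a B0 aE lB _ zB) _.
by rewrite ler_pM2l// hb.
Qed.

Lemma Uf_step r r' y d : 0 < r -> r <= r' -> B * Num.sqrt r <= y ->
  Uf r' (y + d) <=
    y / r + (r'^-1 - 2 * B ^+ 2 * (1 - Num.sqrt r / Num.sqrt r') / r') * d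
     + B / (Num.sqrt r' * r') * (d ^+ 2 - (r' - r)).
Proof.
move=> r0 rr yB; have r'0 := lt_le_trans r0 rr.
apply: le_trans (kink_bound B r r' y d B0 _ r0 rr yB); last by move: a0; rewrite aE; lra.
apply: Uf_le_quad => // [zB|]; last exact: sqr_ge0.
exact: sqr_shortfall.
Qed.

Lemma VfE r y : 0 < r -> Vf r y = a * G r y - y / r +
  (if C * Num.sqrt r < y then qfun a v (y / Num.sqrt r) / Num.sqrt r else 0).
Proof.
move=> r0; rewrite /Vf; case: ifP => _; last by rewrite addr0.
by rewrite /qfun divr_sqrt// /G mulNr; ring.
Qed.

Lemma Vf_ge0 r y : 0 < r -> 0 <= Vf r y.
Proof.
move=> r0; rewrite /Vf; case: ifP => _; last by rewrite subr_ge0 le_aG.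
by rewrite ltW// mulr_gt0// G_gt0.
Qed.

Lemma Vf_le r y : 0 < r -> Vf r y <= v * G r (- y).
Proof.
move=> r0; rewrite /Vf; case: ltP => // yC.
have s0 : 0 < Num.sqrt r by rewrite sqrtr_gt0.
rewrite -subr_ge0.
have -> : v * G r (- y) - (a * G r y - y / r) = qfun a v (y / Num.sqrt r) / Num.sqrt r.
  by rewrite /qfun [y / r]divr_sqrt// /G mulNr; ring.
apply: divr_ge0; last exact: sqrtr_ge0.
apply: (qfun_ge0 B C a v B0 aE lB C0 vE vC).
by rewrite ler_pdivrMr// (le_trans yC)// ler_pM2r// ltW// (lt_trans C0).
Qed.

Lemma Uf_le_Vf r y : 0 < r -> Uf r y - y / r <= Vf r y.
Proof.
move=> r0; rewrite VfE// /Uf; have s0 : 0 < Num.sqrt r by rewrite sqrtr_gt0.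
case: ltP => yB; last first.
  rewrite subrr -VfE//; exact: Vf_ge0.
rewrite lerDl; case: ifP => // _.
apply: divr_ge0; last exact: sqrtr_ge0.
apply: (qfun_ge0 B C a v B0 aE lB C0 vE vC).
by rewrite ler_pdivrMr// ltW.
Qed.

(** Reflecting to -C, -y and -d turns the lower boundary into the situation of [kink_bound]. The
    term [a * G r' (y + d)] is kept as it is, being a martingale; only the linear reward and the
    excess [qfun] need a bound. *)
Lemma Vf_step r r' y d : 0 < r -> r <= r' -> y <= C * Num.sqrt r ->
  Vf r' (y + d) <= a * G r' (y + d) - y / r
    - (r'^-1 - 2 * C ^+ 2 * (1 - Num.sqrt r / Num.sqrt r') / r') * d
     + - C / (Num.sqrt r' * r') * (d ^+ 2 - (r' - r)).
Proof.
move=> r0 rr yC; have r'0 := lt_le_trans r0 rr.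
have s'0 : 0 < Num.sqrt r' by rewrite sqrtr_gt0.
have NC0 : 0 < - C by rewrite oppr_gt0.
have NyC : - C * Num.sqrt r <= - y by rewrite mulNr lerN2.
have := kink_bound (- C) r r' (- y) (- d) NC0 _ r0 rr NyC.
rewrite !sqrrN => /(_ _) kb; have {}kb := kb (ltW (lt_le_trans C1 (ler1n _ 2))).
rewrite VfE// -!addrA lerD2l.
have NE : (- y - d) / r' = - ((y + d) / r') by rewrite -mulNr opprD.
have Nz : (- y - d) / Num.sqrt r' = - ((y + d) / Num.sqrt r') by rewrite -mulNr opprD.
move: kb; rewrite NE; set b := (X in _ / _ * X) => kb.
have bz : (if C * Num.sqrt r' < y + d then qfun a v ((y + d) / Num.sqrt r') / Num.sqrt r' else 0) <= - C / Num.sqrt r' * b.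
  case: ltP => Cy; last by rewrite mulr_ge0 ?sqr_ge0// divr_ge0 ?ltW.
  have Cz : C <= (y + d) / Num.sqrt r' by rewrite ler_pdivlMr// ltW.
  rewrite [leRHS]mulrAC ler_pM2r ?invr_gt0//.
  apply: le_trans (qfun_le_above B C a v B0 aE lB C0 vE vC _ Cz) _.
  rewrite ler_pM2l//.
  have := sqr_shortfall (- C) r r' (- y) (- d) r0 r'0 NyC.
  by rewrite Nz lerN2 => /(_ Cz); rewrite -opprD sqrrN.
apply: (@le_trans _ _ (- ((y + d) / r') + - C / Num.sqrt r' * b)); first by rewrite lerD2l.
by apply: le_trans kb _; rewrite mulNr mulrN -addrA.
Qed.

End boundaries.
End step_bounds.

(** * Pathwise analysis of the bridge *)

Section lower_integral.
Context d (T : measurableType d) (R : realType) (m : {measure set T -> \bar R}).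
Local Open Scope ereal_scope.

(* Integrals of nonnegative functions are suprema over simple functions, measurable or not. *)
Lemma ge0_subset_integral_sup (A D : set T) (f : T -> \bar R) :
  (forall x, 0 <= f x) -> A `<=` D ->
  \int[m]_(x in A) f x <= \int[m]_(x in D) f x.
Proof.
move=> f0 AD; rewrite !ge0_integralE//.
apply: ereal_sup_le => _ [h /= hf <-].
exists h => // x.
apply: le_trans (hf x) _; rewrite /patch.
case: ifPn => [xA|_]; last by case: ifP.
by rewrite mem_set//; apply: AD; exact: set_mem.
Qed.

Lemma nondecreasing_emeasurable (h : R -> \bar R) (D : set R) :
  measurable D -> {homo h : x y / (x <= y)%R >-> x <= y} -> measurable_fun D h.
Proof.
move=> mD hh; apply: measurable_funTS.
apply: (measurability _ (ErealGenOInfty.measurableE R)) => _ [_ [c ->] <-].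
rewrite setTI; apply: is_interval_measurable => x y /= hx hy z /andP[xz zy].
move: hx; rewrite !in_itv/= !andbT => cx.
by apply: lt_le_trans cx _; exact: hh.
Qed.
End lower_integral.

Section uniform.
Context {R : realType}.

Lemma within_continuous_epsP (f : R -> R) (A : set R) :
  {within A, continuous f} <->
  forall x e, A x -> 0 < e -> exists2 dl, 0 < dl &
    forall y, A y -> `|x - y| < dl -> `|f x - f y| < e.
Proof.
split => [/subspace_continuousP cf x e Ax e0|h].
  have /cvgrPdist_lt /(_ _ e0) := cf x Ax.
  by move=> [dl /= dl0 H]; exists dl => // y Ay xy; apply: H.
apply/subspace_continuousP => x Ax; apply/cvgrPdist_lt => e e0.
have [dl dl0 H] := h x e Ax e0.
by exists dl => //= y xy Ay; apply: H.
Qed.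

Lemma segment_uniform_continuity (f : R -> R) (a b e : R) :
  {within `[a, b], continuous f} -> 0 < e ->
  exists2 dl, 0 < dl & forall u v, a <= u <= b -> a <= v <= b ->
    `|u - v| < dl -> `|f u - f v| < e.
Proof.
move=> /within_continuous_epsP cf e0.
have := @segment_compact R a b; rewrite compact_near_coveringP => cov.
pose P (dl y : R) := a <= y <= b -> forall z, a <= z <= b -> `|y - z| < dl -> `|f y - f z| < e.
have : \forall dl \near (0:R)^'+, (`[a, b]%classic `<=` P dl).
  apply: cov => x; rewrite /= => xab.
  have e2 : 0 < e / 2 by rewrite divr_gt0.
  have [dl dl0 Hdl] := cf x _ xab e2.
  have dl2 : 0 < dl / 2 by rewrite divr_gt0.
  have Hdl' y : a <= y <= b -> `|x - y| < dl -> `|f x - f y| < e / 2.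
    by move=> yab; apply: Hdl; rewrite /= in_itv.
  exists (ball x (dl / 2), [set dl' | dl' < dl / 2]).
    split => /=; first exact: nbhsx_ballx.
    by apply: nbhs_right_lt.
  move=> [y dl'] [/= xy dlE] yab z zab yz.
  rewrite (splitr e) -(subrKA (f x)) (le_lt_trans (ler_normD _ _))// ltrD//.
    rewrite distrC Hdl'// (lt_trans xy)// ltr_pdivrMr// ltr_pMr// ltr1n//.
  apply: Hdl' => //; rewrite (splitr dl) -(subrKA y) (le_lt_trans (ler_normD _ _))// ltrD//.
  exact: lt_trans dlE.
move=> [dl /= dl0 H]; exists (dl / 2); first by rewrite divr_gt0.
move=> u v uab vab uv.
have dd : dl / 2 < dl by rewrite ltr_pdivrMr// ltr_pMr// ltr1n.
apply: (H (dl / 2)) => //=.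
- by rewrite sub0r normrN ger0_norm// divr_ge0 ?ltW.
- by rewrite divr_gt0.
Qed.

Lemma segment_bounded (f : R -> R) (a b : R) :
  {within `[a, b], continuous f} -> exists K, forall u, a <= u <= b -> `|f u| <= K.
Proof.
move=> cf.
have := continuous_compact cf (@segment_compact R a b).
move=> /compact_bounded[M [_ HM]].
exists (M + 1) => u uab; apply: HM; first by rewrite ltrDl.
by exists u => //=; rewrite in_itv.
Qed.

End uniform.

Section bounded_interval.
Context {R : realType}.
Local Notation mu := (@lebesgue_measure R).
Implicit Types (a b K : R) (p q : bool).

Lemma lebesgue_measure_bounded_itv p q a b : a <= b ->
  mu [set` Interval (BSide p a) (BSide q b)] = (b - a)%:E.
Proof.
move=> ab; rewrite lebesgue_measure_itv/= lte_fin; case: ltP => //= ba.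
by have -> : a = b; [apply/eqP; rewrite eq_le ab ba|rewrite subrr].
Qed.

Lemma integrable_bounded_itv p q a b K (f : R -> R) : a <= b ->
  measurable_fun [set` Interval (BSide p a) (BSide q b)] f ->
  (forall u, u \in Interval (BSide p a) (BSide q b) -> `|f u| <= K) ->
  mu.-integrable [set` Interval (BSide p a) (BSide q b)] (EFin \o f).
Proof.
move=> ab mf fK; apply: measurable_bounded_integrable => //.
  by rewrite [ltLHS]lebesgue_measure_bounded_itv// ltry.
exists K; split; first exact: num_real.
by move=> K' KK' u /= /fK uK; exact: le_trans (ltW KK').
Qed.

Lemma Rintegral_bounded_itv p q a b K (f : R -> R) : a <= b ->
  mu.-integrable [set` Interval (BSide p a) (BSide q b)] (EFin \o f) ->
  (forall u, u \in Interval (BSide p a) (BSide q b) -> `|f u| <= K) ->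
  `|\int[mu]_(u in [set` Interval (BSide p a) (BSide q b)]) f u| <= (b - a) * K.
Proof.
move=> ab fi fK; apply: (le_trans (le_normr_Rintegral _ _)) => //.
rewrite mulrC -[X in _ * X]/(fine (b - a)%:E) -(lebesgue_measure_bounded_itv p q)//.
rewrite -Rintegral_cst//; apply: le_Rintegral => //; first exact: integrable_norm.
by apply: (integrable_bounded_itv _ _ _ _ `|K|) => // u _.
Qed.

End bounded_interval.

Section bridge_path.
Context {R : realType}.
Local Notation mu := (@lebesgue_measure R).
Variables (g w : R -> R) (t x : R).
Hypothesis Ht : 0 <= t < 1.
Hypothesis cw : {within `[0, +oo[, continuous w}.
Hypothesis HX : forall s, t <= s < 1 ->
  g s = x - \int[mu]_(u in `[t, s]) (g u / (1 - u)) + (w s - w t).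

Let k u := g u / (1 - u).

Let wbounded (T : R) : exists K, forall u, t <= u <= T -> `|w u - w t| <= K.
Proof.
have t0 : 0 <= t by case/andP: Ht.
have ctT : {within `[t, T], continuous w}.
  apply: continuous_subspaceW cw => y /=; rewrite !in_itv/= andbT => /andP[ty _].
  exact: le_trans ty.
have [K HK] := segment_bounded _ _ _ ctT.
exists (K + K) => u utT; rewrite (le_trans (ler_normB _ _))// lerD// HK//.
by case/andP: utT => tu uT; rewrite lexx (le_trans tu).
Qed.

(** The integrand of the equation contains [g] itself, whose measurability is unknown. The integrals
    of its positive and negative parts over [t, s] are monotone in [s] all the same, hence
    measurable in [s], and the equation passes this on to [g]. *)
Lemma bridge_measurable : measurable_fun `[t, 1[ g.
Proof.
pose Ip s : \bar R := (\int[mu]_(u in `[t, s]) ((EFin \o k) ^\+ u))%E.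
pose In s : \bar R := (\int[mu]_(u in `[t, s]) ((EFin \o k) ^\- u))%E.
have mI (f : R -> \bar R) : (forall u, 0 <= f u)%E ->
    measurable_fun `[t, 1[ (fun s => \int[mu]_(u in `[t, s]) f u)%E.
  move=> f0; apply: nondecreasing_emeasurable => // s s' ss'.
  apply: ge0_subset_integral_sup => // u; rewrite /= !in_itv/= => /andP[-> us] /=.
  exact: le_trans ss'.
have mw : measurable_fun `[t, 1[ w.
  apply: measurable_funS (subspace_continuous_measurable_fun _ cw) => //.
  case/andP: Ht => t0 _ y /=; rewrite !in_itv/= andbT => /andP[ty _].
  exact: le_trans ty.
have : measurable_fun `[t, 1[ (fun s => x - fine (Ip s - In s)%E + (w s - w t)).
  apply: measurable_funD; last by apply: measurable_funB.
  apply: measurable_funB => //.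
  apply: (@measurableT_comp _ _ _ _ _ _ (@fine R) _ (fun s => Ip s - In s)%E);
    first exact: fine_measurable.
  by apply: emeasurable_funB; apply: mI => u.
apply: eq_measurable_fun => s; rewrite inE/= in_itv/= => st1.
by rewrite HX// /Rintegral integralE.
Qed.

Lemma bridge_ratio_measurable s : s < 1 -> measurable_fun `[t, s] k.
Proof.
move=> s1; apply: measurable_funM.
  apply: measurable_funS bridge_measurable => // u /=.
  by rewrite !in_itv/= => /andP[-> us]; exact: le_lt_trans s1.
apply: subspace_continuous_measurable_fun => //.
apply/within_continuous_epsP => u e /=; rewrite in_itv/= => /andP[tu us] e0.
have cinv : {for u, continuous (fun u : R => (1 - u)^-1)}.
  apply: cvgV; first by rewrite gt_eqF// subr_gt0 (le_lt_trans us).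
  by apply: cvgB; [exact: cvg_cst|exact: cvg_id].
move/cvgrPdist_lt : cinv => /(_ _ e0)[dl /= dl0 H].
by exists dl => // y _ uy; exact: H.
Qed.

Let normg_bound Kw s : t <= s < 1 -> `|w s - w t| <= Kw ->
  `|g s| <= `|x| + Kw + `|\int[mu]_(u in `[t, s]) k u|.
Proof.
move=> st hw; rewrite HX// (le_trans (ler_normD _ _))// addrAC lerD//.
exact: ler_normB.
Qed.

(** No bound on [g] is available in advance, so integrability is gained step by step: knowing it up
    to [s0] bounds [g] on a further stretch whose length depends on [T] only, and finitely many
    stretches reach [T]. *)
Lemma bridge_extend s0 T : t <= s0 <= T -> T < 1 ->
  mu.-integrable `[t, s0] (EFin \o k) ->
  exists K, forall s, s0 <= s <= T -> s <= s0 + (1 - T) / 2 -> `|g s| <= K.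
Proof.
move=> /andP[ts0 s0T] T1 ik0.
have [Kw Hw] := wbounded T.
pose J0 := \int[mu]_(u in `[t, s0]) `|k u|.
have J00 : 0 <= J0 by apply: Rintegral_ge0 => u _; exact: normr_ge0.
pose Kc := `|x| + Kw + J0.
have Kw0 : 0 <= Kw by apply: le_trans (Hw s0 _); [exact: normr_ge0|rewrite ts0].
have Kc0 : 0 <= Kc by rewrite !addr_ge0.
exists (2 * Kc) => s /andP[s0s sT] ss0.
have ts : t <= s by exact: le_trans s0s.
have s1 : s < 1 by exact: le_lt_trans T1.
(* Without integrability the integral is not finite, [fine] sends it to 0, and the equation bounds
   [g s] by its other two terms. *)
have [iks|niks] := pselect (mu.-integrable `[t, s] (EFin \o k)); last first.
  have I0 : \int[mu]_(u in `[t, s]) k u = 0.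
    rewrite /Rintegral; set I := (X in fine X).
    have : I \isn't a fin_num.
      apply/negP => Ifin; apply: niks; apply/integrableP; split.
        by apply/measurable_EFinP; exact: bridge_ratio_measurable.
      rewrite integral_fin_num_abs//.
      exact: bridge_ratio_measurable.
    by case: I.
  apply: (le_trans (normg_bound Kw s _ _)); rewrite ?ts ?s1 ?Hw ?ts//.
  rewrite I0 normr0 addr0 (le_trans (_ : _ <= Kc))//; first by rewrite lerDl.
  by rewrite mulr_natl mulr2n lerDl.
(* Gronwall in a single step: |g| <= Kc + P s and 1 - u >= 1 - T on the stretch give P s <= (s - s0)
   (Kc + P s) / (1 - T). The length (1 - T) / 2 makes the factor 1/2, so P s <= Kc. *)
pose P u := \int[mu]_(y in `]s0, u]) `|k y|.
have iku u : u <= s -> mu.-integrable `[t, u] (EFin \o k).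
  by move=> us; apply: integrableS iks => //; apply: subset_itvl; rewrite bnd_simp.
have Fb u : s0 <= u <= s -> `|g u| <= Kc + P u.
  move=> /andP[s0u us].
  have tu : t <= u by exact: le_trans s0u.
  apply: (le_trans (normg_bound Kw u _ _)).
  - by rewrite tu (le_lt_trans us).
  - by rewrite Hw// tu (le_trans us).
  rewrite /Kc -[leRHS]addrA lerD2l.
  apply: (le_trans (le_normr_Rintegral _ _)) => //; first exact: iku.
  have := @Rintegral_itvB R (fun y => `|k y|) (BLeft t) (BRight u) s0 (integrable_norm (iku u us)).
  by rewrite !bnd_simp => /(_ ts0 s0u) h; rewrite /P -h addrC subrK.
have iP : mu.-integrable `]s0, s] (EFin \o (fun y => `|k y|)).
  apply: integrable_norm; apply: integrableS iks => //.
  by move=> y /=; rewrite !in_itv/= => /andP[/ltW s0y ->]; rewrite (le_trans ts0).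
have Ps : P s <= Kc.
  have T0 : 0 < 1 - T by rewrite subr_gt0.
  have PuPs u : u <= s -> P u <= P s.
    move=> us; apply: fine_le.
    - apply: integrable_fin_num => //; apply: integrableS iP => //.
      by apply: subset_itvl; rewrite bnd_simp.
    - exact: integrable_fin_num.
    apply: ge0_subset_integral_sup => [y|]; first by rewrite lee_fin.
    by apply: subset_itvl; rewrite bnd_simp.
  have Ps0 : 0 <= P s by apply: Rintegral_ge0 => u _; exact: normr_ge0.
  have ku u : s0 < u <= s -> `|k u| <= (Kc + P s) / (1 - T).
    move=> /andP[s0u us].
    have u1 : 1 - T <= 1 - u by rewrite lerB// (le_trans us).
    rewrite /k normrM ler_pM//.
      by apply: le_trans (Fb u _) _; rewrite ?(ltW s0u)// lerD2l PuPs.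
    by rewrite normfV ger0_norm ?lef_pV2 ?posrE// ?(le_trans (ltW T0))// (lt_le_trans T0).
  have kn u : u \in `]s0, s] -> `| `|k u| | <= (Kc + P s) / (1 - T).
    by rewrite in_itv/= normr_id => us; exact: ku.
  have := Rintegral_bounded_itv _ _ _ _ _ _ s0s iP kn.
  rewrite -/(P s) ger0_norm// => PsK.
  have : (s - s0) * ((Kc + P s) / (1 - T)) <= (1 - T) / 2 * ((Kc + P s) / (1 - T)).
    apply: ler_wpM2r; last by rewrite lerBlDl.
    by apply: divr_ge0; [exact: addr_ge0|exact: ltW].
  have -> : (1 - T) / 2 * ((Kc + P s) / (1 - T)) = (Kc + P s) / 2.
    by field; rewrite gt_eqF.
  by move/(le_trans PsK); rewrite ler_pdivlMr// mulr_natr mulr2n lerD2r.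
apply: (le_trans (Fb s _)); first by rewrite s0s lexx.
by rewrite mulr_natl mulr2n lerD2l.
Qed.

Lemma bridge_bounded T : t <= T < 1 -> exists K, forall s, t <= s <= T -> `|g s| <= K.
Proof.
move=> /andP[tT T1]; have T0 : 0 < (1 - T) / 2 by rewrite divr_gt0// subr_gt0.
have step (n : nat) : exists K, forall s, t <= s <= T -> s <= t + n%:R * ((1 - T) / 2) -> `|g s| <= K.
  elim: n => [|n [K HK]].
    exists `|g t| => s /andP[ts _]; rewrite mul0r addr0 => st.
    by have -> : s = t by apply/eqP; rewrite eq_le ts st.
  have [Tn|nT] := leP T (t + n%:R * ((1 - T) / 2)).
    by exists K => s /andP[ts sT] _; apply: HK; rewrite ?ts// (le_trans sT).
  pose s0 := t + n%:R * ((1 - T) / 2).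
  have ts0 : t <= s0 by rewrite lerDl mulr_ge0// ltW.
  have s01 : s0 < 1 by exact: lt_trans T1.
  have ik : mu.-integrable `[t, s0] (EFin \o k).
    apply: (integrable_bounded_itv _ _ _ _ (K / (1 - T))) => //.
      exact: bridge_ratio_measurable.
    move=> u; rewrite in_itv/= => /andP[tu us].
    have uT : u <= T by rewrite (le_trans us)// ltW.
    rewrite /k normrM ler_pM//; first by apply: HK; rewrite ?tu.
    have u1 : 1 - T <= 1 - u by rewrite lerB.
    have T10 : 0 < 1 - T by rewrite subr_gt0.
    by rewrite normfV ger0_norm ?lef_pV2 ?posrE// ?(le_trans (ltW T10))// (lt_le_trans T10).
  have [K' HK'] := bridge_extend s0 T (introT andP (conj ts0 (ltW nT))) T1 ik.
  exists (Num.max K K') => s /andP[ts sT] sn; rewrite le_max.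
  have [ss0|s0s] := leP s s0; first by rewrite HK ?ts.
  rewrite (HK' s) ?orbT// ?(ltW s0s)//.
  by rewrite (le_trans sn)// /s0 -natr1 mulrDl mul1r addrA.
have [n nT] : exists n : nat, (T - t) / ((1 - T) / 2) < n%:R.
  by exists (Num.truncn ((T - t) / ((1 - T) / 2))).+1; exact: truncnS_gt.
have [K HK] := step n; exists K => s sT; apply: HK => //.
case/andP: sT => _ sT; rewrite (le_trans sT)// -lerBlDl -ler_pdivrMr//.
exact: ltW.
Qed.

Let Y s := k s.

Lemma bridge_integrable u v : t <= u -> u <= v -> v < 1 -> mu.-integrable `[u, v] (EFin \o Y).
Proof.
move=> tu uv v1.
have [K HK] := bridge_bounded v (introT andP (conj (le_trans tu uv) v1)).
apply: (integrable_bounded_itv _ _ _ _ (K / (1 - v))) => //.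
  apply: measurable_funS (bridge_ratio_measurable _ v1) => //.
  by move=> y /=; rewrite !in_itv/= => /andP[uy ->]; rewrite (le_trans tu).
move=> y; rewrite in_itv/= => /andP[uy yv].
have y1 : 1 - v <= 1 - y by rewrite lerB.
have v10 : 0 < 1 - v by rewrite subr_gt0.
rewrite /Y /k normrM ler_pM//; first by apply: HK; rewrite (le_trans tu).
by rewrite normfV ger0_norm ?lef_pV2 ?posrE// ?(le_trans (ltW v10))// (lt_le_trans v10).
Qed.

(** Discrete form of (1 - s) dY = dW. The bracket is the integral of Y v - Y a over [u, v], which
    continuity makes small compared with v - u. *)
Lemma bridge_increment u v : t <= u -> u <= v -> v < 1 ->
  (1 - u) * (Y v - Y u) = w v - w u + ((v - u) * Y v - \int[mu]_(a in `[u, v]) Y a).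
Proof.
move=> tu uv v1.
have tv := le_trans tu uv; have u1 := le_lt_trans uv v1.
have := @Rintegral_itvB R Y (BLeft t) (BRight v) u (bridge_integrable _ _ (lexx t) tv v1).
rewrite !bnd_simp => /(_ tu uv).
rewrite Rintegral_itv_obnd_cbnd; last first.
  apply: integrableS (bridge_integrable _ _ tu uv v1) => //.
  by apply: subset_itvr; rewrite bnd_simp.
move=> <-.
have gE s : t <= s < 1 -> g s = (1 - s) * Y s.
  by move=> /andP[_ s1]; rewrite /Y /k mulrC divfK// gt_eqF// subr_gt0.
have := HX v; have := HX u; rewrite !gE ?tu ?tv ?u1 ?v1// => /(_ isT) eu /(_ isT) ev.
have -> : (1 - u) * (Y v - Y u) = (1 - v) * Y v - (1 - u) * Y u + (v - u) * Y v by ring.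
by rewrite eu ev /Y /k; ring.
Qed.

Lemma bridge_increment_approx e u v : t <= u -> u <= v -> v < 1 ->
  (forall a, u <= a <= v -> `|Y v - Y a| <= e) ->
  `|(Y v - Y u) - (w v - w u) / (1 - u)| <= e * (v - u) / (1 - u).
Proof.
move=> tu uv v1 He.
have u1 : 0 < 1 - u by rewrite subr_gt0 (le_lt_trans uv).
rewrite -[X in `|X|](mulfK (lt0r_neq0 u1)) normrM normfV (ger0_norm (ltW u1)).
rewrite ler_pM2r ?invr_gt0// mulrBl divfK ?gt_eqF// mulrC bridge_increment//.
rewrite addrAC subrr add0r.
have iY := bridge_integrable _ _ tu uv v1.
have ic : mu.-integrable `[u, v] (EFin \o (fun=> Y v)).
  by apply: (integrable_bounded_itv _ _ _ _ `|Y v|) => //.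
have -> : (v - u) * Y v = \int[mu]_(a in `[u, v]) Y v.
  by rewrite Rintegral_cst//= lebesgue_measure_bounded_itv//= mulrC.
rewrite -RintegralB// mulrC; apply: Rintegral_bounded_itv => //.
by apply: eq_integrable (integrableB _ ic iY).
Qed.

Lemma bridge_continuous T : t <= T < 1 -> {within `[t, T], continuous Y}.
Proof.
move=> /andP[tT T1].
have [K HK] := bridge_bounded T (introT andP (conj tT T1)).
have T0 : 0 < 1 - T by rewrite subr_gt0.
pose F s := \int[mu]_(u in `[t, s]) k u.
have cF : {within `[t, T], continuous F}.
  exact: parameterized_integral_continuous (bridge_integrable _ _ (lexx t) tT T1).
have cwT : {within `[t, T], continuous w}.
  apply: continuous_subspaceW cw => y /=; rewrite !in_itv/= andbT => /andP[ty _].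
  by case/andP: Ht => t0 _; exact: le_trans ty.
have ci : {within `[t, T], continuous (fun u : R => (1 - u)^-1)}.
  apply/within_continuous_epsP => u e /=; rewrite in_itv/= => /andP[tu us] e0.
  have cinv : {for u, continuous (fun u : R => (1 - u)^-1)}.
    apply: cvgV; first by rewrite gt_eqF// subr_gt0 (le_lt_trans us).
    by apply: cvgB; [exact: cvg_cst|exact: cvg_id].
  move/cvgrPdist_lt : cinv => /(_ _ e0)[dl /= dl0 H].
  by exists dl => // y _ uy; exact: H.
have : {within `[t, T], continuous (fun s => (x - F s + (w s - w t)) * (1 - s)^-1)}.
  move=> s; apply: cvgM; last exact: ci.
  by apply: cvgD; apply: cvgB; [exact: cvg_cst|exact: cF|exact: cwT|exact: cvg_cst].
apply: subspace_eq_continuous => s; rewrite inE/= in_itv/= => /andP[ts sT].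
by rewrite /from_subspace /Y /k HX// ts (le_lt_trans sT).
Qed.

(** The integrand 1 / (1 - s) is deterministic, so the integral against [W] is a pathwise limit of
    left Riemann sums. *)
Lemma bridge_riemann T e : t <= T < 1 -> 0 < e ->
  exists2 dl, 0 < dl & forall (p : nat -> R) (n : nat),
    t <= p 0%N -> p n <= T -> (forall i, (i < n)%N -> p i <= p i.+1 < p i + dl) ->
    `|Y (p n) - Y (p 0%N) - \sum_(i < n) (w (p i.+1) - w (p i)) / (1 - p i)| <= e.
Proof.
move=> tT1 e0; have /andP[tT T1] := tT1; have T0 : 0 < 1 - T by rewrite subr_gt0.
(* Each cell contributes an error divided by 1 - p i >= 1 - T, and the cells have total length at
   most 1; this modulus brings the sum down to [e]. *)
have e'0 : 0 < e * (1 - T) by rewrite mulr_gt0.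
have [dl dl0 Hdl] := segment_uniform_continuity _ _ _ _ (bridge_continuous T tT1) e'0.
exists dl => // p n tp0 pnT pi.
have mono i j : (i <= j)%N -> (j <= n)%N -> p i <= p j.
  elim: j => [|j IH]; first by rewrite leqn0 => /eqP->.
  rewrite leq_eqVlt => /predU1P[->//|]; rewrite ltnS => ij jn.
  by apply: le_trans (IH ij (ltnW jn)) _; have /andP[] := pi j jn.
have tele : Y (p n) - Y (p 0%N) = \sum_(i < n) (Y (p i.+1) - Y (p i)).
  by rewrite -(big_mkord xpredT (fun i => Y (p i.+1) - Y (p i))) telescope_sumr.
rewrite tele -sumrB (le_trans (ler_norm_sum _ _ _))//.
apply: (@le_trans _ _ (\sum_(i < n) (e * (p i.+1 - p i)))); last first.
  rewrite -mulr_sumr -(big_mkord xpredT (fun i => p i.+1 - p i)) telescope_sumr//.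
  rewrite ler_piMr ?(ltW e0)//; have := pnT; have := tp0; case/andP: Ht; lra.
apply: ler_sum => i _; have ni := ltn_ord i.
have /andP[pi1 pi2] := pi i ni.
have tpi : t <= p i by rewrite (le_trans tp0)// mono// ltnW.
have piT : p i.+1 <= T by rewrite (le_trans _ pnT)// mono.
apply: (le_trans (bridge_increment_approx (e * (1 - T)) _ _ tpi pi1 (le_lt_trans piT T1) _)).
  move=> a /andP[pa ap]; apply/ltW/Hdl.
  - by rewrite piT (le_trans tpi).
  - by rewrite (le_trans tpi)//= (le_trans ap).
  - by rewrite ger0_norm ?subr_ge0// ltrBlDr (lt_le_trans pi2)// addrC lerD2l.
have p1 : 1 - T <= 1 - p i by rewrite lerB// (le_trans pi1).
have p10 : 0 < 1 - p i by exact: lt_le_trans p1.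
rewrite ler_pdivrMr// mulrAC; apply: ler_wpM2l => //.
by rewrite mulr_ge0 ?(ltW e0)// subr_ge0.
Qed.

Lemma bridge_start : g t = x.
Proof.
have t1 : t < 1 by case/andP: Ht.
by rewrite HX ?lexx// set_itv1 Rintegral_set1 !subrr subr0 addr0.
Qed.

End bridge_path.

(** * Limits of integrals *)

Section weighted.
Import HBNNSimple.
Context d (T : measurableType d) d' (T' : measurableType d') (R : realType).
Variables (m : {measure set T -> \bar R}) (D : T -> T').
Hypothesis mD : measurable_fun setT D.
Local Open Scope ereal_scope.

Let mDpre B : measurable B -> measurable (D @^-1` B).
Proof. by move=> mB; rewrite -[X in measurable X]setTI; exact: mD. Qed.

Lemma integral_nnsfun_weight (h : {nnsfun T' >-> R}) (xi : T -> \bar R) :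
  measurable_fun setT xi -> (forall w, 0 <= xi w) ->
  \int[m]_w ((h (D w))%:E * xi w) =
  \sum_(c \in range h) (c%:E * \int[m]_(w in D @^-1` (h @^-1` [set c])) xi w).
Proof.
move=> mxi xi0.
have h0 (r : R) z : 0 <= r%:E * (\1_(h @^-1` [set r]) z)%:E by exact: nnfun_muleindic_ge0.
have mset c : measurable (D @^-1` (h @^-1` [set c])) by exact: mDpre.
transitivity (\int[m]_w \sum_(c \in range h) (c%:E * (\1_(h @^-1` [set c]) (D w))%:E * xi w)).
  apply: eq_integral => w _; rewrite fimfunE -fsumEFin//.
  by rewrite ge0_mule_fsuml// => c; rewrite EFinM; exact: h0.
rewrite ge0_integral_fsum//; last 2 first.
- move=> c; apply: emeasurable_funM => //; apply: measurable_funeM.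
  apply/measurable_EFinP; apply: measurableT_comp => //.
- by move=> c w _; rewrite mule_ge0.
apply: eq_fsbigr => c _.
have [c0|c0] := leP 0%R c; last first.
  rewrite preimage_nnfun0// preimage_set0 integral_set0 mule0.
  by rewrite integral0_eq// => w _; rewrite indicE in_set0 mule0 mul0e.
under eq_integral do rewrite -muleA.
rewrite ge0_integralZl//=; last 2 first.
- apply: emeasurable_funM => //.
  by apply/measurable_EFinP; apply: measurableT_comp.
- by move=> w _; rewrite mule_ge0.
congr (_ * _); rewrite [RHS]integral_mkcond; apply: eq_integral => w _.
rewrite patchE indicE.
have -> : (D w \in h @^-1` [set c]) = (w \in D @^-1` (h @^-1` [set c])) by [].
by case: ifP => _; rewrite ?mul1e ?mul0e.
Qed.

Lemma cvg_integral_weight (phi : T' -> R)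
    (mphi : measurable_fun setT (EFin \o phi)) (xi : T -> R) :
  (forall z, 0 <= phi z)%R ->
  measurable_fun setT xi -> (forall w, 0 <= xi w)%R ->
  \sum_(c \in range (nnsfun_approx measurableT mphi n))
    (c%:E * \int[m]_(w in D @^-1` (nnsfun_approx measurableT mphi n @^-1` [set c])) (xi w)%:E)
  @[n --> \oo] --> \int[m]_w (phi (D w) * xi w)%:E.
Proof.
move=> phi0 mxi xi0; pose h := nnsfun_approx measurableT mphi.
have E n : \int[m]_w ((h n (D w))%:E * (xi w)%:E) =
    (\sum_(c \in range (h n)) (c%:E * \int[m]_(w in D @^-1` (h n @^-1` [set c])) (xi w)%:E)%E)%R.
  by rewrite integral_nnsfun_weight//; exact/measurable_EFinP.
rewrite -(funext E).
have -> : \int[m]_w (phi (D w) * xi w)%:E = \int[m]_w limn (fun n => (h n (D w))%:E * (xi w)%:E).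
  apply: eq_integral => w _; apply/esym/cvg_lim => //.
  rewrite EFinM; apply: cvgeZr => //.
  by apply: (cvg_nnsfun_approx measurableT mphi) => // z _; rewrite lee_fin.
apply: cvg_monotone_convergence => //.
- move=> n; apply: emeasurable_funM; last exact/measurable_EFinP.
  by apply/measurable_EFinP; apply: measurableT_comp.
- by move=> n w _; rewrite mule_ge0 ?lee_fin.
- move=> w _ n n' nn'; rewrite lee_wpmul2r ?lee_fin//.
  exact/lefP/nd_nnsfun_approx.
Qed.

End weighted.

Section weighted2.
Import HBNNSimple.

(** From indicators to simple functions to monotone limits. The general target space covers two
    uses: [D1] an increment compared with the Lebesgue measure, and [D1] the identity into a smaller
    sigma-algebra, which stands in for conditional expectation. *)
Lemma eq_integral_weight d1 (T1 : measurableType d1) d2 (T2 : measurableType d2)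
    d' (T' : measurableType d') (R : realType)
    (m1 : {measure set T1 -> \bar R}) (m2 : {measure set T2 -> \bar R})
    (D1 : T1 -> T') (D2 : T2 -> T') (xi1 : T1 -> R) (xi2 : T2 -> R) (phi : T' -> R) :
  measurable_fun setT D1 -> measurable_fun setT D2 ->
  measurable_fun setT xi1 -> (forall w, 0 <= xi1 w) ->
  measurable_fun setT xi2 -> (forall w, 0 <= xi2 w) ->
  (forall B, measurable B ->
    \int[m1]_(w in D1 @^-1` B) (xi1 w)%:E = \int[m2]_(w in D2 @^-1` B) (xi2 w)%:E)%E ->
  measurable_fun setT phi -> (forall z, 0 <= phi z) ->
  (\int[m1]_w (phi (D1 w) * xi1 w)%:E = \int[m2]_w (phi (D2 w) * xi2 w)%:E)%E.
Proof.
move=> mD1 mD2 mxi1 xi10 mxi2 xi20 H mphi phi0.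
have mphi' : measurable_fun setT (EFin \o phi) by exact/measurable_EFinP.
have c1 := @cvg_integral_weight _ _ _ _ _ m1 D1 mD1 phi mphi' xi1 phi0 mxi1 xi10.
have c2 := @cvg_integral_weight _ _ _ _ _ m2 D2 mD2 phi mphi' xi2 phi0 mxi2 xi20.
suff E : (fun n => \sum_(c \in range (nnsfun_approx measurableT mphi' n))
    (c%:E * \int[m1]_(w in D1 @^-1` (nnsfun_approx measurableT mphi' n @^-1` [set c])) (xi1 w)%:E))%E =
  (fun n => \sum_(c \in range (nnsfun_approx measurableT mphi' n))
    (c%:E * \int[m2]_(w in D2 @^-1` (nnsfun_approx measurableT mphi' n @^-1` [set c])) (xi2 w)%:E))%E.
  by rewrite E in c1; exact: cvg_unique c1 c2.
by apply/funext => n; apply: eq_fsbigr => c _; rewrite H.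
Qed.
End weighted2.

Lemma eq_integral_pi_system d (T : measurableType d) (R : realType)
    (m : {measure set T -> \bar R}) (G : set (set T)) (xi1 xi2 : T -> R) :
  G `<=` measurable -> setI_closed G ->
  (forall w, 0 <= xi1 w) -> (forall w, 0 <= xi2 w) ->
  m.-integrable setT (EFin \o xi1) -> m.-integrable setT (EFin \o xi2) ->
  (\int[m]_w (xi1 w)%:E = \int[m]_w (xi2 w)%:E)%E ->
  (forall A, G A -> \int[m]_(w in A) (xi1 w)%:E = \int[m]_(w in A) (xi2 w)%:E)%E ->
  forall A, <<s G >> A -> (\int[m]_(w in A) (xi1 w)%:E = \int[m]_(w in A) (xi2 w)%:E)%E.
Proof.
move=> Gm GI xi10 xi20 i1 i2 HT HG A.
have mxi1 : measurable_fun setT (EFin \o xi1) := measurable_int _ i1.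
have mxi2 : measurable_fun setT (EFin \o xi2) := measurable_int _ i2.
rewrite -setI_closed_g_dynkin_g_sigma_algebra//.
move=> /(_ [set A | measurable A /\ (\int[m]_(w in A) (xi1 w)%:E = \int[m]_(w in A) (xi2 w)%:E)%E]).
case => [|//]; split; last by move=> B GB; split; [exact: Gm|exact: HG].
have compl (xi : T -> R) B : m.-integrable setT (EFin \o xi) -> measurable B ->
  (\int[m]_(w in ~` B) (xi w)%:E = \int[m]_w (xi w)%:E - \int[m]_(w in B) (xi w)%:E)%E.
  move=> ixi mB; have mxi : measurable_fun setT (EFin \o xi) := measurable_int _ ixi.
  have : (\int[m]_(w in ~` B `|` B) (xi w)%:E =
     \int[m]_(w in ~` B) (xi w)%:E + \int[m]_(w in B) (xi w)%:E)%E.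
    apply: integral_setU => //; first exact: measurableC.
      by rewrite setvU.
    by apply/disj_setPS; rewrite setICl.
  rewrite setvU => ->; rewrite addeK//; apply: integrable_fin_num => //.
  exact: integrableS ixi.
split.
- by split.
- by move=> B [mB HB]; split; [exact: measurableC|rewrite !compl// HT HB].
- move=> F tF HF; split; first by apply: bigcupT_measurable => n; case: (HF n).
  have mF n : measurable (F n) by case: (HF n).
  have mbF : measurable (\bigcup_n F n) by exact: bigcupT_measurable.
  rewrite !ge0_integral_bigcup//; try exact: measurable_funTS; last 2 first.
  - by move=> w _; rewrite lee_fin.
  - by move=> w _; rewrite lee_fin.
  by apply: eq_eseriesr => n _; case: (HF n).
Qed.

Section uniform_integrability.
Context d (T : measurableType d) (R : realType) (P : probability T R).
Implicit Types (f : T -> R).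

Lemma le_integral_trunc f (e : \bar R) : measurable_fun setT f ->
  (forall w, 0 <= f w) ->
  (forall K : nat, (\int[P]_w (Num.min (f w) K%:R)%:E <= e)%E) ->
  (\int[P]_w (f w)%:E <= e)%E.
Proof.
move=> mf f0 H.
have -> : (\int[P]_w (f w)%:E = \int[P]_w limn (fun K : nat => (Num.min (f w) K%:R)%:E))%E.
  apply: eq_integral => w _; apply/esym/cvg_lim => //.
  apply: cvg_near_cst; near=> K; rewrite min_l//.
  by near: K; exact: nbhs_infty_ger.
rewrite monotone_convergence//.
- apply: lime_le; last by apply: nearW => K; exact: H.
  apply: ereal_nondecreasing_is_cvgn => K K' KK'; apply: ge0_le_integral => //.
  + by move=> w _; rewrite lee_fin le_min f0/=.
  + by apply/measurable_EFinP; exact: measurable_minr.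
  + by apply/measurable_EFinP; exact: measurable_minr.
  + by move=> w _; rewrite lee_fin le_min ge_min lexx/= ge_min ler_nat KK' orbT.
- by move=> K; apply/measurable_EFinP; exact: measurable_minr.
- by move=> K w _; rewrite lee_fin le_min f0/=.
- by move=> w _ K K' KK'; rewrite lee_fin le_min ge_min lexx/= ge_min ler_nat KK' orbT.
Unshelve. all: by end_near. Qed.

Lemma cvg_Rintegral_bounded (f_ : nat -> T -> R) f (c : R) :
  (forall n, measurable_fun setT (f_ n)) -> measurable_fun setT f ->
  {ae P, forall w, f_ ^~ w @ \oo --> f w} ->
  (forall n w, `|f_ n w| <= c) ->
  P.-integrable setT (EFin \o f) /\
  \int[P]_w f_ n w @[n --> \oo] --> \int[P]_w f w.
Proof.
move=> mf_ mf ff fc.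
have [] := @dominated_convergence _ _ _ P setT measurableT (fun n => EFin \o f_ n) (EFin \o f) (EFin \o cst c).
- by move=> n; exact/measurable_EFinP.
- exact/measurable_EFinP.
- by apply: filterS ff => w h _; apply: cvg_EFin; [exact: nearW|exact: h].
- exact: finite_measure_integrable_cst.
- by apply: aeW => w n _; rewrite lee_fin.
move=> fi _ h; split => //.
apply: fine_cvg.
by rewrite fineK //; apply: integrable_fin_num.
Qed.

(** Vitali's theorem. Uniform integrability is expressed by the excess (f - c)^+ rather than by
    tails: being a convex function of f, the excess can only grow along a martingale
    ([slope_excess]), and being continuous it keeps its bound in the limit. *)
Lemma cvg_Rintegral_ui (f_ : nat -> T -> R) f :
  (forall n, measurable_fun setT (f_ n)) -> measurable_fun setT f ->
  (forall n w, 0 <= f_ n w) -> (forall w, 0 <= f w) ->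
  {ae P, forall w, f_ ^~ w @ \oo --> f w} ->
  (forall e, 0 < e -> exists2 c, 0 <= c &
     forall n, (\int[P]_w (Num.max (f_ n w - c) 0)%:E <= e%:E)%E) ->
  P.-integrable setT (EFin \o f) /\
  \int[P]_w f_ n w @[n --> \oo] --> \int[P]_w f w.
Proof.
move=> mf_ mf f_0 f0 ff ui.
pose h (c x : R) := Num.max (x - c) 0; pose l (c x : R) := Num.min x c.
have hl c x : x = l c x + h c x.
  rewrite /h /l; case: (lerP x c) => xc.
    by rewrite max_r ?addr0// subr_le0.
  by rewrite max_l ?subr_ge0 ?(ltW xc)// addrC subrK.
have mh c : measurable_fun setT (h c).
  by apply: measurable_maxr => //; apply: measurable_funB.
have ml c : measurable_fun setT (l c) by apply: measurable_minr.
have ch c : continuous (h c).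
  move=> x; apply: (@continuous_max R R (fun x : R => x - c) (fun=> 0) x).
    by apply: cvgB; [exact: cvg_id|exact: cvg_cst].
  exact: cvg_cst.
have cl c : continuous (l c).
  move=> x; apply: (@continuous_min R R id (fun=> c) x); first exact: cvg_id.
  exact: cvg_cst.
have h0 c x : 0 <= h c x by rewrite le_max lexx orbT.
have l0 c x : 0 <= c -> 0 <= x -> 0 <= l c x by move=> c0 x0; rewrite le_min c0 x0.
have lc c x : 0 <= c -> 0 <= x -> `|l c x| <= c.
  by move=> c0 x0; rewrite ger0_norm ?l0// ge_min lexx orbT.
have li (c : R) (u : T -> R) : 0 <= c -> measurable_fun setT u -> (forall w, 0 <= u w) ->
    P.-integrable setT (EFin \o (fun w => l c (u w))).
  move=> c0 mu u0; apply: le_integrable (finite_measure_integrable_cst P c measurableT) => //.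
    by apply/measurable_EFinP; exact: measurableT_comp.
  by move=> w _ /=; rewrite lee_fin (ger0_norm c0) lc.
have hi (c : R) (u : T -> R) (e : R) : measurable_fun setT u -> (\int[P]_w (h c (u w))%:E <= e%:E)%E ->
    P.-integrable setT (EFin \o (fun w => h c (u w))).
  move=> mu ue; apply/integrableP; split.
    by apply/measurable_EFinP; exact: measurableT_comp.
  under eq_integral do rewrite /= ger0_norm ?h0//.
  exact: le_lt_trans ue (ltry _).
have hRi (c : R) (u : T -> R) (e : R) : measurable_fun setT u -> (\int[P]_w (h c (u w))%:E <= e%:E)%E ->
    \int[P]_w (h c (u w)) <= e.
  move=> mu ue; rewrite -lee_fin /Rintegral fineK//.
  by apply: integrable_fin_num => //; exact: hi ue.
have split_ (c : R) (u : T -> R) (e : R) : 0 <= c -> measurable_fun setT u -> (forall w, 0 <= u w) ->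
    (\int[P]_w (h c (u w))%:E <= e%:E)%E ->
    P.-integrable setT (EFin \o u) /\
    \int[P]_w (u w) = \int[P]_w (l c (u w)) + \int[P]_w (h c (u w)).
  move=> c0 mu u0 ue; have i1 := li c u c0 mu u0; have i2 := hi c u e mu ue.
  split; last first.
    by rewrite -RintegralD//; apply: eq_Rintegral => w _; rewrite -hl.
  by apply: eq_integrable (integrableD _ i1 i2) => // w _ /=; rewrite -EFinD -hl.
have fh (c e : R) : 0 <= c -> (forall n, (\int[P]_w (h c (f_ n w))%:E <= e%:E)%E) ->
    (\int[P]_w (h c (f w))%:E <= e%:E)%E.
  move=> c0 H; apply: le_integral_trunc => //; first exact: measurableT_comp.
  move=> K.
  have [||||i1 c1] := @cvg_Rintegral_bounded (fun n w => l K%:R (h c (f_ n w))) (fun w => l K%:R (h c (f w))) K%:R.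
  - by move=> n; do 2 apply: measurableT_comp => //.
  - by do 2 apply: measurableT_comp => //.
  - apply: filterS ff => w fw.
    exact: (cvg_comp _ _ (cvg_comp _ _ fw (ch c _)) (cl K%:R _)).
  - by move=> n w; exact: lc.
  have -> : (\int[P]_w (minr (h c (f w)) K%:R)%:E = (\int[P]_w (l K%:R (h c (f w))))%:E)%E.
    by rewrite /Rintegral fineK//; apply: integrable_fin_num.
  rewrite lee_fin -(cvg_lim _ c1)//; apply: limr_le; first by apply/cvg_ex; eexists; exact: c1.
  apply: nearW => n; apply: le_trans (hRi c (f_ n) e (mf_ n) (H n)).
  apply: le_Rintegral => //.
  - by apply: li => //; exact: measurableT_comp.
  - exact: (hi c (f_ n) e).
  - by move=> w _; rewrite ge_min lexx.
have [fi _] : P.-integrable setT (EFin \o f) /\ True.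
  have [c c0 H] := ui 1 ltr01.
  by split => //; case: (split_ c f 1 c0 mf f0 (fh c 1 c0 H)).
split => //; apply/cvgrPdist_le => e e0.
have e3 : 0 < e / 3 by rewrite divr_gt0.
have [c c0 H] := ui _ e3.
have [_ Ef] := split_ c f _ c0 mf f0 (fh c _ c0 H).
have [||||_ /cvgrPdist_le /(_ _ e3)] := @cvg_Rintegral_bounded (fun n w => l c (f_ n w)) (fun w => l c (f w)) c.
- by move=> n; apply: measurableT_comp => //.
- by apply: measurableT_comp => //.
- by apply: filterS ff => w fw; exact: (cvg_comp _ _ fw (cl c _)).
- by move=> n w; exact: lc.
apply: filterS => n hn.
have [_ En] := split_ c (f_ n) _ c0 (mf_ n) (f_0 n) (H n).
have b1 := hRi c f _ mf (fh c _ c0 H).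
have b2 := hRi c (f_ n) _ (mf_ n) (H n).
have p1 : 0 <= \int[P]_w (h c (f w)) by apply: Rintegral_ge0 => w _.
have p2 : 0 <= \int[P]_w (h c (f_ n w)) by apply: Rintegral_ge0 => w _.
rewrite Ef En; move: hn b1 b2 p1 p2.
move: (\int[P]_w (l c (f w))) (\int[P]_w (h c (f w)))
      (\int[P]_w (l c (f_ n w))) (\int[P]_w (h c (f_ n w))) => x1 x2 x3 x4.
rewrite !ler_norml => /andP[] *; apply/andP; split; lra.
Qed.

Lemma cvg_Rintegral_sqr (f_ : nat -> T -> R) f (K : R) :
  (forall n, measurable_fun setT (f_ n)) -> measurable_fun setT f ->
  (forall n w, 0 <= f_ n w) -> (forall w, 0 <= f w) ->
  {ae P, forall w, f_ ^~ w @ \oo --> f w} ->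
  (forall n, (\int[P]_w (f_ n w ^+ 2)%:E <= K%:E)%E) ->
  P.-integrable setT (EFin \o f) /\
  \int[P]_w f_ n w @[n --> \oo] --> \int[P]_w f w.
Proof.
move=> mf_ mf f_0 f0 ff HK; apply: cvg_Rintegral_ui => // e e0.
have K0 : 0 <= K.
  rewrite -lee_fin (le_trans _ (HK 0%N))//; apply: integral_ge0 => w _.
  by rewrite lee_fin sqr_ge0.
(* The excess over c is at most f^2 / c, of mean at most K / c <= e. Adding 1 keeps [c] positive
   when [K] is 0. *)
pose c := (K + 1) / e; have c0 : 0 < c by rewrite divr_gt0// ltr_wpDl.
exists c; first exact: ltW.
move=> n; apply: (@le_trans _ _ (\int[P]_w (c^-1%:E * (f_ n w ^+ 2)%:E))%E).
  apply: ge0_le_integral => //.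
  - by move=> w _; rewrite lee_fin le_max lexx orbT.
  - by apply/measurable_EFinP; apply: measurable_maxr => //; apply: measurable_funB.
  - by apply/measurable_EFinP; apply: measurable_funM => //; exact: measurable_funX.
  move=> w _; rewrite -EFinM lee_fin ge_max mulr_ge0 ?invr_ge0 ?sqr_ge0 ?(ltW c0)// andbT.
  rewrite ler_pdivlMl//; have := f_0 n w.
  move: (f_ n w) => y y0; have := sqr_ge0 (2 * y - c); nra.
rewrite ge0_integralZl_EFin ?invr_ge0 ?(ltW c0)//; last 2 first.
- by move=> w _; rewrite lee_fin sqr_ge0.
- by apply/measurable_EFinP; exact: measurable_funX.
apply: (@le_trans _ _ (c^-1%:E * K%:E)%E).
  by rewrite lee_pmul2l// ?lte_fin ?invr_gt0.
rewrite -EFinM lee_fin ler_pdivrMl// /c mulrAC -mulrA mulfV ?gt_eqF// mulr1.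
by rewrite lerDl.
Qed.

End uniform_integrability.

Section measurable_big.
Context d (T : measurableType d) (R : realType) (I : Type).
Implicit Types (r : seq I) (Q : pred I) (F : I -> T -> R).

Lemma measurable_fun_bigprod r Q F : (forall i, Q i -> measurable_fun setT (F i)) ->
  measurable_fun setT (fun w => \prod_(i <- r | Q i) F i w).
Proof.
move=> mF; elim: r => [|i r IH].
  rewrite (_ : (fun w => _) = cst 1)//.
  by apply/funext => w; rewrite big_nil.
under eq_fun do rewrite big_cons.
by case: (boolP (Q i)) => // Qi; apply: measurable_funM => //; exact: mF.
Qed.

End measurable_big.

(** * Brownian increments *)

Section normal_mgf.
Context {R : realType}.
Local Notation mu := (@lebesgue_measure R).

Lemma normal_mgf (s l : R) : s != 0 ->
  (\int[mu]_x (expR (l * x) * normal_pdf 0 s x)%:E = (expR (l ^+ 2 * s ^+ 2 / 2))%:E)%E.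
Proof.
move=> s0.
transitivity (\int[mu]_x ((expR (l ^+ 2 * s ^+ 2 / 2))%:E * (normal_pdf (l * s ^+ 2) s x)%:E))%E.
  apply: eq_integral => x _; rewrite -EFinM !normal_pdfE//; congr EFin.
  rewrite /normal_fun mulrCA [RHS]mulrCA -!expRD; congr (_ * expR _).
  by field.
rewrite ge0_integralZl_EFin ?expR_ge0//.
- by rewrite integral_normal_pdf mule1.
- by move=> x _; rewrite lee_fin normal_pdf_ge0.
- by apply/measurable_EFinP; exact: measurable_normal_pdf.
Qed.

Lemma integral_indic_normal (s : R) (A : set R) : measurable A ->
  (\int[mu]_x (\1_A x * normal_pdf 0 s x)%:E = normal_prob 0 s A)%E.
Proof.
move=> mA; rewrite /normal_prob [RHS]integral_mkcond; apply: eq_integral => x _.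
by rewrite patchE indicE; case: ifP => _; rewrite ?mul1r ?mul0r.
Qed.
End normal_mgf.

Section brownian.
Context {R : realType} {d : measure_display} {Omega : measurableType d}.
Variables (P : probability Omega R) (W : R -> Omega -> R).
Hypothesis HW : standard_BM P W.
Local Notation mu := (@lebesgue_measure R).

Definition incr (s : nat -> R) (i : nat) (w : Omega) := W (s i.+1) w - W (s i) w.

Lemma measurable_W s : measurable_fun setT (W s).
Proof. by case: HW. Qed.

Lemma measurable_incr s i : measurable_fun setT (incr s i).
Proof. by apply: measurable_funB; exact: measurable_W. Qed.

Lemma BM_prod (n : nat) (s : nat -> R) (phi : nat -> R -> R) (c : nat -> R) :
  0 <= s 0%N -> (forall i, (i < n)%N -> s i < s i.+1) ->
  (forall i, measurable_fun setT (phi i)) -> (forall i x, 0 <= phi i x) ->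
  (forall i, (i < n)%N ->
     \int[mu]_x (phi i x * normal_pdf 0 (Num.sqrt (s i.+1 - s i)) x)%:E = (c i)%:E)%E ->
  (\int[P]_w (\prod_(i < n) phi i (incr s i w))%:E = (\prod_(i < n) c i)%:E)%E.
Proof.
move=> s0 si.
(* Induction on the number [j] of factors that are not indicators. *)
suff H (j : nat) : forall (phi : nat -> R -> R) (c : nat -> R),
  (forall i, measurable_fun setT (phi i)) -> (forall i x, 0 <= phi i x) ->
  (forall i, (j <= i)%N -> exists2 A, measurable A & phi i = \1_A) ->
  (forall i, (i < n)%N ->
     \int[mu]_x (phi i x * normal_pdf 0 (Num.sqrt (s i.+1 - s i)) x)%:E = (c i)%:E)%E ->
  (\int[P]_w (\prod_(i < n) phi i (incr s i w))%:E = (\prod_(i < n) c i)%:E)%E.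
  move=> mphi phi0 hphi.
  pose phi' i := if (i < n)%N then phi i else \1_setT.
  have -> : (fun w => (\prod_(i < n) phi i (incr s i w))%:E) =
            (fun w => (\prod_(i < n) phi' i (incr s i w))%:E).
    by apply/funext => w; congr EFin; apply: eq_bigr => i _; rewrite /phi' ltn_ord.
  apply: (H n phi') => //.
  - by move=> i; rewrite /phi'; case: ifP => // _.
  - by move=> i x; rewrite /phi'; case: ifP => // _; rewrite indicE.
  - by move=> i ni; rewrite /phi' ltnNge ni/=; exists setT.
  - by move=> i ni; rewrite /phi' ni; exact: hphi.
elim: j => [|j IH] {}phi {}c mphi phi0 hind hphi.
  have /choice[A hA] : forall i, exists A, measurable A /\ phi i = \1_A.
    by move=> i; have [A ? ?] := hind i (leq0n i); exists A.
  have [_ _ _ /(_ n s A s0 si (fun i => (hA i).1))] := HW.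
  have -> : (\int[P]_w (\prod_(i < n) phi i (incr s i w))%:E)%E =
    P (\bigcap_(i in [set i | (i < n)%N]) [set w | W (s i.+1) w - W (s i) w \in A i]); last first.
    move=> ->; rewrite -prodEFin; apply: eq_bigr => i _.
    by rewrite -hphi// (hA i).2 integral_indic_normal//; case: (hA i).
  set E := \bigcap_(i in _) _.
  have mE : measurable E.
    apply: fin_bigcap_measurable => // i _.
    have -> : [set w | W (s i.+1) w - W (s i) w \in A i] = setT `&` incr s i @^-1` A i.
      by rewrite setTI; apply/seteqP; split => w /=; rewrite inE.
    by apply: measurable_incr => //; case: (hA i).
  rewrite -[E in RHS]setIT -integral_indic//.
  apply: eq_integral => w _; congr EFin; rewrite indicE.
  case: (boolP (w \in E)) => [/set_mem wE|/negP wE].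
    rewrite big1// => i _; rewrite (hA i).2 indicE mem_set//.
    by have /= := wE i (ltn_ord i); rewrite inE.
  apply/eqP; rewrite prodf_seq_eq0; apply/hasP.
  have /existsNP[i /not_implyP[ni nAi]] : ~ (forall i, (i < n)%N -> A i (incr s i w)).
    by move=> h; apply: wE; apply/mem_set => i /= ni; rewrite inE; exact: h.
  exists (Ordinal ni); first by rewrite mem_index_enum.
  by rewrite /= (hA i).2 indicE memNset.
have [nj|jn] := leqP n j.
  pose phi' i := if (i < n)%N then phi i else \1_setT.
  have -> : (fun w => (\prod_(i < n) phi i (incr s i w))%:E) =
            (fun w => (\prod_(i < n) phi' i (incr s i w))%:E).
    by apply/funext => w; congr EFin; apply: eq_bigr => i _; rewrite /phi' ltn_ord.
  apply: (IH phi') => //.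
  - by move=> i; rewrite /phi'; case: ifP => // _.
  - by move=> i x; rewrite /phi'; case: ifP => // _; rewrite indicE.
  - by move=> i ni; rewrite /phi' ltnNge (leq_trans nj ni)/=; exists setT.
  - by move=> i ni; rewrite /phi' ni; exact: hphi.
pose J := Ordinal jn.
have c_ge0 i : (i < n)%N -> 0 <= c i.
  move=> ni; rewrite -lee_fin -hphi//; apply: integral_ge0 => x _.
  by rewrite lee_fin mulr_ge0 ?normal_pdf_ge0.
(* The other factors serve as a density. By induction, applied with factor [j] replaced by the
   indicator of an arbitrary [B], the law of increment [j] under this density is a multiple of its
   Gaussian law. *)
have E : (\int[P]_w (phi j (incr s j w) * \prod_(i < n | i != J) phi i (incr s i w))%:E =
  \int[mu]_x (phi j x * (\prod_(i < n | i != J) c i * normal_pdf 0 (Num.sqrt (s j.+1 - s j)) x))%:E)%E.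
  apply: (@eq_integral_weight _ _ _ _ _ R R P mu (incr s j) id) => //.
  - exact: measurable_incr.
  - by apply: measurable_fun_bigprod => i _; apply: measurableT_comp => //; exact: measurable_incr.
  - by move=> w; apply: prodr_ge0.
  - by apply: measurable_funM => //; exact: measurable_normal_pdf.
  - by move=> x; rewrite mulr_ge0 ?normal_pdf_ge0// prodr_ge0// => i _; apply: c_ge0; exact: ltn_ord.
  - move=> B mB.
    pose phi' i := if i == j then \1_B else phi i.
    pose c' i := if i == j then fine (normal_prob 0 (Num.sqrt (s j.+1 - s j)) B) else c i.
    have hphi' : (\int[P]_w (\prod_(i < n) phi' i (incr s i w))%:E = (\prod_(i < n) c' i)%:E)%E.
      apply: IH.
      - by move=> i; rewrite /phi'; case: eqP => // _.
      - by move=> i x; rewrite /phi'; case: eqP => // _; rewrite indicE.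
      - move=> i ji; rewrite /phi'; case: eqP => [_|/eqP nij]; first by exists B.
        by apply: hind; rewrite ltn_neqAle eq_sym nij.
      - move=> i ni; rewrite /phi' /c'; case: eqP => [->|_]; last exact: hphi.
        rewrite integral_indic_normal// fineK//.
        exact: fin_num_measure.
    transitivity (\int[P]_w (\prod_(i < n) phi' i (incr s i w))%:E)%E.
      rewrite integral_mkcond; apply: eq_integral => w _.
      have -> : \prod_(i < n) phi' i (incr s i w) =
          \1_B (incr s j w) * \prod_(i < n | i != J) phi i (incr s i w).
        rewrite (bigD1 J)//= /phi' eqxx; congr (_ * _).
        by apply: eq_bigr => i iJ; rewrite ifN.
      rewrite patchE indicE.
      have -> : (incr s j w \in B) = (w \in incr s j @^-1` B) by [].
      by case: ifP => _; rewrite ?mul1r ?mul0r.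
    rewrite hphi'.
    have -> : \prod_(i < n) c' i =
        fine (normal_prob 0 (Num.sqrt (s j.+1 - s j)) B) * \prod_(i < n | i != J) c i.
      rewrite (bigD1 J)//= /c' eqxx; congr (_ * _).
      by apply: eq_bigr => i iJ; rewrite ifN.
    under eq_integral do rewrite EFinM.
    rewrite ge0_integralZl_EFin//.
    + by rewrite EFinM muleC fineK//; exact: fin_num_measure.
    + by move=> x _; rewrite lee_fin normal_pdf_ge0.
    + by apply/measurable_EFinP; apply: measurable_funTS; exact: measurable_normal_pdf.
    + by apply: prodr_ge0 => i _; apply: c_ge0; exact: ltn_ord.
rewrite (bigD1 J)//=.
under eq_integral do rewrite (bigD1 J)//=.
rewrite E.
under eq_integral do rewrite mulrCA EFinM.
rewrite ge0_integralZl_EFin.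
- by rewrite hphi// -EFinM mulrC.
- by [].
- by move=> x _; rewrite lee_fin mulr_ge0 ?normal_pdf_ge0.
- apply/measurable_EFinP; apply: measurable_funM; first exact: mphi.
  exact: measurable_normal_pdf.
- by apply: prodr_ge0 => i _; apply: c_ge0; exact: ltn_ord.
Qed.

Definition incr_rect (s : nat -> R) (k : nat) : set (set Omega) :=
  [set E | exists2 A : nat -> set R, (forall i, measurable (A i)) &
    E = \bigcap_(i in [set i | (i < k)%N]) (incr s i @^-1` A i)].

Lemma incr_rect_measurable s k : incr_rect s k `<=` measurable.
Proof.
move=> _ [A mA ->]; apply: fin_bigcap_measurable => // i _.
by rewrite -[X in measurable X]setTI; apply: measurable_incr.
Qed.

Lemma incr_rect_setI s k : setI_closed (incr_rect s k).
Proof.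
move=> _ _ [A mA ->] [A' mA' ->]; exists (fun i => A i `&` A' i).
  by move=> i; exact: measurableI.
by rewrite -bigcapI; apply: eq_bigcapr => i _; rewrite preimage_setI.
Qed.

Lemma incr_rectT s k : incr_rect s k setT.
Proof.
exists (fun=> setT) => //; apply/seteqP; split => // w _ i _ //.
Qed.

Lemma measurable_incr_rect s k i : (i < k)%N ->
  measurable_fun setT (incr s i : g_sigma_algebraType (incr_rect s k) -> R).
Proof.
move=> ik _ B mB; rewrite setTI; apply: sub_sigma_algebra.
exists (fun j => if j == i then B else setT) => [j|]; first by case: ifP.
apply/seteqP; split => w /=.
  by move=> Bw j /= jk; case: eqP => // ->.
by move=> /(_ i ik) /=; rewrite eqxx.
Qed.

Section past_future.
Variables (s : nat -> R) (k n : nat).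
Hypotheses (s0 : 0 <= s 0%N) (si : forall i, (i < n)%N -> s i < s i.+1) (kn : (k <= n)%N).

Let var kap := \sum_(k <= i < n) (kap i ^+ 2 * (s i.+1 - s i) / 2).
Let expo kap w := expR (\sum_(k <= i < n) kap i * incr s i w).

Let measurable_expo kap : measurable_fun setT (expo kap).
Proof.
apply: measurableT_comp => //; apply: measurable_sum => i.
by apply: measurable_funM => //; exact: measurable_incr.
Qed.

Let expo_rect kap (A : nat -> set R) : (forall i, measurable (A i)) ->
  (\int[P]_(w in \bigcap_(i in [set i | (i < k)%N]) (incr s i @^-1` A i)) (expo kap w)%:E =
  (\prod_(0 <= i < k) fine (normal_prob 0 (Num.sqrt (s i.+1 - s i)) (A i)) * expR (var kap))%:E)%E.
Proof.
move=> mA.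
pose phi i := if (i < k)%N then \1_(A i) else fun x => expR (kap i * x).
pose c i := if (i < k)%N then fine (normal_prob 0 (Num.sqrt (s i.+1 - s i)) (A i))
            else expR (kap i ^+ 2 * (s i.+1 - s i) / 2).
have := @BM_prod n s phi c s0 si.
have split_prod (F G : nat -> R) : \prod_(i < n) (if (i < k)%N then F i else G i) =
   \prod_(0 <= i < k) F i * \prod_(k <= i < n) G i.
  rewrite -(big_mkord xpredT (fun i => if (i < k)%N then F i else G i)) (big_cat_nat _ kn)//=.
  congr (_ * _).
    by apply: eq_big_nat => i /andP[_ ->].
  by apply: eq_big_nat => i /andP[ki _]; rewrite ltnNge ki.
have -> : \prod_(i < n) c i =
  \prod_(0 <= i < k) fine (normal_prob 0 (Num.sqrt (s i.+1 - s i)) (A i)) * expR (var kap).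
  by rewrite expR_sum -split_prod.
move=> <-.
- rewrite integral_mkcond; apply: eq_integral => w _.
  have -> : \prod_(i < n) phi i (incr s i w) =
     \prod_(0 <= i < k) \1_(A i) (incr s i w) * expo kap w.
    rewrite /expo expR_sum -split_prod; apply: eq_bigr => i _.
    by rewrite /phi; case: ifP.
  rewrite patchE; case: ifPn => [/set_mem wE|/negP wE].
    rewrite big_nat big1 ?mul1r// => i /andP[_ ik].
    by rewrite indicE mem_set//; exact: wE.
  have /existsNP[i /not_implyP[ni nAi]] : ~ (forall i, (i < k)%N -> A i (incr s i w)).
    by move=> h; apply: wE; apply/mem_set => i /= ni; exact: h.
  rewrite big_mkord (bigD1 (Ordinal ni))//= indicE memNset//.
  by rewrite !mul0r.
- move=> i; rewrite /phi; case: ifP => // _.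
  by apply: measurableT_comp => //; apply: measurable_funM.
- by move=> i x; rewrite /phi; case: ifP => _; rewrite ?expR_ge0// indicE.
- move=> i ni; rewrite /phi /c; case: ifP => _.
    rewrite integral_indic_normal// fineK//.
    by rewrite fin_num_measure//; exact: mA.
  have d0 : 0 < s i.+1 - s i by rewrite subr_gt0 si.
  by rewrite normal_mgf ?gt_eqF ?sqrtr_gt0// sqr_sqrtr// ltW.
Qed.

Lemma integrable_expo kap : P.-integrable setT (EFin \o expo kap).
Proof.
apply/integrableP; split; first by apply/measurable_EFinP; exact: measurable_expo.
under eq_integral do rewrite /= ger0_norm ?expR_ge0//.
have [A mA AT] := incr_rectT s k.
by rewrite AT expo_rect// ltry.
Qed.

(** Past and future increments are independent: on rectangles this is [BM_prod] with indicators for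
    the first [k] factors and exponentials for the rest, and the rectangles form a pi-system. *)
Lemma BM_exp_past kap A : <<s incr_rect s k >> A ->
  (\int[P]_(w in A) (expo kap w)%:E = (expR (var kap))%:E * P A)%E.
Proof.
move=> sA.
have mA : measurable A.
  by move: A sA; apply: smallest_sub; [exact: sigma_algebra_measurable|exact: incr_rect_measurable].
rewrite -integral_cst//.
have rect E : incr_rect s k E ->
    (\int[P]_(w in E) (expo kap w)%:E = \int[P]_(w in E) (expR (var kap))%:E)%E.
  move=> rE; rewrite integral_cst; last exact: incr_rect_measurable rE.
  case: rE => B mB ->; rewrite expo_rect//.
  (* With zero exponents the same formula yields the probability of the rectangle. *)
  have := expo_rect (fun=> 0) B mB.
  have -> : var (fun=> 0) = 0 by rewrite /var big1// => i _; rewrite expr0n/= !mul0r.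
  have -> : (fun w => (expo (fun=> 0) w)%:E) = (fun w => 1%:E).
    by apply/funext => w; rewrite /expo big1 ?expR0// => i _; rewrite mul0r.
  rewrite expR0 mulr1 integral_cst; last first.
    by apply: (incr_rect_measurable s k); exists B.
  by rewrite mul1e => ->; rewrite -EFinM mulrC.
apply: (@eq_integral_pi_system _ _ _ P (incr_rect s k)) => //.
- exact: incr_rect_measurable.
- exact: incr_rect_setI.
- by move=> w; exact: expR_ge0.
- exact: integrable_expo.
- exact: finite_measure_integrable_cst.
- exact/rect/incr_rectT.
Qed.

End past_future.

End brownian.

(** * The bridge in the new clock *)

Lemma cvg_expR (R : realType) (u : nat -> R) (l : R) : u n @[n --> \oo] --> l ->
  expR (u n) @[n --> \oo] --> expR l.
Proof. by move=> ul; apply: continuous_cvg => //; exact: continuous_expR. Qed.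

Section bridge_grids.
Context {R : realType} {d : measure_display} {Omega : measurableType d}.
Variables (P : probability Omega R) (W X : R -> Omega -> R) (t x : R).
Hypotheses (Ht : 0 <= t < 1) (HW : standard_BM P W) (HX : bridge_SDE W X t x).

(* The bridge divided by [1 - s] is a Brownian motion in the clock [(1 - s)^-1]. *)
Definition slope s w := X s w / (1 - s).
Local Notation rate u := (1 - u)^-1.

Lemma slope_continuous T w : t <= T < 1 -> {within `[t, T], continuous (slope ^~ w)}.
Proof.
move=> tT; have [_ _ cW _] := HW.
exact: (bridge_continuous (X ^~ w) (W ^~ w) t x Ht (cW w) (HX w) T tT).
Qed.

Lemma slope_cvg T w (v : nat -> R) u : t <= T < 1 -> (forall n, t <= v n <= T) ->
  t <= u <= T -> v n @[n --> \oo] --> u -> slope (v n) w @[n --> \oo] --> slope u w.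
Proof.
move=> tT vT uT vu; apply/cvgrPdist_lt => e e0.
have [dl dl0 H] := (within_continuous_epsP _ _).1 (slope_continuous T w tT) u e
  (ltac:(by rewrite /= in_itv/= uT)) e0.
near=> n; apply: H; first by rewrite /= in_itv/= vT.
by near: n; exact: cvgr_dist_lt.
Unshelve. all: by end_near. Qed.

Lemma slope_start w : slope t w = x / (1 - t).
Proof. by rewrite /slope (bridge_start (X ^~ w) (W ^~ w) t x Ht (HX w)). Qed.

Lemma slope_riemann T w (p : nat -> nat -> R) (N : nat -> nat) (m : nat -> R) : t <= T < 1 ->
  (forall n, t <= p n 0%N) -> (forall n, p n (N n) <= T) ->
  (forall n i, (i < N n)%N -> p n i <= p n i.+1 <= p n i + m n) ->
  m n @[n --> \oo] --> 0 ->
  (slope (p n (N n)) w - slope (p n 0%N) w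
     - \sum_(i < N n) incr W (p n) i w / (1 - p n i)) @[n --> \oo] --> 0.
Proof.
move=> tT p0 pN pi m0; have [_ _ cW _] := HW.
apply/cvgrPdist_le => e e0.
have [dl dl0 H] := bridge_riemann (X ^~ w) (W ^~ w) t x Ht (cW w) (HX w) T e tT e0.
near=> n; rewrite sub0r normrN; apply: H => // i iN.
have /andP[-> pi2] := pi n i iN; rewrite (le_lt_trans pi2)// ltrD2l.
near: n; have : \forall n \near \oo, `|0 - m n| < dl by apply: cvgr_dist_lt.
apply: filterS => n; rewrite sub0r normrN; exact/le_lt_trans/ler_norm.
Unshelve. all: by end_near. Qed.

Section past.
Variable s : R.
Hypothesis ts : t <= s < 1.

(** Dyadic points are nested, so that the sigma-algebras of their increments grow with [n]. *)
Definition past n (i : nat) : R := t + (s - t) * (i%:R / (2 ^ n)%:R).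
(** For s = t all points coincide, while [standard_BM] speaks of strictly increasing times; the grid
    then carries no increment. *)
Definition past_size n : nat := if t < s then (2 ^ n)%N else 0%N.

Lemma past_double n i : past n.+1 i.*2 = past n i.
Proof.
rewrite /past expnS -mul2n !natrM; congr (_ + _ * _).
by rewrite invfM mulrACA divff ?mul1r// pnatr_eq0.
Qed.

Lemma incr_past n i w :
  incr W (past n) i w = incr W (past n.+1) i.*2 w + incr W (past n.+1) i.*2.+1 w.
Proof. by rewrite /incr -[i.*2.+2]doubleS !past_double [RHS]addrC addrA subrK. Qed.

Let rect n := incr_rect W (past n) (past_size n).

Let measurable_incr_past n i : (i < past_size n)%N ->
  measurable_fun setT (incr W (past n) i : g_sigma_algebraType (rect n) -> R).
Proof. exact: measurable_incr_rect. Qed.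

Let rectS n : <<s rect n >> `<=` <<s rect n.+1 >>.
Proof.
apply: smallest_sub; first exact: smallest_sigma_algebra.
move=> _ [A mA ->].
change (@measurable _ (g_sigma_algebraType (rect n.+1))
  (\bigcap_(i in [set i | (i < past_size n)%N]) incr W (past n) i @^-1` A i)).
apply: fin_bigcap_measurable => // i /= iN.
have -> : incr W (past n) i = incr W (past n.+1) i.*2 \+ incr W (past n.+1) i.*2.+1.
  by apply/funext => w; exact: incr_past.
rewrite -[X in measurable X]setTI.
have [i1 i2] : (i.*2 < past_size n.+1)%N /\ (i.*2.+1 < past_size n.+1)%N.
  move: iN; rewrite /past_size; case: ifP => // _; rewrite expnS mul2n => iN.
  by rewrite ltn_double ltn_Sdouble.
apply: (@measurable_funD _ (g_sigma_algebraType (rect n.+1))) => //; exact: measurable_incr_past.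
Qed.

Let rect_mono n m : (n <= m)%N -> <<s rect n >> `<=` <<s rect m >>.
Proof.
elim: m => [|m IH]; first by rewrite leqn0 => /eqP ->.
by rewrite leq_eqVlt => /predU1P[->//|/IH h]; exact: subset_trans (rectS m).
Qed.

(** An increasing union of sigma-algebras, hence closed under intersection: the pi-system on which
    identities are tested before passing to [<<s past_events >>]. *)
Definition past_events : set (set Omega) := [set E | exists n, <<s rect n >> E].

Lemma past_events_measurable : past_events `<=` measurable.
Proof.
move=> E [n]; move: E; apply: smallest_sub; first exact: sigma_algebra_measurable.
exact: (incr_rect_measurable _ _ HW).
Qed.

Lemma past_events_setI : setI_closed past_events.
Proof.
move=> A B [n nA] [m mB]; exists (maxn n m).
apply: (@measurableI _ (g_sigma_algebraType (rect (maxn n m)))).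
  by apply: rect_mono nA; rewrite leq_maxl.
by apply: rect_mono mB; rewrite leq_maxr.
Qed.

(** [slope u] is a pointwise limit of Riemann sums of dyadic increments. The index [j n] is that of
    the last dyadic point not after [u], so the sums never look beyond [s]. *)
Lemma measurable_slope_past u : t <= u <= s ->
  measurable_fun setT (slope u : g_sigma_algebraType past_events -> R).
Proof.
move=> /andP[tu us]; have /andP[_ s1] := ts.
pose j n := Num.truncn ((2 ^ n)%:R * ((u - t) / (s - t))).
have pow0 n : 0 < (2 ^ n)%:R :> R by rewrite ltr0n expn_gt0.
have j_bound n : [/\ (j n <= past_size n)%N, t <= past n (j n), past n (j n) <= u &
    u <= past n (j n) + (s - t) / (2 ^ n)%:R].
  rewrite /past_size; case: ifPn => [lts|]; last first.
    rewrite -leNgt => st; have es : s = t by apply/eqP; rewrite eq_le st (le_trans tu).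
    have eu : u = t by apply/eqP; rewrite eq_le tu andbT -es.
    by rewrite /j /past es eu subrr !mul0r mulr0 truncn0 !addr0.
  have st0 : 0 < s - t by rewrite subr_gt0.
  have z0 : 0 <= (2 ^ n)%:R * ((u - t) / (s - t)).
    by rewrite mulr_ge0 ?ler0n// divr_ge0 ?subr_ge0// ltW.
  have /andP[j1 j2] := truncn_itv z0.
  split.
  - rewrite truncn_le_nat (le_lt_trans _ (_ : (2 ^ n)%:R < _)) ?ltr_nat//.
    by rewrite ler_piMr ?ler0n// ler_pdivrMr// mul1r lerD2r.
  - by rewrite /past lerDl mulr_ge0 ?(ltW st0)// divr_ge0.
  - by rewrite /past -lerBrDl mulrC -ler_pdivlMr// ler_pdivrMr// mulrC.
  - rewrite /past -addrA -lerBlDl -mulrDr mulrC -ler_pdivrMr// -[X in _ <= _ + X]mul1r -mulrDl natr1 ler_pdivlMr//.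
    by rewrite mulrC ltW.
have mesh0 : (s - t) / (2 ^ n)%:R @[n --> \oo] --> (0 : R).
  rewrite -[0](mulr0 (s - t)); apply: cvgM; first exact: cvg_cst.
  under eq_fun do rewrite natrX -exprVn.
  by apply: cvg_expr; rewrite ger0_norm ?invr_ge0// invf_lt1// ltr1n.
pose S n w := x / (1 - t) + \sum_(i < j n) incr W (past n) i w / (1 - past n i).
apply: (@measurable_fun_cvg _ (g_sigma_algebraType past_events) R setT S).
- move=> n; apply: measurable_funD => //; apply: measurable_sum => i.
  apply: measurable_funM => //.
  have [jk _ _ _] := j_bound n.
  have := measurable_incr_past n i (leq_trans (ltn_ord i) jk).
  move=> h _ B mB; have := h measurableT B mB; rewrite !setTI.
  by move=> E; apply: sub_sigma_algebra; exists n.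
move=> w _.
have c1 : (slope (past n (j n)) w - S n w) @[n --> \oo] --> 0.
  have past0 n : past n 0 = t by rewrite /past mul0r mulr0 addr0.
  have -> : (fun n => slope (past n (j n)) w - S n w) = (fun n =>
      slope (past n (j n)) w - slope (past n 0) w
      - \sum_(i < j n) incr W (past n) i w / (1 - past n i)).
    by apply/funext => n; rewrite past0 slope_start /S opprD addrA.
  apply: (slope_riemann s w past j (fun n => (s - t) / (2 ^ n)%:R)) => //.
  - by move=> n; rewrite past0.
  - by move=> n; have [_ _ h _] := j_bound n; rewrite (le_trans h).
  - move=> n i ij; rewrite /past -natr1 [(_ + 1) / _]mulrDl mul1r mulrDr addrA lexx andbT lerDl.
    by rewrite divr_ge0 ?ler0n// subr_ge0 (le_trans tu).
have c2 : slope (past n (j n)) w @[n --> \oo] --> slope u w.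
  apply: (slope_cvg s) => //; [|by rewrite tu|].
    by move=> n; have [_ -> h _] := j_bound n; rewrite (le_trans h).
  apply: (@squeeze_cvgr _ _ _ _ (fun n => u - (s - t) / (2 ^ n)%:R) (cst u)).
  - by near=> n; have [_ _ -> h] := j_bound n; rewrite lerBlDr h.
  - by rewrite -[X in _ --> X]subr0; apply: cvgB => //; exact: cvg_cst.
  - exact: cvg_cst.
have -> : S ^~ w = (fun n => slope (past n (j n)) w - (slope (past n (j n)) w - S n w)).
  by apply/funext => n; rewrite opprB addrC subrK.
by rewrite -[X in _ --> X]subr0; exact: cvgB.
Unshelve. all: by end_near. Qed.

(** Since [X] starts from a constant, its past contains nothing beyond the increments of [W] after
    [t]. This transfers the independence of future increments to the filtration of the stopping
    times. *)
Lemma nat_filtration_sub : nat_filtration X t s `<=` <<s past_events >>.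
Proof.
apply: smallest_sub; first exact: smallest_sigma_algebra.
move=> _ [u [A [/andP[tu us] mA ->]]]; have /andP[_ s1] := ts.
have -> : X u @^-1` A = (fun w => slope u w * (1 - u)) @^-1` A.
  have u0 : 1 - u != 0 by rewrite gt_eqF// subr_gt0 (le_lt_trans us).
  by congr (_ @^-1` A); apply/funext => w; rewrite /slope mulfVK.
have mf : measurable_fun setT
    ((fun w => slope u w * (1 - u)) : g_sigma_algebraType past_events -> R).
  by apply: measurable_funM => //; apply: measurable_slope_past; rewrite tu.
by have := mf measurableT A mA; rewrite setTI.
Qed.

Lemma nat_filtration_measurable : nat_filtration X t s `<=` measurable.
Proof.
apply: subset_trans nat_filtration_sub _; apply: smallest_sub.
  exact: sigma_algebra_measurable.
exact: past_events_measurable.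
Qed.

Lemma past_size_past n : past n (past_size n) = s.
Proof.
rewrite /past /past_size; case: ifPn => [_|].
  by rewrite divff ?mulr1 ?pnatr_eq0 ?expn_eq0// addrC subrK.
by rewrite -leNgt mul0r mulr0 addr0 => st; apply/eqP; rewrite eq_le st; case/andP: ts => ->.
Qed.

Lemma past_lt n i : (i < past_size n)%N -> past n i < past n i.+1.
Proof.
rewrite /past_size; case: ifP => // lts _.
rewrite /past ltrD2l ltr_pM2l ?subr_gt0// ltr_pM2r ?invr_gt0 ?ltr0n ?expn_gt0//.
by rewrite ltr_nat.
Qed.

Lemma measurable_slope : measurable_fun setT (slope s).
Proof.
have /andP[t1 _] := ts.
have ms := measurable_slope_past s (ltac:(by rewrite t1 lexx)).
move=> _ B mB; rewrite setTI.
have : <<s past_events >> (slope s @^-1` B) by have := ms measurableT B mB; rewrite setTI.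
by move: (_ @^-1` _); apply: smallest_sub;
  [exact: sigma_algebra_measurable | exact: past_events_measurable].
Qed.

Section future.
Variable s' : R.
Hypotheses (ss' : s < s') (s'1 : s' < 1).

Definition future N (i : nat) : R := s + (s' - s) * (i%:R / N%:R).

Let grid n N i := if (i < past_size n)%N then past n i else future N (i - past_size n).

Lemma future0 N : future N 0 = s.
Proof. by rewrite /future mul0r mulr0 addr0. Qed.

Lemma future_lt N i : (0 < N)%N -> future N i < future N i.+1.
Proof.
move=> N0; rewrite /future ltrD2l ltr_pM2l ?subr_gt0// ltr_pM2r ?invr_gt0 ?ltr0n//.
by rewrite ltr_nat.
Qed.

Let grid_past n N i : (i <= past_size n)%N -> grid n N i = past n i.
Proof.
rewrite leq_eqVlt => /predU1P[->|]; last by rewrite /grid => ->.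
by rewrite /grid ltnn subnn future0 past_size_past.
Qed.

Let grid_future n N j : grid n N (past_size n + j) = future N j.
Proof. by rewrite /grid ltnNge leq_addr/= addnC addnK. Qed.

(** The dyadic grid of the past and the uniform grid of the future are concatenated into one grid,
    to which [BM_exp_past] applies; the pi-system [past_events] then removes the dependence on the
    level [n]. *)
Lemma future_exp N (kap : nat -> R) A : (0 < N)%N -> <<s past_events >> A ->
  (\int[P]_(w in A) (expR (\sum_(i < N) kap i * incr W (future N) i w))%:E =
   (expR (\sum_(i < N) (kap i ^+ 2 * (future N i.+1 - future N i) / 2)))%:E * P A)%E.
Proof.
move=> N0; pose xi w := expR (\sum_(i < N) kap i * incr W (future N) i w).
set c := expR _; rewrite -/(xi _) => pA.
have mA : measurable A.
  move: A pA; apply: smallest_sub; first exact: sigma_algebra_measurable.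
  exact: past_events_measurable.
have key n B : <<s rect n >> B -> (\int[P]_(w in B) (xi w)%:E = c%:E * P B)%E.
  move=> rB.
  have g0 : 0 <= grid n N 0.
    by rewrite grid_past// /past mul0r mulr0 addr0; case/andP: Ht.
  have gi i : (i < past_size n + N)%N -> grid n N i < grid n N i.+1.
    case: (ltnP i (past_size n)) => ik iN.
      by rewrite !grid_past// ?past_lt// ltnW.
    by rewrite -(subnKC ik) -addnS !grid_future future_lt.
  have eg : incr_rect W (grid n N) (past_size n) = rect n.
    have ei i : (i < past_size n)%N -> incr W (grid n N) i = incr W (past n) i.
      by move=> ik; apply/funext => w; rewrite /incr !grid_past// ltnW.
    by apply/seteqP; split => _ [D mD ->]; exists D => //; apply: eq_bigcapr => i /= /ei ->.
  have := BM_exp_past P W HW (grid n N) (past_size n) (past_size n + N) g0 gi (leq_addr _ _)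
    (fun i => kap (i - past_size n)%N) B.
  rewrite eg => /(_ rB) /=.
  move=> h.
  have e1 w : \sum_(past_size n <= i < past_size n + N) kap (i - past_size n)%N * incr W (grid n N) i w
     = \sum_(i < N) kap i * incr W (future N) i w.
    rewrite -{1}[past_size n]add0n big_addn addKn big_mkord; apply: eq_bigr => i _.
    by rewrite addnK /incr -addSn addnC !grid_future addnC grid_future.
  have e2 : \sum_(past_size n <= i < past_size n + N)
       kap (i - past_size n)%N ^+ 2 * (grid n N i.+1 - grid n N i) / 2
     = \sum_(i < N) (kap i ^+ 2 * (future N i.+1 - future N i) / 2).
    rewrite -{1}[past_size n]add0n big_addn addKn big_mkord; apply: eq_bigr => i _.
    by rewrite addnK -addSn addnC !grid_future addnC grid_future.
  rewrite /c -e2 -h; apply: eq_integral => w _.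
  by rewrite e1.
have xi0 w : 0 <= xi w by exact: expR_ge0.
have c0 : 0 <= c by exact: expR_ge0.
have cE B : measurable B -> (\int[P]_(w in B) c%:E = c%:E * P B)%E by move=> mB; exact: integral_cst.
have keyT : (\int[P]_w (xi w)%:E = c%:E * P setT)%E.
  by apply: (key 0%N); exact: (@measurableT _ (g_sigma_algebraType (rect 0))).
have mxi : measurable_fun setT xi.
  apply: measurableT_comp => //; apply: measurable_sum => i.
  by apply: measurable_funM => //; exact: (measurable_incr _ _ HW).
have ixi : P.-integrable setT (EFin \o xi).
  apply/integrableP; split; first exact/measurable_EFinP.
  have -> : (\int[P]_w `|(EFin \o xi) w| = \int[P]_w (xi w)%:E)%E.
    by apply: eq_integral => w _; rewrite /= ger0_norm.
  by rewrite keyT probability_setT mule1 ltry.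
rewrite -cE//.
apply: (@eq_integral_pi_system _ _ _ P past_events xi (cst c) past_events_measurable
  past_events_setI xi0 _ ixi _ _ _ A pA).
- by move=> w; exact: c0.
- exact: finite_measure_integrable_cst.
- by rewrite keyT cE.
- move=> B [n nB]; rewrite (key n)// cE//.
  by apply: past_events_measurable; exists n.
Unshelve. all: by end_near. Qed.

(** [q] is the left Riemann sum of the increasing function (1 - s)^-2, whose integral is [h]. On
    each cell the gap is exactly the mesh times the left rate times the increase of the rate. *)
Lemma future_rate_sum N h q : (0 < N)%N -> h = rate s' - rate s ->
  q = \sum_(i < N) (rate (future N i) ^+ 2 * (future N i.+1 - future N i)) ->
  h - (s' - s) / N%:R * (rate s' * h) <= q <= h.
Proof.
move=> N0 hE0 qE; have N0' : 0 < N%:R :> R by rewrite ltr0n.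
have futN : future N N = s' by rewrite /future divff ?mulr1 ?gt_eqF// addrC subrK.
have D i : future N i.+1 - future N i = (s' - s) / N%:R.
  by rewrite /future -natr1; field; exact: lt0r_neq0.
have fut i : (i <= N)%N -> s <= future N i <= s'.
  move=> iN; rewrite /future lerDl mulr_ge0 ?divr_ge0 ?ler0n ?subr_ge0 ?(ltW ss')//=.
  rewrite -lerBrDl ler_piMr ?subr_ge0 ?(ltW ss')// ler_pdivrMr// mul1r ler_nat//.
have pos i : (i <= N)%N -> 0 < 1 - future N i.
  by move=> /fut /andP[_ h1]; rewrite subr_gt0 (le_lt_trans h1).
have hE : h = \sum_(i < N) (rate (future N i.+1) - rate (future N i)).
  rewrite hE0 -(big_mkord xpredT (fun i => rate (future N i.+1) - rate (future N i))).
  by rewrite telescope_sumr// futN future0.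
have dE i : (i < N)%N -> rate (future N i.+1) - rate (future N i) =
    rate (future N i) * rate (future N i.+1) * (future N i.+1 - future N i).
  by move=> iN; have := pos i (ltnW iN); have := pos i.+1 iN => ? ?; field; rewrite ?gt_eqF.
have Dge0 : 0 <= (s' - s) / N%:R by rewrite divr_ge0 ?subr_ge0 ?(ltW ss') ?ler0n.
have mono i : (i < N)%N -> 0 <= rate (future N i.+1) - rate (future N i).
  by move=> iN; rewrite dE// D mulr_ge0// mulr_ge0// invr_ge0 ltW// pos// ltnW.
have gap i : (i < N)%N ->
    rate (future N i.+1) - rate (future N i) - rate (future N i) ^+ 2 * (future N i.+1 - future N i)
    = (s' - s) / N%:R * (rate (future N i) * (rate (future N i.+1) - rate (future N i))).
  by move=> iN; rewrite [X in X - _ = _]dE// !D; ring.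
have qh : h - q = \sum_(i < N) ((s' - s) / N%:R *
    (rate (future N i) * (rate (future N i.+1) - rate (future N i)))).
  by rewrite hE qE -sumrB; apply: eq_bigr => i _; rewrite gap.
apply/andP; split.
  rewrite lerBlDr -lerBlDl qh -mulr_sumr ler_wpM2l// hE mulr_sumr.
  apply: ler_sum => i _; have iN := ltn_ord i; rewrite ler_wpM2r ?mono//.
  rewrite lef_pV2 ?posrE ?subr_gt0//; last by have := pos i (ltnW iN); rewrite subr_gt0.
  by rewrite lerD2l lerN2; have /andP[] := fut i (ltnW iN).
rewrite -subr_ge0 qh sumr_ge0// => i _; have iN := ltn_ord i.
by rewrite mulr_ge0// mulr_ge0 ?mono// invr_ge0 ltW// pos// ltnW.
Qed.

End future.
End past.

(** Conditionally on the past, the increment of [Y] is a centred Gaussian whose variance is the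
    elapsed clock. The Riemann sums of [W] have this property with variance [q n]; they converge
    pathwise, their variances converge, and an L^2 bound exchanges limit and integral. *)
Lemma slope_exp s s' l A : t <= s -> s < s' -> s' < 1 -> nat_filtration X t s A ->
  (\int[P]_(w in A) (expR (l * (slope s' w - slope s w)))%:E =
   (expR (l ^+ 2 * (rate s' - rate s) / 2))%:E * P A)%E.
Proof.
move=> tles ss' s'1 FA; have s1 := lt_trans ss' s'1.
have ts : t <= s < 1 by rewrite tles.
have ts' : t <= s' < 1 by rewrite s'1 (le_trans tles)// ltW.
have mA : measurable A by exact: nat_filtration_measurable FA.
have pA := nat_filtration_sub s ts _ FA.
pose fut n := future s s' n.+1.
pose kap n i := l / (1 - fut n i).
(* The value c = 1 is the exponential of interest; c = 2 is its square, whose mean is at most exp (2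
   l^2 h). *)
pose xi (c : R) n w := expR (\sum_(i < n.+1) c * kap n i * incr W (fut n) i w).
pose q n := \sum_(i < n.+1) (rate (fut n i) ^+ 2 * (fut n i.+1 - fut n i)).
pose h := rate s' - rate s.
have xiE c n B : <<s past_events s >> B ->
    (\int[P]_(w in B) (xi c n w)%:E = (expR (c ^+ 2 * l ^+ 2 * q n / 2))%:E * P B)%E.
  move=> pB; rewrite (future_exp s ts s' ss' n.+1 (fun i => c * kap n i))//.
  congr (_%:E * _)%E; congr expR; rewrite /q mulr_sumr mulr_suml; apply: eq_bigr => i _.
  rewrite /kap -!/(fut n _); move: (rate (fut n i)) (fut n i.+1 - fut n i) => a b.
  by ring.
have qb n : h - (s' - s) / n.+1%:R * (rate s' * h) <= q n <= h.
  exact: (future_rate_sum s s' ss' s'1 n.+1 h (q n)).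
pose f n w := \1_A w * xi 1 n w.
pose g w := \1_A w * expR (l * (slope s' w - slope s w)).
have mxi c n : measurable_fun setT (xi c n).
  apply: measurableT_comp => //; apply: measurable_sum => i.
  by apply: measurable_funM => //; exact: (measurable_incr _ _ HW).
have m1A : measurable_fun setT (\1_A : Omega -> R) by exact: measurable_indic.
have [ig cg] : P.-integrable setT (EFin \o g) /\ \int[P]_w f n w @[n --> \oo] --> \int[P]_w g w.
  apply: (@cvg_Rintegral_sqr _ _ _ P f g (expR (2 * l ^+ 2 * h))).
  - by move=> n; exact: measurable_funM.
  - apply: measurable_funM => //; apply: measurableT_comp => //; apply: measurable_funM => //.
    by apply: measurable_funB; exact: measurable_slope.
  - by move=> n w; rewrite mulr_ge0 ?expR_ge0// indicE.
  - by move=> w; rewrite mulr_ge0 ?expR_ge0// indicE.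
  - apply: aeW => w; apply: cvgM; first exact: cvg_cst.
    suff h1 : \sum_(i < n.+1) 1 * kap n i * incr W (fut n) i w @[n --> \oo] -->
        l * (slope s' w - slope s w).
      exact: cvg_expR.
    have fut1 n : fut n n.+1 = s'.
      by rewrite /fut /future divff ?mulr1 ?pnatr_eq0// addrC subrK.
    have fut0 n : fut n 0%N = s by exact: future0.
    pose E n := slope s' w - slope s w - \sum_(i < n.+1) incr W (fut n) i w / (1 - fut n i).
    have -> : (fun n => \sum_(i < n.+1) 1 * kap n i * incr W (fut n) i w) =
        (fun n => l * (slope s' w - slope s w - E n)).
      apply/funext => n; rewrite /E opprB addrC subrK mulr_sumr; apply: eq_bigr => i _.
      by rewrite /kap mul1r mulrAC mulrA.
    rewrite -[X in _ --> l * X]subr0; apply: cvgM; first exact: cvg_cst.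
    apply: cvgB; first exact: cvg_cst.
    have -> : E = (fun n => slope (fut n n.+1) w - slope (fut n 0%N) w
         - \sum_(i < n.+1) incr W (fut n) i w / (1 - fut n i)).
      by apply/funext => n; rewrite fut1 fut0.
    apply: (slope_riemann s' w fut (fun n => n.+1) (fun n => (s' - s) / n.+1%:R)) => //.
    + by move=> n; rewrite fut0.
    + by move=> n; rewrite fut1.
    + move=> n i _; rewrite ltW ?future_lt//= /fut /future.
      by rewrite -[i.+1%:R]natr1 [(_ + 1) / _]mulrDl mul1r [_ * (_ + _)]mulrDr addrA.
    rewrite -[0](mulr0 (s' - s)); apply: cvgM; first exact: cvg_cst.
    exact: cvg_harmonic.
  - move=> n; apply: (@le_trans _ _ (\int[P]_w (xi 2 n w)%:E)%E).
      apply: ge0_le_integral => //.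
      - by move=> w _; rewrite lee_fin sqr_ge0.
      - by apply/measurable_EFinP; apply: measurable_funX; exact: measurable_funM.
      - exact/measurable_EFinP.
      move=> w _; rewrite lee_fin exprMn indicE.
      have -> : xi 1 n w ^+ 2 = xi 2 n w.
        rewrite expr2 -expRD; congr expR; rewrite -big_split; apply: eq_bigr => i _ /=.
        by rewrite -mulrDl -mulrDl.
      by case: (w \in A); rewrite ?expr1n ?mul1r// expr0n mul0r expR_ge0.
    rewrite xiE; last exact: (@measurableT _ (g_sigma_algebraType (past_events s))).
    rewrite probability_setT mule1 lee_fin ler_expR.
    have /andP[_ qh] := qb n; have := ler_wpM2l (sqr_ge0 l) qh; lra.
have If n : \int[P]_w f n w = expR (l ^+ 2 * q n / 2) * fine (P A).
  have /(congr1 fine) := xiE 1 n A pA.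
  rewrite expr1n mul1r fineM ?fin_num_measure//= => <-.
  rewrite [in RHS]integral_mkcond /Rintegral; congr fine; apply: eq_integral => w _.
  by rewrite patchE /f indicE; case: ifP => _; rewrite ?mul1r ?mul0r.
have cq : q n @[n --> \oo] --> h.
  apply: (@squeeze_cvgr _ _ _ _ (fun n => h - (s' - s) * harmonic n * (rate s' * h)) (cst h)).
  - by near=> n; exact: qb.
  - rewrite -[X in _ --> X]subr0; apply: cvgB; first exact: cvg_cst.
    rewrite -[X in _ --> X](mul0r (rate s' * h)); apply: cvgM; last exact: cvg_cst.
    by rewrite -[X in _ --> X](mulr0 (s' - s)); apply: cvgM; [exact: cvg_cst|exact: cvg_harmonic].
  - exact: cvg_cst.
have Ig : \int[P]_w g w = expR (l ^+ 2 * h / 2) * fine (P A).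
  apply/esym; apply: (@cvg_unique _ _ (\int[P]_w f n w @[n --> \oo])) cg => //.
  have -> : (fun n => \int[P]_w f n w) = (fun n => expR (l ^+ 2 * q n / 2) * fine (P A)).
    exact/funext.
  apply: cvgM; last exact: cvg_cst.
  have h1 : l ^+ 2 * q n / 2 @[n --> \oo] --> l ^+ 2 * h / 2.
    by apply: cvgM; [apply: cvgM|]; [exact: cvg_cst|exact: cq|exact: cvg_cst].
  exact: cvg_expR.
transitivity (\int[P]_w (g w)%:E)%E.
  rewrite integral_mkcond; apply: eq_integral => w _.
  by rewrite patchE /g indicE; case: ifP => _; rewrite ?mul1r ?mul0r.
have -> : (\int[P]_w (g w)%:E)%E = (\int[P]_w g w)%:E.
  by rewrite /Rintegral fineK//; exact: integrable_fin_num.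
by rewrite Ig EFinM fineK ?fin_num_measure.
Unshelve. all: by end_near. Qed.

End bridge_grids.

(** * Conditional moments of an increment *)

Lemma expR_le_quad (R : realType) (u : R) : 0 <= u -> u <= 2^-1 -> expR u <= 1 + u + 2 * u ^+ 2.
Proof.
move=> u0 u2; have h := expR_ge1Dx (- u).
rewrite -[expR u]invrK -expRN; apply: (@le_trans _ _ (1 - u)^-1).
  by rewrite lef_pV2 ?posrE ?expR_gt0//; lra.
rewrite -[leLHS]mul1r ler_pdivrMr; last lra.
nra.
Qed.

Lemma le_of_small (R : realType) (a b c e0 : R) : 0 < e0 -> 0 <= c ->
  (forall e, 0 < e -> e <= e0 -> a <= b + e * c) -> a <= b.
Proof.
move=> e00 c0 H; apply/ler_addgt0Pr => e e_gt0.
have c1 : 0 < c + 1 by rewrite ltr_wpDl.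
have e'0 : 0 < Num.min e0 (e / (c + 1)) by rewrite lt_min e00 divr_gt0.
apply: le_trans (H _ e'0 _) _; first by rewrite ge_min lexx.
rewrite lerD2l (@le_trans _ _ (e / (c + 1) * c))//; first by rewrite ler_wpM2r// ge_min lexx orbT.
by rewrite mulrAC ler_pdivrMr// ler_pM2l// lerDl.
Qed.

Section integrable_real.
Context d (T : measurableType d) (R : realType) (m : {measure set T -> \bar R}) (A : set T).
Hypothesis mA : measurable A.
Implicit Types f g : T -> R.

Lemma integrable_scale c f : m.-integrable A (EFin \o f) -> m.-integrable A (fun w => (c * f w)%:E).
Proof. by move=> fi; apply: eq_integrable (integrableZl mA c fi). Qed.

Lemma integrable_add f g : m.-integrable A (EFin \o f) -> m.-integrable A (EFin \o g) ->
  m.-integrable A (fun w => (f w + g w)%:E).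
Proof. by move=> fi gi; apply: eq_integrable (integrableD mA fi gi). Qed.

Lemma integrable_sub f g : m.-integrable A (EFin \o f) -> m.-integrable A (EFin \o g) ->
  m.-integrable A (fun w => (f w - g w)%:E).
Proof. by move=> fi gi; apply: eq_integrable (integrableB mA fi gi). Qed.

End integrable_real.

Section exponential_increment.
Context {R : realType} {d : measure_display} {Omega : measurableType d}.
Variables (P : probability Omega R) (Gen : set (set Omega)).
Local Notation mu := (@lebesgue_measure R).
Local Notation adapted f := (measurable_fun setT (f : g_sigma_algebraType Gen -> R)).
Hypothesis sub : <<s Gen >> `<=` @measurable d Omega.

Lemma adapted_measurable (f : Omega -> R) : adapted f -> measurable_fun setT f.
Proof.
move=> mf _ B mB; rewrite setTI; apply: sub.
by have := mf measurableT B mB; rewrite setTI.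
Qed.

Lemma adapted_indic A : <<s Gen >> A -> adapted (\1_A : Omega -> R).
Proof. by move=> FA; exact: (@measurable_indic _ (g_sigma_algebraType Gen) R setT A). Qed.

Lemma G_tonelli (Z : Omega -> R) A r : measurable_fun setT Z -> measurable A -> 0 < r ->
  (\int[P]_(w in A) (G r (Z w))%:E = \int[mu]_l \int[P]_w
     (\1_A w * (\1_`[0%R, +oo[%classic l * expR (l * Z w - l ^+ 2 * r / 2)))%:E)%E.
Proof.
move=> mZ mA r0.
pose k (z : Omega * R) : \bar R :=
  (\1_A z.1 * (\1_`[0%R, +oo[%classic z.2 * expR (z.2 * Z z.1 - z.2 ^+ 2 * r / 2)))%:E.
have k0 z : (0 <= k z)%E.
  by rewrite lee_fin mulr_ge0 ?mulr_ge0 ?expR_ge0// indicE.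
have mk : measurable_fun setT k.
  apply/measurable_EFinP; apply: measurable_funM.
    have m1 : measurable_fun setT (\1_A : Omega -> R) by exact: measurable_indic.
    exact: (measurableT_comp m1 measurable_fst).
  apply: measurable_funM.
    have m1 : measurable_fun setT (\1_`[0%R, +oo[%classic : R -> R) by exact: measurable_indic.
    exact: (measurableT_comp m1 measurable_snd).
  apply: measurableT_comp => //; apply: measurable_funB.
    apply: measurable_funM; first exact: measurable_snd.
    exact: (measurableT_comp mZ measurable_fst).
  by apply: measurable_funM => //; apply: measurable_funM => //;
    apply: measurable_funX; exact: measurable_snd.
rewrite -(@fubini_tonelli _ _ _ _ _ P mu k mk k0) integral_mkcond.
apply: eq_integral => w _; rewrite patchE /k/=.
transitivity (\int[mu]_l ((\1_A w)%:E * (\1_`[0%R, +oo[%classic l * expR (l * Z w - l ^+ 2 * r / 2))%:E))%E; last first.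
  by apply: eq_integral => l _; rewrite EFinM.
rewrite ge0_integralZl_EFin//; last first.
  apply/measurable_EFinP; apply: measurable_funM; first exact: measurable_indic.
  by apply: measurableT_comp => //; apply: measurable_funB; apply: measurable_funM => //;
    apply: measurable_funM => //; exact: measurable_funX.
rewrite indicE; case: ifP => _; rewrite ?mul0e// mul1e G_integral//.
rewrite [LHS]integral_mkcond; apply: eq_integral => l _.
by rewrite patchE indicE; case: ifP => _; rewrite ?mul1r ?mul0r.
Qed.

Variables (Y D : Omega -> R) (h : R).
Hypotheses (mY : adapted Y) (mD : measurable_fun setT D) (h0 : 0 <= h).
Hypothesis hexp : forall l A, <<s Gen >> A ->
  (\int[P]_(w in A) (expR (l * D w))%:E = (expR (l ^+ 2 * h / 2))%:E * P A)%E.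

(** [hexp] is the case of indicators; [eq_integral_weight], with the identity as map into the
    sigma-algebra of [Gen], extends it to adapted weights. *)
Lemma exp_increment_weight (Z : Omega -> R) l : adapted Z -> (forall w, 0 <= Z w) ->
  (\int[P]_w (Z w * expR (l * D w))%:E = \int[P]_w (Z w * expR (l ^+ 2 * h / 2))%:E)%E.
Proof.
move=> mZ Z0.
apply: (@eq_integral_weight d Omega d Omega _ (g_sigma_algebraType Gen) R P P id id
   (fun w => expR (l * D w)) (cst (expR (l ^+ 2 * h / 2))) Z) => //.
- by move=> _ B mB; rewrite setTI; apply: sub.
- by move=> _ B mB; rewrite setTI; apply: sub.
- by apply: measurableT_comp => //; exact: measurable_funM.
- by move=> w; exact: expR_ge0.
move=> B mB; rewrite preimage_id hexp//.
by rewrite -[RHS]/(\int[P]_(w in B) (expR (l ^+ 2 * h / 2))%:E)%E integral_cst//; exact: sub.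
Qed.

Lemma G_martingale A r : <<s Gen >> A -> 0 < r ->
  (\int[P]_(w in A) (G (r + h) (Y w + D w))%:E = \int[P]_(w in A) (G r (Y w))%:E)%E.
Proof.
move=> FA r0; have mA := sub _ FA; have mY' := adapted_measurable Y mY.
have mYD : measurable_fun setT (fun w => Y w + D w) by exact: measurable_funD.
have rh0 : 0 < r + h by rewrite ltr_wpDr.
rewrite (G_tonelli (fun w => Y w + D w) A (r + h) mYD mA rh0) (G_tonelli Y A r mY' mA r0).
apply: eq_integral => l _.
pose Z w := \1_A w * (\1_`[0%R, +oo[%classic l * expR (l * Y w - l ^+ 2 * (r + h) / 2)).
transitivity (\int[P]_w (Z w * expR (l * D w))%:E)%E.
  apply: eq_integral => w _; rewrite /Z -!mulrA -expRD; congr ((_ * (_ * expR _))%:E); ring.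
rewrite exp_increment_weight.
- apply: eq_integral => w _; rewrite /Z -!mulrA -expRD; congr ((_ * (_ * expR _))%:E); ring.
- apply: measurable_funM; first exact: adapted_indic.
  apply: measurable_funM => //; apply: measurableT_comp => //.
  by apply: measurable_funB => //; exact: measurable_funM.
- by move=> w; rewrite mulr_ge0 ?mulr_ge0 ?expR_ge0// indicE.
Qed.

Let integrable_exp l : P.-integrable setT (fun w => (expR (l * D w))%:E).
Proof.
apply/integrableP; split.
  by apply/measurable_EFinP; apply: measurableT_comp => //; exact: measurable_funM.
have -> : (\int[P]_w `|(expR (l * D w))%:E| = \int[P]_w (expR (l * D w))%:E)%E.
  by apply: eq_integral => w _; rewrite /= ger0_norm ?expR_ge0.
rewrite hexp; last exact: (@measurableT _ (g_sigma_algebraType Gen)).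
by rewrite probability_setT mule1 ltry.
Qed.

Lemma increment_sqr_integrable : P.-integrable setT (fun w => (D w ^+ 2)%:E).
Proof.
have i1 := integrable_exp 1; have i2 := integrable_exp (-1).
apply: (le_integrable _ _ _ (integrableD measurableT i1 i2)) => //.
  by apply/measurable_EFinP; exact: measurable_funX.
move=> w _; rewrite -EFinD lee_fin !ger0_norm ?sqr_ge0 ?addr_ge0 ?expR_ge0//.
rewrite mul1r mulN1r; have := sqr_le_expRDN (D w); lra.
Qed.

Lemma increment_integrable : P.-integrable setT (fun w => (D w)%:E).
Proof.
have i1 := finite_measure_integrable_cst P (1 : R) measurableT.
apply: (le_integrable _ _ _ (integrableD measurableT increment_sqr_integrable i1)) => //.
  exact/measurable_EFinP.
move=> w _; rewrite -EFinD lee_fin [leRHS]ger0_norm ?addr_ge0 ?sqr_ge0//.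
rewrite /cst/= ler_norml; have := sqr_ge0 (D w - 1); have := sqr_ge0 (D w + 1).
by move: (D w) => z ? ?; apply/andP; split; nra.
Qed.

Let Rintegral_exp l A : <<s Gen >> A ->
  \int[P]_(w in A) expR (l * D w) = expR (l ^+ 2 * h / 2) * fine (P A).
Proof.
by move=> FA; rewrite /Rintegral hexp// fineM ?fin_num_measure//; exact: sub.
Qed.

Let integrable_on A (f : Omega -> R) : measurable A -> P.-integrable setT (EFin \o f) ->
  P.-integrable A (EFin \o f).
Proof. by move=> mA; apply: integrableS. Qed.

Let h_small : exists2 e0 : R, 0 < e0 & forall e, 0 < e -> e <= e0 -> e * h / 2 <= 2^-1.
Proof.
exists (1 + h)^-1 => [|e e0 eh]; first by rewrite invr_gt0 ltr_wpDr.
have : e * (1 + h) <= 1 by rewrite -ler_pdivlMr ?ltr_wpDr// mul1r.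
nra.
Qed.

(** Integrating l^2 D^2 <= exp (l D) + exp (-l D) - 2 bounds l^2 times the moment by 2 (exp (l^2
    h/2) - 1) P(A); dividing by l^2 = e and letting e tend to 0 leaves h P(A). *)
Lemma increment_sqr A : <<s Gen >> A -> \int[P]_(w in A) (D w ^+ 2) <= h * fine (P A).
Proof.
move=> FA; have mA := sub _ FA; set m := Rintegral _ _ _; set p := fine (P A).
have p0 : 0 <= p by rewrite fine_ge0.
have [e0 e00 he] := h_small.
have key e : 0 < e -> e <= e0 -> m <= (h + e * h ^+ 2) * p.
  move=> e_gt0 ee0; pose l := Num.sqrt e.
  have l2 : l ^+ 2 = e by rewrite sqr_sqrtr// ltW.
  have iA c f : P.-integrable setT (EFin \o f) -> P.-integrable A (fun w => (c * f w)%:E).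
    by move=> fi; apply: integrable_scale => //; exact: integrable_on.
  have : e * m + 2 * p <= 2 * expR (e * h / 2) * p.
    have i1 : P.-integrable A (fun w => (e * D w ^+ 2)%:E).
      exact: (iA _ (fun w => D w ^+ 2) increment_sqr_integrable).
    have i2 : P.-integrable A (EFin \o cst 2) by exact: finite_measure_integrable_cst.
    have i3 c : P.-integrable A (fun w => (expR (c * D w))%:E).
      exact: (integrable_on _ (fun w => expR (c * D w)) mA (integrable_exp c)).
    have -> : e * m + 2 * p = \int[P]_(w in A) (e * D w ^+ 2 + 2).
      rewrite RintegralD// RintegralZl// ?Rintegral_cst//.
      by apply: (integrable_on _ (fun w => D w ^+ 2)) => //; exact: increment_sqr_integrable.
    have -> : 2 * expR (e * h / 2) * p = \int[P]_(w in A) (expR (l * D w) + expR (- l * D w)).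
      rewrite (RintegralD mA (i3 l) (i3 (- l))) !Rintegral_exp// sqrrN l2 -/p.
      by rewrite -mulrA mulr_natl mulr2n.
    apply: le_Rintegral => //; first exact: integrable_add.
      exact: (integrable_add _ _ _ _ _ mA (fun w => expR (l * D w))
        (fun w => expR (- l * D w)) (i3 l) (i3 (- l))).
    move=> w _; have := sqr_le_expRDN (l * D w); rewrite exprMn l2 mulNr; lra.
  have := expR_le_quad _ (e * h / 2) _ (he e e_gt0 ee0).
  rewrite divr_ge0 ?mulr_ge0// ?(ltW e_gt0)// => /(_ isT).
  move: (expR _) => E hE h1.
  have : E * p <= (1 + e * h / 2 + 2 * (e * h / 2) ^+ 2) * p by exact: ler_wpM2r.
  move=> h2; rewrite -(ler_pM2l e_gt0); nra.
apply: (le_of_small _ _ _ (h ^+ 2 * p) e0) => //; first by rewrite mulr_ge0 ?sqr_ge0.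
by move=> e e_gt0 ee0; rewrite mulrA -mulrDl; exact: key.
Qed.

(** Integrating 1 + c D <= exp (c D) gives c m <= c^2 h P(A) for every small [c]. Division by [c],
    taken with either sign, confines m to 0. *)
Lemma increment_mean A : <<s Gen >> A -> \int[P]_(w in A) D w = 0.
Proof.
move=> FA; have mA := sub _ FA; set m := Rintegral _ _ _; pose p := fine (P A).
have p0 : 0 <= p by rewrite fine_ge0.
have [e0 e00 he] := h_small.
have key c : c ^+ 2 <= e0 -> c * m <= c ^+ 2 * (h * p).
  have [->|c0] := eqVneq c 0; first by rewrite expr0n !mul0r.
  move=> ce0; have c2 : 0 < c ^+ 2 by rewrite exprn_even_gt0.
  have i0 : P.-integrable A (EFin \o cst 1) by exact: finite_measure_integrable_cst.
  have i1 : P.-integrable A (fun w => (c * D w)%:E).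
    apply: integrable_scale => //; apply: integrable_on => //; exact: increment_integrable.
  have i2 : P.-integrable A (fun w => (expR (c * D w))%:E).
    exact: (integrable_on _ (fun w => expR (c * D w)) mA (integrable_exp c)).
  have : p + c * m <= expR (c ^+ 2 * h / 2) * p.
    rewrite -Rintegral_exp//.
    have -> : p + c * m = \int[P]_(w in A) (1 + c * D w).
      rewrite (RintegralD mA i0 i1) Rintegral_cst// mul1r RintegralZl//.
      by apply: integrable_on => //; exact: increment_integrable.
    apply: le_Rintegral => //; first exact: (integrable_add _ _ _ _ _ mA (cst 1) (fun w => c * D w)).
    by move=> w _; exact: expR_ge1Dx.
  have := he _ c2 ce0; set u := _ / 2 => u2.
  have u0 : 0 <= u by rewrite /u divr_ge0// mulr_ge0// sqr_ge0.
  have uE : c ^+ 2 * (h * p) = 2 * u * p by rewrite /u; field.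
  have : expR u * p <= (1 + u + 2 * u ^+ 2) * p by rewrite ler_wpM2r// expR_le_quad.
  rewrite uE; have : 0 <= u * p by rewrite mulr_ge0.
  have : u ^+ 2 * p <= 2^-1 * (u * p) by rewrite expr2 -mulrA ler_wpM2r// mulr_ge0.
  move: (expR u * p) => E; nra.
have hp : 0 <= h * p by rewrite mulr_ge0.
have e1 : 0 < Num.min e0 1 by rewrite lt_min e00/=.
have sq e : 0 < e -> e <= Num.min e0 1 -> e ^+ 2 <= e0.
  move=> e_gt0; rewrite le_min => /andP[h1 h2]; apply: le_trans h1.
  by rewrite expr2 ler_piMr// ltW.
apply/eqP; rewrite eq_le; apply/andP; split.
  apply: (le_of_small _ _ _ (h * p) _ e1) => // e e_gt0 ee.
  by have := key e (sq e e_gt0 ee); rewrite add0r expr2 -mulrA ler_pM2l.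
rewrite -oppr_le0; apply: (le_of_small _ _ _ (h * p) _ e1) => // e e_gt0 ee.
have := key (- e); rewrite sqrrN => /(_ (sq e e_gt0 ee)).
by rewrite add0r expr2 -mulrA mulNr -mulrN ler_pM2l.
Qed.

End exponential_increment.

(** * Supermartingale steps *)

Section measurable_boundary.
Context {R : realType}.

Lemma measurable_G r : measurable_fun setT (G r : R -> R).
Proof.
apply: measurable_funM => //; apply: measurableT_comp.
  by apply: continuous_measurable_fun; exact: continuous_lap0.
exact: measurable_funM.
Qed.

Lemma measurable_Uf B a r : measurable_fun setT (Uf B a r : R -> R).
Proof.
apply: measurable_fun_ifT; last exact: measurable_funM.
  exact: measurable_fun_ltr.
by apply: measurable_funM => //; exact: measurable_G.
Qed.

Lemma measurable_Vf C a v r : measurable_fun setT (Vf C a v r : R -> R).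
Proof.
apply: measurable_fun_ifT; first exact: measurable_fun_ltr.
  by apply: measurable_funM => //; apply: measurableT_comp => //; exact: measurable_G.
by apply: measurable_funB; apply: measurable_funM => //; exact: measurable_G.
Qed.

End measurable_boundary.

Section ge0_integral_real.
Context d (T : measurableType d) (R : realType) (m : {measure set T -> \bar R}).
Variables (A : set T) (f g : T -> R).
Hypotheses (mA : measurable A) (mf : measurable_fun setT f) (mg : measurable_fun setT g).
Hypothesis f0 : forall w, A w -> 0 <= f w.

Let mEFin (h : T -> R) : measurable_fun setT h -> measurable_fun A (EFin \o h).
Proof. by move=> mh; apply: measurable_funTS; exact/measurable_EFinP. Qed.

Lemma ge0_le_integral_real : (forall w, A w -> f w <= g w) ->
  (\int[m]_(w in A) (f w)%:E <= \int[m]_(w in A) (g w)%:E)%E.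
Proof. by move=> fg; apply: ge0_le_integral => //; exact: mEFin. Qed.

Lemma ge0_integral_scale c : 0 <= c ->
  (\int[m]_(w in A) (c * f w)%:E = c%:E * \int[m]_(w in A) (f w)%:E)%E.
Proof.
move=> c0; rewrite -ge0_integralZl_EFin//; exact: mEFin.
Qed.

Lemma ge0_integral_add : (forall w, A w -> 0 <= g w) ->
  (\int[m]_(w in A) (f w + g w)%:E = \int[m]_(w in A) (f w)%:E + \int[m]_(w in A) (g w)%:E)%E.
Proof. by move=> g0; rewrite -ge0_integralD//; exact: mEFin. Qed.

End ge0_integral_real.

Lemma le_integral_split d (T : measurableType d) (R : realType) (m : {measure set T -> \bar R})
    (A L : set T) (f g : T -> R) : measurable A -> measurable L ->
  measurable_fun setT f -> measurable_fun setT g ->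
  (forall w, 0 <= f w) -> (forall w, 0 <= g w) ->
  (\int[m]_(w in A `&` L) (f w)%:E <= \int[m]_(w in A `&` L) (g w)%:E)%E ->
  (\int[m]_(w in A `\` L) (f w)%:E <= \int[m]_(w in A `\` L) (g w)%:E)%E ->
  (\int[m]_(w in A) (f w)%:E <= \int[m]_(w in A) (g w)%:E)%E.
Proof.
move=> mA mL mf mg f0 g0 h1 h2.
have split_ (h : T -> R) : measurable_fun setT h -> (forall w, 0 <= h w) ->
   (\int[m]_(w in A) (h w)%:E =
     \int[m]_(w in A `&` L) (h w)%:E + \int[m]_(w in A `\` L) (h w)%:E)%E.
  move=> mh h0; rewrite -{1}(setUIDK A L) ge0_integral_setU//.
  - exact: measurableI.
  - exact: measurableD.
  - by apply: measurable_funTS; exact/measurable_EFinP.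
  - by move=> w _; rewrite lee_fin.
  - by apply/disj_setPS; rewrite setDE => w [[_ Lw] [_ nLw]].
by rewrite !split_// leeD.
Qed.

Section supermartingale_step.
Context {R : realType} {d : measure_display} {Omega : measurableType d}.
Variables (P : probability Omega R) (Gen : set (set Omega)).
Local Notation adapted f := (measurable_fun setT (f : g_sigma_algebraType Gen -> R)).
Hypothesis sub : <<s Gen >> `<=` @measurable d Omega.
Variables (Y D : Omega -> R) (h : R).
Hypotheses (mY : adapted Y) (mD : measurable_fun setT D) (h0 : 0 <= h).
Hypothesis hexp : forall l A, <<s Gen >> A ->
  (\int[P]_(w in A) (expR (l * D w))%:E = (expR (l ^+ 2 * h / 2))%:E * P A)%E.

Lemma quadratic_step A (f k0 : Omega -> R) (k1 k2 : R) : <<s Gen >> A ->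
  measurable_fun setT f -> (forall w, 0 <= f w) -> 0 <= k2 ->
  P.-integrable A (EFin \o k0) ->
  (forall w, A w -> f w <= k0 w + k1 * D w + k2 * (D w ^+ 2 - h)) ->
  (\int[P]_(w in A) (f w)%:E <= \int[P]_(w in A) (k0 w)%:E)%E.
Proof.
move=> FA mf f0 k20 ik fk; have mA := sub _ FA.
pose g w := k0 w + k1 * D w + k2 * (D w ^+ 2 - h).
have iD : P.-integrable A (fun w => (D w)%:E).
  exact: (integrableS measurableT mA (subsetT A) (increment_integrable P Gen D h mD hexp)).
have iD2 : P.-integrable A (fun w => (D w ^+ 2)%:E).
  exact: (integrableS measurableT mA (subsetT A) (increment_sqr_integrable P Gen D h mD hexp)).
have ih : P.-integrable A (EFin \o cst h) by exact: finite_measure_integrable_cst.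
have i1 : P.-integrable A (fun w => (k1 * D w)%:E) by exact: integrable_scale.
have i2 : P.-integrable A (fun w => (D w ^+ 2 - h)%:E).
  exact: (integrable_sub _ _ _ _ _ mA (fun w => D w ^+ 2) (cst h)).
have i3 : P.-integrable A (fun w => (k2 * (D w ^+ 2 - h))%:E).
  exact: (integrable_scale _ _ _ _ _ mA k2 (fun w => D w ^+ 2 - h)).
have i4 : P.-integrable A (fun w => (k0 w + k1 * D w)%:E).
  exact: (integrable_add _ _ _ _ _ mA k0 (fun w => k1 * D w)).
have ig : P.-integrable A (fun w => (g w)%:E).
  exact: (integrable_add _ _ _ _ _ mA (fun w => k0 w + k1 * D w) (fun w => k2 * (D w ^+ 2 - h))).
apply: (@le_trans _ _ (\int[P]_(w in A) (g w)%:E)%E).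
  apply: ge0_le_integral => //.
  - by move=> w _; rewrite lee_fin.
  - by apply: measurable_funTS; exact/measurable_EFinP.
  - exact: measurable_int ig.
have RE (u : Omega -> R) : P.-integrable A (EFin \o u) ->
    (\int[P]_(w in A) (u w)%:E = (\int[P]_(w in A) u w)%:E)%E.
  by move=> iu; rewrite /Rintegral fineK//; exact: integrable_fin_num.
rewrite (RE g ig) (RE k0 ik) lee_fin.
rewrite (RintegralD mA i4 i3) (RintegralD mA ik i1) (RintegralZl k1 mA iD).
rewrite (RintegralZl k2 mA i2) (RintegralB mA iD2 ih) Rintegral_cst//.
rewrite (increment_mean P Gen sub D h mD h0 hexp _ FA) mulr0 addr0 gerDl.
rewrite mulr_ge0_le0// subr_le0.
exact: (increment_sqr P Gen sub D h mD h0 hexp _ FA).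
Qed.

Lemma G_martingaleN A r : <<s Gen >> A -> 0 < r ->
  (\int[P]_(w in A) (G (r + h) (- (Y w + D w)))%:E = \int[P]_(w in A) (G r (- Y w))%:E)%E.
Proof.
move=> FA r0; have mYN : adapted (fun w => - Y w) by exact: measurableT_comp.
have mDN : measurable_fun setT (fun w => - D w) by exact: measurableT_comp.
rewrite -(G_martingale P Gen sub (fun w => - Y w) (fun w => - D w) h mYN mDN h0 _ A r FA r0).
  by apply: eq_integral => w _; rewrite opprD.
move=> l E FE; have := hexp (- l) E FE; rewrite sqrrN => <-.
by apply: eq_integral => w _; rewrite mulrN mulNr.
Qed.

Variables B C a v : R.
Hypotheses (B0 : 0 < B) (aE : a = 1 - B ^+ 2) (lB : a * lap 0 B = B).
Hypotheses (C0 : C < 0) (vE : v = B ^+ 2 - C ^+ 2) (C1 : C ^+ 2 < 1).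
Hypothesis vC : v * lap 0 (- C) = a * lap 0 C - C.
Hypothesis iY : P.-integrable setT (EFin \o Y).

Let mYD : measurable_fun setT (fun w => Y w + D w).
Proof. by apply: measurable_funD => //; exact: adapted_measurable mY. Qed.

Let mset r c : <<s Gen >> [set w | Y w < c * Num.sqrt r].
Proof.
have := mY measurableT [set y | y < c * Num.sqrt r].
rewrite setTI; apply.
rewrite (_ : [set y | _] = `]-oo, c * Num.sqrt r[%classic)//.
Qed.

Let mset_gt r c : <<s Gen >> [set w | c * Num.sqrt r < Y w].
Proof.
have := mY measurableT [set y | c * Num.sqrt r < y].
rewrite setTI; apply.
by rewrite (_ : [set y | _] = `]c * Num.sqrt r, +oo[%classic)// set_itvE.
Qed.

Let mYn : measurable_fun setT Y. Proof. exact: adapted_measurable mY. Qed.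

Lemma Uf_supermartingale A r : <<s Gen >> A -> 0 < r ->
  (\int[P]_(w in A) (Uf B a (r + h) (Y w + D w))%:E <=
   \int[P]_(w in A) (Uf B a r (Y w))%:E)%E.
Proof.
move=> FA r0; have mA := sub _ FA; have rh0 : 0 < r + h by rewrite ltr_wpDr.
have a0 : 0 < a by exact: (a_gt0 B a B0 lB).
pose L := [set w | Y w < B * Num.sqrt r].
have FL : <<s Gen >> L by exact: mset.
have FAL : <<s Gen >> (A `&` L) by exact: (@measurableI _ (g_sigma_algebraType Gen)).
have FAD : <<s Gen >> (A `\` L) by exact: (@measurableD _ (g_sigma_algebraType Gen)).
have mU (f : Omega -> R) r' : measurable_fun setT f -> measurable_fun setT (fun w : Omega => Uf B a r' (f w)).
  by move=> mf; apply: measurableT_comp => //; exact: measurable_Uf.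
have mG (f : Omega -> R) (r' : R) : measurable_fun setT f -> measurable_fun setT (fun w : Omega => G r' (f w)).
  by move=> mf; apply: measurableT_comp => //; exact: measurable_G.
have U0 r' y : 0 < r' -> 0 <= Uf B a r' y by exact: (Uf_ge0 B a B0 lB).
have G0 (r' y : R) : 0 < r' -> 0 <= G r' y by move=> r'0; exact/ltW/G_gt0.
apply: (le_integral_split _ _ _ P A L) => //.
- exact: sub FL.
- by apply: mU.
- by apply: mU.
- by move=> w; exact: U0.
- by move=> w; exact: U0.
- have mAL := sub _ FAL.
  apply: (@le_trans _ _ (\int[P]_(w in A `&` L) (a * G (r + h) (Y w + D w))%:E)%E).
    apply: ge0_le_integral_real => //.
    + exact: mU.
    + by apply: measurable_funM => //; exact: mG.
    + by move=> w _; exact: U0.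
    + by move=> w _; exact: (Uf_le B a B0 aE lB).
  rewrite ge0_integral_scale ?(ltW a0)//; [|exact: mG|by move=> w _; exact: G0].
  rewrite (G_martingale P Gen sub Y D h mY mD h0 hexp _ _ FAL r0).
  rewrite -ge0_integral_scale ?(ltW a0)//; [|exact: mG|by move=> w _; exact: G0].
  apply: ge0_le_integral_real => //.
  + by apply: measurable_funM => //; exact: mG.
  + exact: mU.
  + by move=> w _; rewrite mulr_ge0 ?(ltW a0)// G0.
  + by move=> w [_ Lw]; rewrite /Uf Lw.
- have mAL := sub _ FAD.
  apply: (@le_trans _ _ (\int[P]_(w in A `\` L) (Y w / r)%:E)%E).
    pose r' := r + h.
    apply: (quadratic_step (A `\` L) (fun w => Uf B a r' (Y w + D w)) (fun w => Y w / r)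
      (r'^-1 - 2 * B ^+ 2 * (1 - Num.sqrt r / Num.sqrt r') / r') (B / (Num.sqrt r' * r'))) => //.
    - exact: mU.
    - by move=> w; exact: U0.
    - by rewrite divr_ge0 ?mulr_ge0 ?sqrtr_ge0// ltW.
    - apply: (integrableS measurableT) => //.
      rewrite (_ : _ \o _ = (fun w => (r^-1 * Y w)%:E)); last first.
        by apply/funext => w /=; rewrite mulrC.
      exact: integrable_scale.
    move=> w [_ /negP]; rewrite -leNgt => Lw.
    have -> : D w ^+ 2 - h = D w ^+ 2 - (r' - r) by rewrite /r' [r + h]addrC addrK.
    by apply: (Uf_step B a B0 aE lB) => //; rewrite lerDl.
  apply: ge0_le_integral_real => //.
  + exact: measurable_funM.
  + exact: mU.
  + move=> w [_ /negP]; rewrite -leNgt => Lw; rewrite divr_ge0 ?(ltW r0)// (le_trans _ Lw)//.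
    by rewrite mulr_ge0 ?sqrtr_ge0 ?ltW.
  + by move=> w [_ /negP]; rewrite -leNgt => Lw; rewrite /Uf ltNge Lw.
Qed.

Lemma Vf_supermartingale A r : <<s Gen >> A -> 0 < r ->
  P.-integrable setT (fun w => (G r (Y w))%:E) ->
  (\int[P]_(w in A) (Vf C a v (r + h) (Y w + D w))%:E <=
   \int[P]_(w in A) (Vf C a v r (Y w))%:E)%E.
Proof.
move=> FA r0 iG; have mA := sub _ FA; have rh0 : 0 < r + h by rewrite ltr_wpDr.
have a0 : 0 < a by exact: (a_gt0 B a B0 lB).
have v0 : 0 < v by exact: (v_gt0 B C a v B0 lB C0 vC).
pose L := [set w | C * Num.sqrt r < Y w].
have FL : <<s Gen >> L by exact: mset_gt.
have FAL : <<s Gen >> (A `&` L) by exact: (@measurableI _ (g_sigma_algebraType Gen)).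
have FAD : <<s Gen >> (A `\` L) by exact: (@measurableD _ (g_sigma_algebraType Gen)).
have mU (f : Omega -> R) r' : measurable_fun setT f -> measurable_fun setT (fun w : Omega => Vf C a v r' (f w)).
  by move=> mf; apply: measurableT_comp => //; exact: measurable_Vf.
have mG (f : Omega -> R) (r' : R) : measurable_fun setT f -> measurable_fun setT (fun w : Omega => G r' (f w)).
  by move=> mf; apply: measurableT_comp => //; exact: measurable_G.
have mGN (f : Omega -> R) (r' : R) : measurable_fun setT f -> measurable_fun setT (fun w : Omega => G r' (- f w)).
  by move=> mf; apply: mG; exact: measurableT_comp.
have U0 r' y : 0 < r' -> 0 <= Vf C a v r' y by exact: (Vf_ge0 B C a v B0 aE lB C0 vC).
have G0 (r' y : R) : 0 < r' -> 0 <= G r' y by move=> r'0; exact/ltW/G_gt0.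
apply: (le_integral_split _ _ _ P A L) => //.
- exact: sub FL.
- by apply: mU.
- by apply: mU.
- by move=> w; exact: U0.
- by move=> w; exact: U0.
- have mAL := sub _ FAL.
  apply: (@le_trans _ _ (\int[P]_(w in A `&` L) (v * G (r + h) (- (Y w + D w)))%:E)%E).
    apply: ge0_le_integral_real => //.
    + exact: mU.
    + by apply: measurable_funM => //; exact: mGN.
    + by move=> w _; exact: U0.
    + by move=> w _; exact: (Vf_le B C a v B0 aE lB C0 vE vC).
  rewrite ge0_integral_scale ?(ltW v0)//; [|exact: mGN|by move=> w _; exact: G0].
  rewrite (G_martingaleN _ _ FAL r0).
  rewrite -ge0_integral_scale ?(ltW v0)//; [|exact: mGN|by move=> w _; exact: G0].
  apply: ge0_le_integral_real => //.
  + by apply: measurable_funM => //; exact: mGN.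
  + exact: mU.
  + by move=> w _; rewrite mulr_ge0 ?(ltW v0)// G0.
  + by move=> w [_ Lw]; rewrite /Vf Lw.
- have mAL := sub _ FAD.
  pose r' := r + h.
  have neg w : (A `\` L) w -> 0 <= - (r^-1 * Y w).
    move=> [_ /negP]; rewrite -leNgt => Lw.
    rewrite -mulrN mulr_ge0 ?invr_ge0 ?(ltW r0)// oppr_ge0 (le_trans Lw)//.
    by rewrite mulr_le0_ge0 ?sqrtr_ge0// ltW.
  have iG' : P.-integrable setT (fun w => (a * G r' (Y w + D w))%:E).
    apply: (integrable_scale _ _ _ _ _ measurableT a (fun w => G r' (Y w + D w))).
    apply/integrableP; split; first by apply/measurable_EFinP; exact: mG.
    have FT : <<s Gen >> setT by exact: (@measurableT _ (g_sigma_algebraType Gen)).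
    have /integrableP[_] := iG; apply: le_lt_trans.
    under eq_integral do rewrite /= ger0_norm ?G0//.
    under [leRHS]eq_integral do rewrite /= ger0_norm ?G0//.
    by rewrite (G_martingale P Gen sub Y D h mY mD h0 hexp _ _ FT r0).
  have iYr : P.-integrable setT (fun w => (- (r^-1 * Y w))%:E).
    rewrite (_ : (fun w => _) = (fun w => (- r^-1 * Y w)%:E)); first exact: integrable_scale.
    by apply/funext => w; rewrite mulNr.
  (* The leading term passed to [quadratic_step] contains [G] at the end of the step; it is moved
     back to the start afterwards by the exact martingale identity. *)
  apply: (@le_trans _ _ (\int[P]_(w in A `\` L) (a * G r' (Y w + D w) - r^-1 * Y w)%:E)%E).
    apply: (quadratic_step (A `\` L) (fun w => Vf C a v r' (Y w + D w))
      (fun w => a * G r' (Y w + D w) - r^-1 * Y w)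
      (- (r'^-1 - 2 * C ^+ 2 * (1 - Num.sqrt r / Num.sqrt r') / r')) (- C / (Num.sqrt r' * r'))) => //.
    - exact: mU.
    - by move=> w; exact: U0.
    - by rewrite divr_ge0 ?mulr_ge0 ?sqrtr_ge0 ?oppr_ge0// ltW.
    - apply: (integrableS measurableT) => //.
      exact: (integrable_add _ _ _ _ _ measurableT (fun w => a * G r' (Y w + D w)) (fun w => - (r^-1 * Y w))).
    move=> w [_ /negP]; rewrite -leNgt => Lw.
    have -> : D w ^+ 2 - h = D w ^+ 2 - (r' - r) by rewrite /r' [r + h]addrC addrK.
    rewrite mulNr [r^-1 * _]mulrC; apply: (Vf_step B C a v B0 aE lB C0 vE C1 vC) => //.
    by rewrite lerDl.
  rewrite ge0_integral_add//.
  + rewrite ge0_integral_scale ?(ltW a0)//; [|exact: mG|by move=> w _; exact: G0].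
    rewrite (G_martingale P Gen sub Y D h mY mD h0 hexp _ _ FAD r0).
    rewrite -ge0_integral_scale ?(ltW a0)//; [|exact: mG|by move=> w _; exact: G0].
    rewrite -ge0_integral_add//.
    * apply: ge0_le_integral_real => //.
      - apply: measurable_funD; first by apply: measurable_funM => //; exact: mG.
        by apply: measurableT_comp => //; exact: measurable_funM.
      - exact: mU.
      - by move=> w Lw; rewrite addr_ge0 ?neg// mulr_ge0 ?(ltW a0)// G0.
      - by move=> w [_ /negP] /negbTE Lw; rewrite /Vf Lw [r^-1 * _]mulrC.
    * by apply: measurable_funM => //; exact: mG.
    * by apply: measurableT_comp => //; exact: measurable_funM.
    * by move=> w _; rewrite mulr_ge0 ?(ltW a0)// G0.
  + by apply: measurable_funM => //; exact: mG.
  + by apply: measurableT_comp => //; exact: measurable_funM.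
  + by move=> w _; rewrite mulr_ge0 ?(ltW a0)// G0.
Qed.

End supermartingale_step.

(** * Stopping on finite grids *)

Section discrete_stopping.
Context {R : realType} {d : measure_display} {Omega : measurableType d}.
Variable P : {measure set Omega -> \bar R}.

Definition stopped (Z : nat -> Omega -> R) (sg : Omega -> nat) w := Z (sg w) w.

Lemma measurable_stopped Z sg : (forall k, measurable [set w | (sg w <= k)%N]) ->
  (forall k, measurable_fun setT (Z k)) -> measurable_fun setT (stopped Z sg).
Proof.
move=> msg mZ _ B mB; rewrite setTI.
have meq k : measurable [set w | sg w = k].
  case: k => [|k].
    by have := msg 0%N; congr measurable; apply/seteqP; split => w /=; rewrite leqn0 => /eqP.
  have -> : [set w | sg w = k.+1] = [set w | (sg w <= k.+1)%N] `\` [set w | (sg w <= k)%N].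
    apply/seteqP; split => w /=; first by move=> ->; rewrite leqnn ltnn.
    by move=> [h1 /negP]; rewrite -ltnNge => h2; apply/eqP; rewrite eqn_leq h1.
  exact: measurableD.
have -> : stopped Z sg @^-1` B = \bigcup_k ([set w | sg w = k] `&` Z k @^-1` B).
  apply/seteqP; split => w /=; first by move=> h; exists (sg w).
  by move=> [k _ [/= <-]].
apply: bigcup_measurable => k _; apply: measurableI => //.
by rewrite -[X in measurable X]setTI; exact: mZ.
Qed.

(** Taken to be equality for martingales, <= for supermartingales and >= for the excess of a
    martingale over a level. *)
Variable op : \bar R -> \bar R -> Prop.
Hypotheses (op_refl : forall x, op x x) (op_trans : forall x y z, op x y -> op y z -> op x z).
Hypothesis op_add : forall x y z, op x y -> op (x + z)%E (y + z)%E.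

Lemma stopped_rel n (Z : nat -> Omega -> R) (sg1 sg2 : Omega -> nat) :
  (forall k, measurable [set w | (sg1 w <= k)%N]) ->
  (forall k, measurable [set w | (sg2 w <= k)%N]) ->
  (forall k, measurable_fun setT (Z k)) -> (forall k w, (k <= n)%N -> 0 <= Z k w) ->
  (forall w, (sg1 w <= sg2 w <= n)%N) ->
  (forall k, (k < n)%N -> op (\int[P]_(w in [set w | (sg1 w <= k < sg2 w)%N]) (Z k.+1 w)%:E)%E
     (\int[P]_(w in [set w | (sg1 w <= k < sg2 w)%N]) (Z k w)%:E)%E) ->
  op (\int[P]_w (stopped Z sg2 w)%:E)%E (\int[P]_w (stopped Z sg1 w)%:E)%E.
Proof.
move=> m1 m2 mZ Z0 s12 H.
(* Interpolates between [sg1] at k = 0 and [sg2] at k = n. From k to k + 1 it moves only on {sg1 <=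
   k < sg2}, an event decided at index k, and there it advances from k to k + 1. *)
pose idx k w := minn (sg2 w) (maxn (sg1 w) k).
have midx k j : measurable [set w | (idx k w <= j)%N].
  have -> : [set w | (idx k w <= j)%N] =
      [set w | (sg2 w <= j)%N] `|` ([set w | (sg1 w <= j)%N] `&` [set _ | (k <= j)%N]).
    apply/seteqP; split => w /=; rewrite /idx geq_min geq_max.
      by case/orP => [->|/andP[]]; [left|right].
    by case=> [->//|[-> ->]]; rewrite orbT.
  apply: measurableU => //; apply: measurableI => //.
  case: (boolP (k <= j)%N) => _; first by rewrite (_ : [set _ | _] = setT)//; apply/seteqP; split.
  by rewrite (_ : [set _ | _] = set0)//; apply/seteqP; split.
have key k : (k <= n)%N -> op (\int[P]_w (stopped Z (idx k) w)%:E)%E (\int[P]_w (stopped Z sg1 w)%:E)%E.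
  elim: k => [|k IH] kn.
    have -> : idx 0%N = sg1; last exact: op_refl.
    by apply/funext => w; rewrite /idx maxn0; apply/minn_idPr; case/andP: (s12 w).
  apply: (op_trans _ (\int[P]_w (stopped Z (idx k) w)%:E)%E _ _ (IH (ltnW kn))).
  set L := [set w | (sg1 w <= k < sg2 w)%N].
  have mL : measurable L.
    have -> : L = [set w | (sg1 w <= k)%N] `\` [set w | (sg2 w <= k)%N].
      apply/seteqP; split => w; rewrite /L/=.
        by move=> /andP[-> h]; split => //; apply/negP; rewrite -ltnNge.
      by move=> [-> /negP]; rewrite -ltnNge.
    exact: measurableD.
  have idx_n j w : (idx j w <= n)%N by rewrite geq_min; case/andP: (s12 w) => _ ->.
  have split_ j : (\int[P]_w (stopped Z (idx j) w)%:E =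
      \int[P]_(w in L) (stopped Z (idx j) w)%:E + \int[P]_(w in ~` L) (stopped Z (idx j) w)%:E)%E.
    rewrite -ge0_integral_setU//.
    - by rewrite setUv.
    - exact: measurableC.
    - by rewrite setUv; apply/measurable_EFinP; exact: measurable_stopped.
    - by move=> w _; rewrite lee_fin Z0.
    - by apply/disj_setPS; rewrite setICr.
  rewrite !split_.
  have -> : (\int[P]_(w in ~` L) (stopped Z (idx k.+1) w)%:E =
             \int[P]_(w in ~` L) (stopped Z (idx k) w)%:E)%E.
    apply: eq_integral => w /set_mem nL; rewrite /stopped; congr (Z _ w)%:E.
    rewrite /idx; move/negP: nL; rewrite negb_and -ltnNge -leqNgt => /orP[h|h].
      by rewrite !(maxn_idPl _)// ltnW.
    by rewrite !(minn_idPl _)// leq_max ?(leqW h) ?h orbT.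
  apply: op_add.
  have -> : (\int[P]_(w in L) (stopped Z (idx k.+1) w)%:E = \int[P]_(w in L) (Z k.+1 w)%:E)%E.
    apply: eq_integral => w /set_mem /andP[h1 h2]; rewrite /stopped; congr (Z _ w)%:E.
    by rewrite /idx (maxn_idPr _) ?(leqW h1)//; exact/minn_idPr.
  have -> : (\int[P]_(w in L) (stopped Z (idx k) w)%:E = \int[P]_(w in L) (Z k w)%:E)%E.
    apply: eq_integral => w /set_mem /andP[h1 h2]; rewrite /stopped; congr (Z _ w)%:E.
    by rewrite /idx (maxn_idPr _)//; exact/minn_idPr/ltnW.
  exact: H.
suff <- : idx n = sg2 by exact: key.
by apply/funext => w; rewrite /idx; apply/minn_idPl; rewrite leq_max orbC; case/andP: (s12 w) => _ ->.
Qed.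

End discrete_stopping.

(** * Martingale and supermartingale steps of the bridge *)

Section bridge_martingales.
Context {R : realType} {d : measure_display} {Omega : measurableType d}.
Variables (P : probability Omega R) (W X : R -> Omega -> R) (t x : R).
Hypotheses (Ht : 0 <= t < 1) (HW : standard_BM P W) (HX : bridge_SDE W X t x).
Local Notation Y := (slope X).
Local Notation rate u := (1 - u)^-1.
Local Notation F := (nat_filtration X t).
Local Notation y0 := (x / (1 - t)).

(** The generators of [nat_filtration], named so that adaptedness can be stated as measurability on
    a [g_sigma_algebraType]. *)
Definition nat_generators (s : R) : set (set Omega) :=
  [set E | exists u (A : set R), [/\ t <= u <= s, measurable A & E = X u @^-1` A]].

Local Notation adapted s f :=
  (measurable_fun setT (f : g_sigma_algebraType (nat_generators s) -> R)).

Lemma nat_filtration_mono s s' : s <= s' -> F s `<=` F s'.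
Proof.
move=> ss'; apply: sub_sigma_algebra2 => E [u [A [/andP[tu us] mA ->]]].
by exists u, A; split => //; rewrite tu (le_trans us).
Qed.

Lemma slope_adapted s : t <= s < 1 -> adapted s (Y s).
Proof.
move=> /andP[ts _]; apply: measurable_funM => //.
move=> _ B mB; rewrite setTI; apply: sub_sigma_algebra.
by exists s, B; split => //; rewrite ts lexx.
Qed.

Lemma rate_gt0 (s : R) : s < 1 -> 0 < rate s.
Proof. by move=> s1; rewrite invr_gt0 subr_gt0. Qed.

Lemma rate_ge0_sub (s s' : R) : s <= s' -> s' < 1 -> 0 <= rate s' - rate s.
Proof.
move=> ss' s'1; rewrite subr_ge0 lef_pV2 ?posrE ?subr_gt0//; last exact: le_lt_trans s'1.
by rewrite lerD2l lerN2.
Qed.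

Section step.
Variables s s' : R.
Hypotheses (ts : t <= s) (ss' : s < s') (s'1 : s' < 1).

Let ts1 : t <= s < 1. Proof. by rewrite ts (lt_trans ss'). Qed.
Let ts'1 : t <= s' < 1. Proof. by rewrite s'1 (le_trans ts)// ltW. Qed.
Let D w := Y s' w - Y s w.
Let YD : (fun w => Y s w + D w) = Y s'.
Proof. by apply/funext => w; rewrite /D addrC subrK. Qed.
Let rD : rate s + (rate s' - rate s) = rate s'. Proof. by rewrite addrC subrK. Qed.
Let mD : measurable_fun setT D.
Proof. by apply: measurable_funB; exact: (measurable_slope P W X t x Ht HW HX). Qed.
Let h0 : 0 <= rate s' - rate s. Proof. by rewrite rate_ge0_sub// ltW. Qed.
Let sub : <<s nat_generators s >> `<=` @measurable d Omega.
Proof. exact: (nat_filtration_measurable P W X t x Ht HW HX). Qed.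
Let hexp l A : <<s nat_generators s >> A ->
  (\int[P]_(w in A) (expR (l * D w))%:E = (expR (l ^+ 2 * (rate s' - rate s) / 2))%:E * P A)%E.
Proof. by move=> FA; exact: (slope_exp P W X t x Ht HW HX). Qed.
Let mY := slope_adapted s ts1.
Let r0 : 0 < rate s. Proof. by rewrite rate_gt0// (lt_trans ss'). Qed.

Lemma slope_increment_integrable : P.-integrable setT (fun w => (D w)%:E).
Proof. exact: (increment_integrable P _ _ _ mD hexp). Qed.

Lemma slope_G A : F s A ->
  (\int[P]_(w in A) (G (rate s') (Y s' w))%:E = \int[P]_(w in A) (G (rate s) (Y s w))%:E)%E.
Proof.
move=> FA; rewrite -(G_martingale P _ sub (Y s) D _ mY mD h0 hexp A _ FA r0) rD.
by apply: eq_integral => w _; rewrite -YD.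
Qed.

Lemma slope_GN A : F s A ->
  (\int[P]_(w in A) (G (rate s') (- Y s' w))%:E = \int[P]_(w in A) (G (rate s) (- Y s w))%:E)%E.
Proof.
move=> FA; rewrite -(G_martingaleN P _ sub (Y s) D _ mY mD h0 hexp A _ FA r0) rD.
by apply: eq_integral => w _; rewrite -YD.
Qed.

(** Conditional Jensen for (phi - c)^+, carried out on the event {phi > c}, where the excess is phi
    - c. Adding c times its probability to both sides avoids subtracting integrals that might be
    infinite. *)
Lemma slope_excess (phi : R -> R -> R) A c :
  (forall r, measurable_fun setT (phi r)) -> (forall r y, 0 < r -> 0 <= phi r y) ->
  (forall E, F s E -> \int[P]_(w in E) (phi (rate s') (Y s' w))%:E =
     \int[P]_(w in E) (phi (rate s) (Y s w))%:E)%E ->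
  F s A -> 0 <= c ->
  (\int[P]_(w in A) (Num.max (phi (rate s) (Y s w) - c) 0)%:E <=
   \int[P]_(w in A) (Num.max (phi (rate s') (Y s' w) - c) 0)%:E)%E.
Proof.
move=> mphi phi0 mart FA c0; have mA := sub _ FA; have r'0 : 0 < rate s' by exact: rate_gt0.
have mG u : t <= u < 1 -> measurable_fun setT (fun w => phi (rate u) (Y u w)).
  by move=> tu; apply: measurableT_comp; [exact: mphi|exact: (measurable_slope P W X t x Ht HW HX)].
have mE u : t <= u < 1 -> measurable_fun setT (fun w => Num.max (phi (rate u) (Y u w) - c) 0).
  by move=> tu; apply: measurable_maxr => //; apply: measurable_funB => //; exact: mG.
pose L := [set w | c < phi (rate s) (Y s w)].
have FL : F s L.
  have mGY : adapted s (fun w => phi (rate s) (Y s w)).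
    by apply: measurableT_comp => //; exact: mphi.
  have := mGY measurableT [set y | c < y]; rewrite setTI; apply.
  by rewrite (_ : [set y | _] = `]c, +oo[%classic)// set_itvE.
have FAL : F s (A `&` L) by exact: (@measurableI _ (g_sigma_algebraType (nat_generators s))).
have mAL := sub _ FAL.
apply: (le_integral_split _ _ _ P A L) => //.
- exact: sub FL.
- exact: mE.
- exact: mE.
- by move=> w; rewrite le_max lexx orbT.
- by move=> w; rewrite le_max lexx orbT.
- have fP : (c%:E * P (A `&` L))%E \is a fin_num by rewrite fin_numM// fin_num_measure.
  rewrite -(leeD2rE _ _ fP) -integral_cst// -!ge0_integral_add//; try exact: mE.
  apply: (@le_trans _ _ (\int[P]_(w in A `&` L) (phi (rate s) (Y s w))%:E)%E).
    apply: ge0_le_integral_real => //; [|exact: mG| |].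
    + by apply: measurable_funD => //; exact: mE.
    + by move=> w _; rewrite addr_ge0// le_max lexx orbT.
    + move=> w [_ /= Lw]; rewrite /cst (max_idPl _) ?subrK// subr_ge0 ltW//.
  rewrite -mart//; apply: ge0_le_integral_real => //; [exact: mG| | |].
  + by apply: measurable_funD => //; exact: mE.
  + by move=> w _; exact: phi0.
  + by move=> w _; rewrite /cst -lerBlDr le_max lexx.
  all: try by move=> w _; rewrite le_max lexx orbT.
- apply: ge0_le_integral_real => //.
  + by apply: measurableD => //; exact: sub FL.
  + exact: mE.
  + exact: mE.
  + by move=> w _; rewrite le_max lexx orbT.
  + move=> w [_ /negP]; rewrite -leNgt => Lw; rewrite (max_idPr _) ?subr_le0//.
    by rewrite le_max lexx orbT.
Qed.

End step.

Lemma slope_integrable s : t <= s < 1 -> P.-integrable setT (fun w => (Y s w)%:E).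
Proof.
move=> /andP[ts s1].
have it : P.-integrable setT (fun w => (Y t w)%:E).
  rewrite (_ : (fun w => _) = EFin \o cst y0); first exact: finite_measure_integrable_cst.
  by apply/funext => w; rewrite (slope_start W X t x Ht HX).
move: ts; rewrite le_eqVlt => /predU1P[<-//|ts].
rewrite (_ : (fun w => _) = (fun w => (Y t w + (Y s w - Y t w))%:E)).
  apply: (integrable_add _ _ _ _ _ measurableT (Y t) (fun w => Y s w - Y t w)) => //.
  exact: slope_increment_integrable.
by apply/funext => w; rewrite addrC subrK.
Qed.

Let FT s : F s setT.
Proof. exact: (@measurableT _ (g_sigma_algebraType (nat_generators s))). Qed.

Let start_integral (f : R -> R) : (\int[P]_w (f (Y t w))%:E)%E = (f y0)%:E.
Proof.
rewrite (_ : (fun w => _) = cst (f y0)%:E).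
  by rewrite -[X in _ = X]mule1 -(@probability_setT _ _ _ P) -integral_cst.
by apply/funext => w; rewrite (slope_start W X t x Ht HX).
Qed.

Lemma slope_G_total s : t <= s < 1 ->
  (\int[P]_w (G (rate s) (Y s w))%:E = (G (rate t) y0)%:E)%E.
Proof.
move=> /andP[]; rewrite le_eqVlt => /predU1P[<- _|ts s1]; first exact: (start_integral (G _)).
by rewrite (slope_G t s)// (start_integral (G _)).
Qed.

Lemma slope_G_integrable s : t <= s < 1 -> P.-integrable setT (fun w => (G (rate s) (Y s w))%:E).
Proof.
move=> ts; have /andP[_ s1] := ts; apply/integrableP; split.
  apply/measurable_EFinP; apply: measurableT_comp; first exact: measurable_G.
  exact: (measurable_slope P W X t x Ht HW HX).
have -> : (\int[P]_w `|(G (rate s) (Y s w))%:E| = \int[P]_w (G (rate s) (Y s w))%:E)%E.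
  by apply: eq_integral => w _; rewrite /= ger0_norm//; apply/ltW/G_gt0; exact: rate_gt0.
by rewrite slope_G_total// ltry.
Qed.

Section boundaries.
Variables B C a v : R.
Hypotheses (B0 : 0 < B) (aE : a = 1 - B ^+ 2) (lB : a * lap 0 B = B).
Hypotheses (C0 : C < 0) (vE : v = B ^+ 2 - C ^+ 2) (C1 : C ^+ 2 < 1).
Hypothesis vC : v * lap 0 (- C) = a * lap 0 C - C.
Variables s s' : R.
Hypotheses (ts : t <= s) (ss' : s < s') (s'1 : s' < 1).

Let ts1 : t <= s < 1. Proof. by rewrite ts (lt_trans ss'). Qed.
Let ts'1 : t <= s' < 1. Proof. by rewrite s'1 (le_trans ts)// ltW. Qed.
Let D w := Y s' w - Y s w.
Let YD : (fun w => Y s w + D w) = Y s'.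
Proof. by apply/funext => w; rewrite /D addrC subrK. Qed.
Let rD : rate s + (rate s' - rate s) = rate s'. Proof. by rewrite addrC subrK. Qed.
Let mD : measurable_fun setT D.
Proof. by apply: measurable_funB; exact: (measurable_slope P W X t x Ht HW HX). Qed.
Let h0 : 0 <= rate s' - rate s. Proof. by rewrite rate_ge0_sub// ltW. Qed.
Let sub : <<s nat_generators s >> `<=` @measurable d Omega.
Proof. exact: (nat_filtration_measurable P W X t x Ht HW HX). Qed.
Let hexp l A : <<s nat_generators s >> A ->
  (\int[P]_(w in A) (expR (l * D w))%:E = (expR (l ^+ 2 * (rate s' - rate s) / 2))%:E * P A)%E.
Proof. by move=> FA; exact: (slope_exp P W X t x Ht HW HX). Qed.
Let mY := slope_adapted s ts1.
Let r0 : 0 < rate s. Proof. by rewrite rate_gt0// (lt_trans ss'). Qed.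
Let iY := slope_integrable s ts1.

Lemma slope_Uf A : F s A ->
  (\int[P]_(w in A) (Uf B a (rate s') (Y s' w))%:E <=
   \int[P]_(w in A) (Uf B a (rate s) (Y s w))%:E)%E.
Proof.
move=> FA.
have := Uf_supermartingale P _ sub (Y s) D _ mY mD h0 hexp B a B0 aE lB iY A _ FA r0.
rewrite rD; apply: le_trans; rewrite le_eqVlt; apply/orP; left; apply/eqP.
by apply: eq_integral => w _; rewrite -YD.
Qed.

Lemma slope_Vf A : F s A ->
  (\int[P]_(w in A) (Vf C a v (rate s') (Y s' w))%:E <=
   \int[P]_(w in A) (Vf C a v (rate s) (Y s w))%:E)%E.
Proof.
move=> FA.
have := Vf_supermartingale P _ sub (Y s) D _ mY mD h0 hexp B C a v B0 aE lB C0 vE C1 vC iY A _ FA r0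
  (slope_G_integrable s ts1).
rewrite rD; apply: le_trans; rewrite le_eqVlt; apply/orP; left; apply/eqP.
by apply: eq_integral => w _; rewrite -YD.
Qed.

End boundaries.
End bridge_martingales.

(** * Rounding of stopping times to a finite grid *)

Section grid.
Context {R : realType} {Omega : Type}.
Variables (t T : R) (n : nat).
Hypotheses (tT : t < T) (n0 : (0 < n)%N).

Definition grid k : R := future t T n (minn k n).
(** Rounds up, so that stopping at index k is decided at the k-th grid point. The search covers the
    indices below [n] only: when it fails, [find] returns [n], which means stopping at the horizon
    [T]. *)
Definition hit_index (tau : Omega -> R) w : nat := find (fun k => tau w <= grid k) (iota 0 n).

Lemma grid0 : grid 0 = t. Proof. by rewrite /grid min0n future0. Qed.

Lemma gridn : grid n = T.
Proof. by rewrite /grid minnn /future divff ?mulr1 ?pnatr_eq0 -?lt0n// addrC subrK. Qed.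

Lemma grid_mono k l : (k <= l)%N -> grid k <= grid l.
Proof.
move=> kl; rewrite /grid /future lerD2l ler_wpM2l ?subr_ge0 ?(ltW tT)//.
by rewrite ler_wpM2r ?invr_ge0 ?ler0n// ler_nat leq_min geq_minr andbT geq_min kl.
Qed.

Lemma grid_bound k : t <= grid k <= T.
Proof.
have -> : grid k = grid (minn k n) by rewrite /grid -minnA minnn.
rewrite -{1}grid0 -gridn !grid_mono ?geq_minr//.
Qed.

Lemma gridS k : (k < n)%N -> grid k.+1 = grid k + (T - t) / n%:R.
Proof.
move=> kn; rewrite /grid !(minn_idPl _) ?(ltnW kn)// /future -natr1.
by field; rewrite pnatr_eq0 -lt0n.
Qed.

Lemma grid_lt k : (k < n)%N -> grid k < grid k.+1.
Proof. by move=> kn; rewrite gridS// ltrDl divr_gt0 ?subr_gt0 ?ltr0n. Qed.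

Lemma hit_index_le_size tau w : (hit_index tau w <= n)%N.
Proof. by rewrite -[leqRHS](size_iota 0) find_size. Qed.

Lemma hit_index_le tau w k : (k < n)%N -> (hit_index tau w <= k)%N = (tau w <= grid k).
Proof.
move=> kn; apply/idP/idP => h.
  have hn : (hit_index tau w < n)%N by exact: leq_ltn_trans kn.
  have : has (fun k => tau w <= grid k) (iota 0 n) by rewrite has_find size_iota.
  move=> /(nth_find 0%N); rewrite nth_iota// add0n => /le_trans; apply; exact: grid_mono.
rewrite leqNgt; apply/negP => kh.
by have := before_find 0%N kh; rewrite nth_iota// add0n h.
Qed.

Lemma hit_index_mono tau1 tau2 w : tau1 w <= tau2 w -> (hit_index tau1 w <= hit_index tau2 w)%N.
Proof.
move=> t12; have := hit_index_le_size tau2 w; rewrite leq_eqVlt => /predU1P[->|h].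
  exact: hit_index_le_size.
by rewrite hit_index_le// (le_trans t12)// -hit_index_le.
Qed.

Lemma grid_hit_bound tau w : t <= tau w ->
  Num.min (tau w) T <= grid (hit_index tau w) <= Num.min (tau w) T + (T - t) / n%:R.
Proof.
move=> ttau; set k := hit_index tau w; have kn := hit_index_le_size tau w.
apply/andP; split.
  rewrite ge_min; move: kn; rewrite leq_eqVlt -/k => /predU1P[->|kn]; first by rewrite gridn lexx orbT.
  by rewrite -hit_index_le// leqnn.
case: (posnP k) => [->|k0].
  rewrite grid0 ler_wpDr ?divr_ge0 ?ler0n ?subr_ge0 ?(ltW tT)// le_min ttau ltW//.
have k1n : (k.-1 < n)%N by rewrite prednK.
rewrite -(prednK k0) gridS// lerD2r le_min; have /andP[_ ->] := grid_bound k.-1; rewrite andbT.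
by rewrite ltW// ltNge -hit_index_le// -/k -ltnNge prednK.
Qed.

End grid.
Lemma integrable_of_sqr d (T : measurableType d) (R : realType) (P : probability T R) (f : T -> R) K :
  measurable_fun setT f -> (\int[P]_w (f w ^+ 2)%:E <= K%:E)%E -> P.-integrable setT (EFin \o f).
Proof.
move=> mf fK.
have i2 : P.-integrable setT (fun w => (f w ^+ 2)%:E).
  apply/integrableP; split; first by apply/measurable_EFinP; exact: measurable_funX.
  apply: le_lt_trans (ltry K); apply: le_trans fK; rewrite le_eqVlt; apply/orP; left; apply/eqP.
  by apply: eq_integral => w _; rewrite /= ger0_norm ?sqr_ge0.
have i1 := finite_measure_integrable_cst P (1 : R) measurableT.
apply: (le_integrable _ _ _ (integrableD measurableT i2 i1)) => //.
  exact/measurable_EFinP.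
move=> w _; rewrite -EFinD lee_fin [leRHS]ger0_norm ?addr_ge0 ?sqr_ge0//.
rewrite /cst/= ler_norml; have := sqr_ge0 (f w - 1); have := sqr_ge0 (f w + 1).
by move: (f w) => z ? ?; apply/andP; split; nra.
Qed.

Section grid_stopping.
Context {R : realType} {d : measure_display} {Omega : measurableType d}.
Variables (P : probability Omega R) (W X : R -> Omega -> R) (t x : R).
Hypotheses (Ht : 0 <= t < 1) (HW : standard_BM P W) (HX : bridge_SDE W X t x).
Local Notation Y := (slope X).
Local Notation rate u := (1 - u)^-1.
Local Notation F := (nat_filtration X t).
Local Notation y0 := (x / (1 - t)).
Variables (T : R) (n : nat).
Hypotheses (tT : t < T) (T1 : T < 1) (n0 : (0 < n)%N).
Local Notation p := (grid t T n).
Local Notation hit := (@hit_index R Omega t T n).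

Definition on_grid (phi : R -> R -> R) (k : nat) (w : Omega) := phi (rate (p k)) (Y (p k) w).

Let p1 k : t <= p k < 1.
Proof. by have /andP[-> h] := grid_bound t T n tT n0 k; exact: le_lt_trans T1. Qed.

Lemma on_grid_measurable phi k : measurable_fun setT (phi (rate (p k))) ->
  measurable_fun setT (on_grid phi k).
Proof.
move=> mphi; apply: measurableT_comp => //.
exact: (measurable_slope P W X t x Ht HW HX).
Qed.

Lemma hit_F tau k : stopping_time X t tau -> (k < n)%N -> F (p k) [set w | (hit tau w <= k)%N].
Proof.
move=> st kn; have := st _ (p1 k); congr (F _ _).
by apply/seteqP; split => w /=; rewrite hit_index_le.
Qed.

Lemma hit_measurable tau k : stopping_time X t tau -> measurable [set w | (hit tau w <= k)%N].
Proof.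
move=> st; case: (ltnP k n) => kn.
  exact: (nat_filtration_measurable P W X t x Ht HW HX _ (p1 k) _ (hit_F _ _ st kn)).
rewrite (_ : [set w | _] = setT)//; apply/seteqP; split => // w _ /=.
exact: leq_trans (hit_index_le_size _ _ _ _ _) kn.
Qed.

(** The order tau1 <= tau2 is given almost surely only; the maximum makes it hold at every point, as
    [stopped_rel] requires. *)
Definition hit2 (tau1 tau2 : Omega -> R) w := maxn (hit tau1 w) (hit tau2 w).

Lemma hit2_measurable tau1 tau2 k : stopping_time X t tau1 -> stopping_time X t tau2 ->
  measurable [set w | (hit2 tau1 tau2 w <= k)%N].
Proof.
move=> st1 st2; rewrite (_ : [set w | _] =
   [set w | (hit tau1 w <= k)%N] `&` [set w | (hit tau2 w <= k)%N]).
  by apply: measurableI; exact: hit_measurable.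
by apply/seteqP; split => w; rewrite /= /hit2 geq_max => /andP.
Qed.

Lemma grid_stop (op : \bar R -> \bar R -> Prop) (phi : R -> R -> R) tau1 tau2 :
  (forall x, op x x) -> (forall x y z, op x y -> op y z -> op x z) ->
  (forall x y z, op x y -> op (x + z)%E (y + z)%E) ->
  (forall r, measurable_fun setT (phi r)) -> (forall r y, 0 < r -> 0 <= phi r y) ->
  (forall s s' A, t <= s -> s < s' -> s' < 1 -> F s A ->
     op (\int[P]_(w in A) (phi (rate s') (Y s' w))%:E)%E
        (\int[P]_(w in A) (phi (rate s) (Y s w))%:E)%E) ->
  stopping_time X t tau1 -> stopping_time X t tau2 ->
  op (\int[P]_w (stopped (on_grid phi) (hit2 tau1 tau2) w)%:E)%E
     (\int[P]_w (stopped (on_grid phi) (hit tau1) w)%:E)%E.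
Proof.
move=> op1 op2 op3 mphi phi0 H st1 st2; apply: (stopped_rel P op op1 op2 op3 n).
- by move=> k; exact: hit_measurable.
- by move=> k; exact: hit2_measurable.
- by move=> k; exact: on_grid_measurable.
- by move=> k w _; apply: phi0; apply: rate_gt0; case/andP: (p1 k).
- by move=> w; rewrite leq_maxl geq_max !hit_index_le_size.
move=> k kn.
have -> : [set w | (hit tau1 w <= k < hit2 tau1 tau2 w)%N] =
    [set w | (hit tau1 w <= k)%N] `\` [set w | (hit tau2 w <= k)%N].
  apply/seteqP; split => w /=; rewrite /hit2 leq_max.
    by move=> /andP[h1]; rewrite ltnNge h1/= ltnNge => /negP.
  by move=> [h1 /negP]; rewrite -ltnNge => ->; rewrite h1 orbT.
apply: H; [by case/andP: (p1 k)|exact: grid_lt|by case/andP: (p1 k.+1)|].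
apply: (@measurableD _ (g_sigma_algebraType (nat_generators X t (p k)))); exact: hit_F.
Qed.

(** The constants [t] and 1 stand for the first and the last index of the grid. *)
Lemma stopping_time_cst c : c <= t \/ 1 <= c -> stopping_time X t (cst c).
Proof.
move=> ct s /andP[ts s1]; case: ct => ct.
  rewrite (_ : [set w | _] = setT); last first.
    by apply/seteqP; split => // w _; rewrite /= (le_trans ct).
  exact: (@measurableT _ (g_sigma_algebraType (nat_generators X t s))).
rewrite (_ : [set w | _] = set0); last first.
  by apply/seteqP; split => // w /=; rewrite leNgt (lt_le_trans s1).
exact: (@measurable0 _ (g_sigma_algebraType (nat_generators X t s))).
Qed.

Lemma hit_start w : hit (cst t) w = 0%N.
Proof. by apply/eqP; rewrite -leqn0 hit_index_le// grid0. Qed.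

Lemma hit_end w : hit (cst 1) w = n.
Proof.
apply/eqP; rewrite eqn_leq hit_index_le_size/= leqNgt; apply/negP => h.
have : (hit (cst 1%R) w <= n.-1)%N by rewrite -ltnS prednK.
rewrite hit_index_le ?prednK//; apply/negP; rewrite -ltNge.
by case/andP: (p1 n.-1).
Qed.

Lemma grid_stop_start (op : \bar R -> \bar R -> Prop) (phi : R -> R -> R) tau :
  (forall x, op x x) -> (forall x y z, op x y -> op y z -> op x z) ->
  (forall x y z, op x y -> op (x + z)%E (y + z)%E) ->
  (forall r, measurable_fun setT (phi r)) -> (forall r y, 0 < r -> 0 <= phi r y) ->
  (forall s s' A, t <= s -> s < s' -> s' < 1 -> F s A ->
     op (\int[P]_(w in A) (phi (rate s') (Y s' w))%:E)%E
        (\int[P]_(w in A) (phi (rate s) (Y s w))%:E)%E) ->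
  stopping_time X t tau ->
  op (\int[P]_w (stopped (on_grid phi) (hit tau) w)%:E)%E (phi (rate t) y0)%:E.
Proof.
move=> op1 op2 op3 mphi phi0 H st.
have := grid_stop op phi (cst t) tau op1 op2 op3 mphi phi0 H (stopping_time_cst _ (or_introl (lexx t))) st.
have -> : hit2 (cst t) tau = hit tau.
  by apply/funext => w; rewrite /hit2 hit_start max0n.
have -> : (\int[P]_w (stopped (on_grid phi) (hit (cst t)) w)%:E)%E = (phi (rate t) y0)%:E.
  rewrite (_ : (fun w => _) = cst (phi (rate t) y0)%:E).
    by rewrite -[X in _ = X]mule1 -(@probability_setT _ _ _ P) -integral_cst.
  apply/funext => w.
  by rewrite /stopped hit_start /on_grid grid0 (slope_start W X t x Ht HX).
by [].
Qed.

Lemma stopped_G tau : stopping_time X t tau ->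
  (\int[P]_w (stopped (on_grid G) (hit tau) w)%:E = (G (rate t) y0)%:E)%E.
Proof.
apply: (grid_stop_start eq) => //.
- by move=> ? ? ? -> ->.
- by move=> ? ? ? ->.
- exact: measurable_G.
- by move=> r y r0; exact/ltW/G_gt0.
- by move=> s s' A ts ss' s'1 FA; rewrite (slope_G P W X t x Ht HW HX s s').
Qed.

Let measurable_GN r : measurable_fun setT (fun y : R => G r (- y)).
Proof. by apply: measurableT_comp => //; exact: measurable_G. Qed.

Lemma stopped_GN tau : stopping_time X t tau ->
  (\int[P]_w (stopped (on_grid (fun r y => G r (- y))) (hit tau) w)%:E = (G (rate t) (- y0))%:E)%E.
Proof.
apply: (grid_stop_start eq (fun r y => G r (- y))) => //.
- by move=> ? ? ? -> ->.
- by move=> ? ? ? ->.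
- by move=> r y r0; exact/ltW/G_gt0.
- by move=> s s' A ts ss' s'1 FA; rewrite (slope_GN P W X t x Ht HW HX s s').
Qed.

Lemma stopped_excess (phi : R -> R -> R) tau c :
  (forall r, measurable_fun setT (phi r)) -> (forall r y, 0 < r -> 0 <= phi r y) ->
  (forall s s' A, t <= s -> s < s' -> s' < 1 -> F s A ->
     (\int[P]_(w in A) (phi (rate s') (Y s' w))%:E =
      \int[P]_(w in A) (phi (rate s) (Y s w))%:E)%E) ->
  0 <= c -> stopping_time X t tau ->
  (\int[P]_w (Num.max (stopped (on_grid phi) (hit tau) w - c) 0)%:E <=
   \int[P]_w (Num.max (phi (rate T) (Y T w) - c) 0)%:E)%E.
Proof.
move=> mphi phi0 mart c0 st.
have := grid_stop (fun x y => y <= x)%E (fun r y => Num.max (phi r y - c) 0) tau (cst 1)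
  (fun x => lexx x) (fun x y z xy yz => le_trans yz xy) (fun x y z yx => leeD2r z yx).
have -> : hit2 tau (cst 1) = (fun=> n).
  apply/funext => w; rewrite /hit2 hit_end; apply/maxn_idPr; exact: hit_index_le_size.
rewrite /stopped /on_grid gridn//; apply => //.
- by move=> r; apply: measurable_maxr => //; apply: measurable_funB => //; exact: mphi.
- by move=> r y _; rewrite le_max lexx orbT.
- by move=> s s' A ts ss' s'1 FA; apply: (slope_excess P W X t x Ht HW HX) => // E; exact: mart.
- by apply: stopping_time_cst; right.
Qed.

Lemma stopping_time_max tau1 tau2 : stopping_time X t tau1 -> stopping_time X t tau2 ->
  stopping_time X t (fun w => Num.max (tau1 w) (tau2 w)).
Proof.
move=> st1 st2 s ts.
have -> : [set w | Num.max (tau1 w) (tau2 w) <= s] = [set w | tau1 w <= s] `&` [set w | tau2 w <= s].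
  by apply/seteqP; split => w; rewrite /= ge_max => /andP.
by apply: (@measurableI _ (g_sigma_algebraType (nat_generators X t s))); [exact: st1|exact: st2].
Qed.

Lemma hit2E tau1 tau2 : hit2 tau1 tau2 = hit (fun w => Num.max (tau1 w) (tau2 w)).
Proof.
apply/funext => w; rewrite /hit2.
wlog t12 : tau1 tau2 / tau1 w <= tau2 w => [H|].
  have [/H//|/ltW/H] := leP (tau1 w) (tau2 w).
  by rewrite maxnC => ->; rewrite /hit_index maxC.
rewrite (maxn_idPr (hit_index_mono _ _ _ tT _ _ _ t12)) /hit_index.
by rewrite (max_idPr t12).
Qed.

Definition gridX (tau : Omega -> R) w := X (p (hit tau w)) w.

Lemma gridXE tau w : gridX tau w = stopped (on_grid (fun r y => y / r)) (hit tau) w.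
Proof.
rewrite /gridX /stopped /on_grid invrK /slope mulfVK// gt_eqF// subr_gt0.
by case/andP: (p1 (hit tau w)).
Qed.

Let stopped_meas (phi : R -> R -> R) tau : (forall r, measurable_fun setT (phi r)) ->
  stopping_time X t tau -> measurable_fun setT (stopped (on_grid phi) (hit tau)).
Proof.
move=> mphi st; apply: measurable_stopped => [k|k]; first exact: hit_measurable.
exact: on_grid_measurable.
Qed.

Lemma gridX_measurable tau : stopping_time X t tau -> measurable_fun setT (gridX tau).
Proof.
move=> st; have -> : gridX tau = stopped (on_grid (fun r y => y / r)) (hit tau).
  by apply/funext => w; exact: gridXE.
by apply: stopped_meas => // r; exact: measurable_funM.
Qed.

Let rate1 k : 1 <= rate (p k).
Proof.
have /andP[tp p1'] := p1 k; rewrite invf_ge1 ?subr_gt0// gerBl (le_trans _ tp)//.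
by case/andP: Ht.
Qed.

Lemma gridX_sqr tau : stopping_time X t tau ->
  (\int[P]_w (gridX tau w ^+ 2)%:E <= (G (rate t) y0 + G (rate t) (- y0))%:E)%E.
Proof.
move=> st; rewrite EFinD -(stopped_G tau st) -(stopped_GN tau st).
have r0 k : 0 < rate (p k) by exact: lt_le_trans (rate1 k).
rewrite -ge0_integral_add//.
- apply: ge0_le_integral_real => //.
  + by apply: measurable_funX; exact: gridX_measurable.
  + apply: measurable_funD; apply: stopped_meas => //; exact: measurable_G.
  + by move=> w _; exact: sqr_ge0.
  + by move=> w _; rewrite gridXE; exact: sqr_le_G.
- by apply: stopped_meas => //; exact: measurable_G.
- exact: stopped_meas.
- by move=> w _; exact/ltW/G_gt0.
- by move=> w _; exact/ltW/G_gt0.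
Qed.

Lemma gridX_integrable tau : stopping_time X t tau -> P.-integrable setT (EFin \o gridX tau).
Proof.
by move=> st; apply: integrable_of_sqr (gridX_sqr tau st); exact: gridX_measurable.
Qed.

Section gain.
Variables B C a v : R.
Hypotheses (B0 : 0 < B) (aE : a = 1 - B ^+ 2) (lB : a * lap 0 B = B).
Hypotheses (C0 : C < 0) (vE : v = B ^+ 2 - C ^+ 2) (C1 : C ^+ 2 < 1).
Hypothesis vC : v * lap 0 (- C) = a * lap 0 C - C.

Lemma gridX_gain tau1 tau2 : stopping_time X t tau1 -> stopping_time X t tau2 ->
  \int[P]_w gridX (fun w => Num.max (tau1 w) (tau2 w)) w - \int[P]_w gridX tau1 w
  <= Vf C a v (rate t) y0.
Proof.
move=> st1 st2; set tau := fun w => Num.max _ _.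
have st : stopping_time X t tau by exact: stopping_time_max.
have a0 : 0 < a by exact: (a_gt0 B a B0 lB).
have r0 k : 0 < rate (p k) by exact: lt_le_trans (rate1 k).
have mUf r : measurable_fun setT (Uf B a r : R -> R) by exact: measurable_Uf.
have mVf r : measurable_fun setT (Vf C a v r : R -> R) by exact: measurable_Vf.
have Uf0 (r y : R) : 0 < r -> 0 <= Uf B a r y by exact: (Uf_ge0 B a B0 lB).
have Vf0 (r y : R) : 0 < r -> 0 <= Vf C a v r y by exact: (Vf_ge0 B C a v B0 aE lB C0 vC).
pose U tau w := stopped (on_grid (Uf B a)) (hit tau) w.
pose V tau w := stopped (on_grid (Vf C a v)) (hit tau) w.
have ge0_integrable (f : Omega -> R) (K : \bar R) : measurable_fun setT f -> (forall w, 0 <= f w) ->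
    (\int[P]_w (f w)%:E <= K)%E -> (K < +oo)%E -> P.-integrable setT (EFin \o f).
  move=> mf f0 fK K1; apply/integrableP; split; first exact/measurable_EFinP.
  apply: le_lt_trans K1; apply: le_trans fK; rewrite le_eqVlt; apply/orP; left; apply/eqP.
  by apply: eq_integral => w _; rewrite /= ger0_norm.
have iU tau' : stopping_time X t tau' -> P.-integrable setT (EFin \o U tau').
  move=> st'; apply: (ge0_integrable _ (a * G (rate t) y0)%:E) => //.
  - exact: stopped_meas.
  - by move=> w; exact: Uf0.
  - rewrite EFinM -(stopped_G tau' st') -ge0_integral_scale ?(ltW a0)//.
    + apply: ge0_le_integral_real => //.
      * exact: stopped_meas.
      * by apply: measurable_funM => //; apply: stopped_meas => //; exact: measurable_G.
      * by move=> w _; exact: Uf0.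
      * by move=> w _; exact: (Uf_le B a B0 aE lB).
    + by apply: stopped_meas => //; exact: measurable_G.
    + by move=> w _; exact/ltW/G_gt0.
  - by rewrite ltry.
have hV : (\int[P]_w (V tau1 w)%:E <= (Vf C a v (rate t) y0)%:E)%E.
  apply: (grid_stop_start (fun x y => x <= y)%E) => //.
  - by move=> ? ? ?; exact: le_trans.
  - by move=> ? ? ?; exact: leeD2r.
  - by move=> s s' A ts ss' s'1 FA; apply: (slope_Vf P W X t x Ht HW HX B C a v B0 aE lB C0 vE C1 vC).
have iV : P.-integrable setT (EFin \o V tau1).
  by apply: (ge0_integrable _ _ _ _ hV (ltry _)) => [|w]; [exact: stopped_meas|exact: Vf0].
have hU : \int[P]_w U tau w <= \int[P]_w U tau1 w.
  apply: fine_le; [exact: integrable_fin_num (iU _ st)|exact: integrable_fin_num (iU _ st1)|].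
  rewrite /U /tau -hit2E; apply: (grid_stop (fun x y => x <= y)%E) => //.
  - by move=> ? ? ?; exact: le_trans.
  - by move=> ? ? ?; exact: leeD2r.
  - by move=> s s' A ts ss' s'1 FA; apply: (slope_Uf P W X t x Ht HW HX B a B0 aE lB).
have h1 : \int[P]_w gridX tau w <= \int[P]_w U tau w.
  apply: le_Rintegral => //; [exact: gridX_integrable|exact: iU|].
  by move=> w _; rewrite gridXE; exact: (Uf_ge B a B0 aE lB).
have i1 := iU _ st1; have iX := gridX_integrable _ st1.
have h2 : \int[P]_w U tau1 w - \int[P]_w gridX tau1 w <= \int[P]_w V tau1 w.
  rewrite -(RintegralB measurableT i1 iX); apply: le_Rintegral => //.
    exact: integrable_sub.
  by move=> w _; rewrite gridXE; exact: (Uf_le_Vf B C a v B0 aE lB C0 vE vC).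
have h3 : \int[P]_w V tau1 w <= Vf C a v (rate t) y0.
  rewrite -lee_fin /Rintegral fineK//; exact: integrable_fin_num.
by rewrite (le_trans _ h3)// (le_trans _ h2)// lerD2r (le_trans h1).
Qed.

End gain.
End grid_stopping.

(** * The limit of fine grids *)

Section null_sets.
Import HBNNSimple.
Context d (T : measurableType d) (R : realType) (m : {measure set T -> \bar R}) (N : set T).
Hypotheses (mN : measurable N) (N0 : m N = 0%E).
Local Open Scope ereal_scope.

Let ge0_integral_off_null (f : T -> \bar R) : (forall x, 0 <= f x) ->
  \int[m]_x f x = \int[m]_(x in ~` N) f x.
Proof.
move=> f0; apply/eqP; rewrite eq_le; apply/andP; split; last exact: ge0_subset_integral_sup.
rewrite [leLHS]ge0_integralE//; apply: ge_ereal_sup => _ [h /= hf <-].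
have hf' x : (h x)%:E <= f x by have := hf x; rewrite patch_setT.
rewrite -integralT_nnsfun.
have -> : \int[m]_x (EFin \o h) x = \int[m]_(x in ~` N) (EFin \o h) x.
  rewrite -(setUv N) ge0_integral_setU//; last 4 first.
  - exact: measurableC.
  - by apply/measurable_EFinP; exact: measurable_funTS.
  - by move=> x _; rewrite lee_fin.
  - by apply/disj_setPS; rewrite setICr.
  rewrite (_ : \int[m]_(x in N) _ = 0) ?add0e//.
  apply: null_set_integral => //; apply/measurable_EFinP; exact: measurable_funTS.
rewrite !ge0_integralE//; last by move=> x; rewrite lee_fin.
apply: ereal_sup_le => _ [k /= kh <-]; exists k => // x.
apply: le_trans (kh x) _; rewrite /patch; case: ifP => // _; exact: hf'.
Qed.

(** A nonnegative integral is a supremum over simple functions, and each of these ignores [N]. The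
    functions are arbitrary because the integrand of [gain] evaluates [X] on [N] at uncontrolled
    times, where no measurability is at hand. *)
Lemma eq_integral_off_null (f g : T -> \bar R) : (forall x, ~ N x -> f x = g x) ->
  \int[m]_x f x = \int[m]_x g x.
Proof.
move=> fg; rewrite integralE [RHS]integralE; congr (_ - _).
- rewrite !ge0_integral_off_null//; apply: eq_integral => x /set_mem nN.
  by rewrite !funeposE fg.
- rewrite !ge0_integral_off_null//; apply: eq_integral => x /set_mem nN.
  by rewrite !funenegE fg.
Qed.

End null_sets.

Lemma cvg_Rintegral_L2 d (T : measurableType d) (R : realType) (P : probability T R)
    (f_ : nat -> T -> R) (f : T -> R) (K : R) :
  (forall n, measurable_fun setT (f_ n)) -> measurable_fun setT f ->
  {ae P, forall w, f_ ^~ w @ \oo --> f w} ->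
  (forall n, (\int[P]_w (f_ n w ^+ 2)%:E <= K%:E)%E) ->
  P.-integrable setT (EFin \o f) /\ \int[P]_w f_ n w @[n --> \oo] --> \int[P]_w f w.
Proof.
move=> mf_ mf ff HK.
have part (c : R) : c ^+ 2 = 1 ->
   P.-integrable setT (fun w => (Num.max (c * f w) 0)%:E) /\
   \int[P]_w Num.max (c * f_ n w) 0 @[n --> \oo] --> \int[P]_w Num.max (c * f w) 0.
  move=> c1; apply: (@cvg_Rintegral_sqr _ _ _ P (fun n w => Num.max (c * f_ n w) 0) _ K).
  - by move=> n; apply: measurable_maxr => //; exact: measurable_funM.
  - by apply: measurable_maxr => //; exact: measurable_funM.
  - by move=> n w; rewrite le_max lexx orbT.
  - by move=> w; rewrite le_max lexx orbT.
  - apply: filterS ff => w h.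
    apply: (@continuous_cvg _ _ _ _ _ (fun n => c * f_ n w) (fun y => Num.max y 0)).
      by move=> ?; apply: (@continuous_max _ _ id (cst 0)) => //; exact: cst_continuous.
    by apply: cvgM => //; exact: cvg_cst.
  move=> n; apply: le_trans (HK n); apply: ge0_le_integral_real => //.
  - by apply: measurable_funX; apply: measurable_maxr => //; exact: measurable_funM.
  - exact: measurable_funX.
  - by move=> w _; exact: sqr_ge0.
  move=> w _; case: (leP (c * f_ n w) 0) => _; first by rewrite expr0n/= sqr_ge0.
  by rewrite exprMn c1 mul1r.
have [i1 c1] := part 1 (expr1n _ _).
have [i2 c2] := part (- 1) (etrans (sqrrN _) (expr1n _ _)).
have dec (y : R) : y = Num.max (1 * y) 0 - Num.max (- 1 * y) 0.
  by rewrite mul1r mulN1r; case: (leP y 0) => h; case: (leP (- y) 0) => h'; lra.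
have dec_ (g : T -> R) : g = (fun w => Num.max (1 * g w) 0 - Num.max (- 1 * g w) 0).
  by apply/funext => w; exact: dec.
split; first by rewrite (dec_ f); exact: integrable_sub.
have i_n n : P.-integrable setT (EFin \o f_ n) by apply: integrable_of_sqr (HK n).
have max_int (c : R) (g : T -> R) : measurable_fun setT g -> P.-integrable setT (EFin \o g) ->
    `|c| = 1 -> P.-integrable setT (EFin \o (fun w => Num.max (c * g w) 0)).
  move=> mg ig c1'; apply: (le_integrable _ _ _ ig) => //.
    by apply/measurable_EFinP; apply: measurable_maxr => //; exact: measurable_funM.
  move=> w _; rewrite /= lee_fin [leLHS]ger0_norm ?le_max ?lexx ?orbT// ge_max normr_ge0 andbT.
  by rewrite (le_trans (ler_norm _))// normrM c1' mul1r.
have -> : (fun n => \int[P]_w f_ n w) =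
   (fun n => \int[P]_w Num.max (1 * f_ n w) 0 - \int[P]_w Num.max (- 1 * f_ n w) 0).
  apply/funext => n; rewrite -RintegralB//.
  - by apply: eq_Rintegral => w _; exact: dec.
  - by apply: max_int => //; rewrite normr1.
  - by apply: max_int => //; rewrite normrN1.
have -> : \int[P]_w f w = \int[P]_w Num.max (1 * f w) 0 - \int[P]_w Num.max (- 1 * f w) 0.
  by rewrite -RintegralB//; apply: eq_Rintegral => w _; exact: dec.
exact: cvgB.
Qed.

Section grid_limit.
Context {R : realType} {d : measure_display} {Omega : measurableType d}.
Variables (P : probability Omega R) (W X : R -> Omega -> R) (t x : R).
Hypotheses (Ht : 0 <= t < 1) (HW : standard_BM P W) (HX : bridge_SDE W X t x).
Local Notation Y := (slope X).
Local Notation rate u := (1 - u)^-1.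
Local Notation F := (nat_filtration X t).
Local Notation y0 := (x / (1 - t)).

Definition at_time (phi : R -> R -> R) s w := phi (rate s) (Y s w).

Definition path_continuous (phi : R -> R -> R) := forall w (u : nat -> R) s,
  (forall m, t <= u m < 1) -> t <= s < 1 -> u m @[m --> \oo] --> s ->
  at_time phi (u m) w @[m --> \oo] --> at_time phi s w.

Lemma slope_path_cvg w (u : nat -> R) (s : R) : (forall m, t <= u m < 1) -> t <= s < 1 ->
  u m @[m --> \oo] --> s -> Y (u m) w @[m --> \oo] --> Y s w.
Proof.
(* Continuity is known on [t, T] for T < 1; the midpoint between [s] and 1 leaves room for the
   eventual values of [u], and capping handles the others. *)
move=> u1 /andP[ts s1] us; pose T := (s + 1) / 2.
have sT : s < T by rewrite /T; lra.
have T1 : T < 1 by rewrite /T; lra.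
have tT : t <= T < 1 by rewrite T1 (le_trans ts)// ltW.
pose u' m := Num.min (u m) T.
have uT : \forall m \near \oo, u m < T by exact: cvgr_lt us _ sT.
have u's : u' m @[m --> \oo] --> s.
  apply: cvg_trans us; apply: near_eq_cvg; near=> m.
  rewrite /u' (min_idPl _)// ltW//; near: m; exact: uT.
have h := slope_cvg P W X t x Ht HW HX T w u' s tT _ _ u's.
apply: cvg_trans (h _ _).
- apply: near_eq_cvg; near=> m.
  rewrite /u' (min_idPl _)// ltW//; near: m; exact: uT.
- by move=> m; rewrite /u' le_min ge_min lexx orbT andbT; have /andP[-> _] := u1 m;
    case/andP: tT.
- by rewrite ts ltW.
Unshelve. all: by end_near. Qed.

Lemma rate_cvg (u : nat -> R) (s : R) : s < 1 -> u m @[m --> \oo] --> s ->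
  rate (u m) @[m --> \oo] --> rate s.
Proof.
move=> s1 us; apply: cvgV; first by rewrite gt_eqF// subr_gt0.
by apply: cvgB => //; exact: cvg_cst.
Qed.

Lemma path_continuous_X : path_continuous (fun r y => y / r).
Proof.
move=> w u s u1 s1 us; rewrite /at_time.
apply: cvgM; first exact: slope_path_cvg.
apply: cvgV; last by apply: rate_cvg => //; case/andP: s1.
by rewrite gt_eqF// rate_gt0//; case/andP: s1.
Qed.

Lemma path_continuous_G : path_continuous G.
Proof.
move=> w u s u1 s1 us; rewrite /at_time /G; have s1' : s < 1 by case/andP: s1.
have cs : Num.sqrt (rate (u m)) @[m --> \oo] --> Num.sqrt (rate s).
  by apply: (@continuous_cvg _ _ _ _ _ _ (@Num.sqrt R)); [exact: sqrt_continuous|exact: rate_cvg].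
have s0 : Num.sqrt (rate s) != 0 by rewrite gt_eqF// sqrtr_gt0 rate_gt0.
have ci : (Num.sqrt (rate (u m)))^-1 @[m --> \oo] --> (Num.sqrt (rate s))^-1 by exact: cvgV.
apply: cvgM => //.
apply: (@continuous_cvg _ _ _ _ _ _ (lap 0)); first exact: continuous_lap0.
by apply: cvgM => //; exact: slope_path_cvg.
Qed.

Lemma path_continuous_GN : path_continuous (fun r y => G r (- y)).
Proof.
move=> w u s u1 s1 us; rewrite /at_time /G; have s1' : s < 1 by case/andP: s1.
have cs : Num.sqrt (rate (u m)) @[m --> \oo] --> Num.sqrt (rate s).
  by apply: (@continuous_cvg _ _ _ _ _ _ (@Num.sqrt R)); [exact: sqrt_continuous|exact: rate_cvg].
have s0 : Num.sqrt (rate s) != 0 by rewrite gt_eqF// sqrtr_gt0 rate_gt0.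
have ci : (Num.sqrt (rate (u m)))^-1 @[m --> \oo] --> (Num.sqrt (rate s))^-1 by exact: cvgV.
apply: cvgM => //.
apply: (@continuous_cvg _ _ _ _ _ _ (lap 0)); first exact: continuous_lap0.
by apply: cvgM => //; apply: cvgN; exact: slope_path_cvg.
Qed.

(** The horizon may move while the mesh shrinks: it is constant for optional stopping before 1, and
    increases to 1 for the gain. *)
Variables (T_ : nat -> R) (T : R).
Hypotheses (tT_ : forall m, t < T_ m) (T_1 : forall m, T_ m < 1) (T_T : T_ m @[m --> \oo] --> T).

Definition grid_time (tau : Omega -> R) m w :=
  grid t (T_ m) m.+1 (hit_index t (T_ m) m.+1 tau w).

Lemma grid_time_bound tau m w : t <= grid_time tau m w < 1.
Proof.
have /andP[-> h] := grid_bound t (T_ m) m.+1 (tT_ m) isT (hit_index t (T_ m) m.+1 tau w).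
exact: le_lt_trans (T_1 m).
Qed.

Lemma grid_time_cvg tau w : t <= tau w ->
  grid_time tau m w @[m --> \oo] --> Num.min (tau w) T.
Proof.
move=> ttau.
have cmin : Num.min (tau w) (T_ m) @[m --> \oo] --> Num.min (tau w) T.
  apply: (@continuous_cvg _ _ _ _ _ _ (Num.min (tau w))) => //.
  by move=> ?; apply: (@continuous_min _ _ (cst (tau w)) id) => //; exact: cst_continuous.
apply: (@squeeze_cvgr _ _ _ _ (fun m => Num.min (tau w) (T_ m))
   (fun m => Num.min (tau w) (T_ m) + (T_ m - t) * harmonic m)) => //.
- near=> m; exact: (grid_hit_bound t (T_ m) m.+1 (tT_ m) isT).
- rewrite -[X in _ --> X]addr0; apply: cvgD => //.
  rewrite -[X in _ --> X](mulr0 (T - t)); apply: cvgM; last exact: cvg_harmonic.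
  by apply: cvgB => //; exact: cvg_cst.
Unshelve. all: by end_near. Qed.

Variables (tau : Omega -> R) (N : set Omega).
Hypotheses (st : stopping_time X t tau) (mN : measurable N) (N0 : P N = 0%E).
Hypothesis tauN : forall w, ~ N w -> t <= tau w /\ Num.min (tau w) T < 1.
Hypothesis tT : t <= T.

(** The factor annihilates the exceptional set, where the stopped time may leave [t, 1[; what
    remains is an everywhere limit of measurable grid values. *)
Definition stop_value (phi : R -> R -> R) w := \1_(~` N) w * at_time phi (Num.min (tau w) T) w.

Let grid_value (phi : R -> R -> R) m w := at_time phi (grid_time tau m w) w.

Lemma grid_value_measurable phi m : (forall r, measurable_fun setT (phi r)) ->
  measurable_fun setT (grid_value phi m).
Proof.
move=> mphi; apply: (@measurable_stopped _ _ _ (on_grid X t (T_ m) m.+1 phi)) => [k|k].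
  exact: (hit_measurable P W X t x Ht HW HX (T_ m) m.+1 (tT_ m) (T_1 m) isT tau k st).
exact: (on_grid_measurable P W X t x Ht HW HX (T_ m) m.+1 (tT_ m) (T_1 m) isT).
Qed.

Lemma stop_value_cvg phi w : path_continuous phi -> ~ N w ->
  grid_value phi m w @[m --> \oo] --> stop_value phi w.
Proof.
move=> cphi nN; have [h1 h2] := tauN w nN.
rewrite /stop_value indicE mem_set// mul1r; apply: cphi.
- by move=> m; exact: grid_time_bound.
- by rewrite h2 andbT le_min h1.
- exact: grid_time_cvg.
Qed.

Lemma stop_value_measurable phi : (forall r, measurable_fun setT (phi r)) ->
  path_continuous phi -> measurable_fun setT (stop_value phi).
Proof.
move=> mphi cphi.
apply: (@measurable_fun_cvg _ _ _ _ (fun m w => \1_(~` N) w * grid_value phi m w)).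
  move=> m; apply: measurable_funM; last exact: grid_value_measurable.
  by apply: measurable_indic; exact: measurableC.
move=> w _; have [Nw|nN] := pselect (N w).
  rewrite /stop_value indicE memNset ?mul0r; last by move=> h; exact: h.
  rewrite (_ : (fun _ => _) = cst 0); first exact: cvg_cst.
  by apply/funext => m; rewrite mul0r.
rewrite indicE mem_set// (_ : (fun _ => _) = grid_value phi ^~ w); first exact: stop_value_cvg.
by apply/funext => m; rewrite mul1r.
Qed.

Lemma stop_value_ae_cvg phi : path_continuous phi ->
  {ae P, forall w, grid_value phi ^~ w @ \oo --> stop_value phi w}.
Proof.
move=> cphi; exists N; split => // w /= nc; apply: contrapT => nN.
by apply: nc; exact: stop_value_cvg.
Qed.

Lemma stop_value_X : P.-integrable setT (EFin \o stop_value (fun r y => y / r)) /\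
  \int[P]_w gridX X t (T_ m) m.+1 tau w @[m --> \oo] --> \int[P]_w stop_value (fun r y => y / r) w.
Proof.
have mphi r : measurable_fun setT (fun y : R => y / r) by exact: measurable_funM.
apply: (cvg_Rintegral_L2 _ _ _ P _ _ (G (rate t) y0 + G (rate t) (- y0))).
- by move=> m; exact: (gridX_measurable P W X t x Ht HW HX (T_ m) m.+1 (tT_ m) (T_1 m) isT).
- by apply: stop_value_measurable => //; exact: path_continuous_X.
- apply: filterS (stop_value_ae_cvg _ path_continuous_X) => w; apply: cvg_trans.
  rewrite (_ : (fun m => gridX _ _ _ _ _ _) = (grid_value (fun r y => y / r)) ^~ w)//.
  by apply/funext => m; rewrite gridXE.
- by move=> m; exact: (gridX_sqr P W X t x Ht HW HX (T_ m) m.+1 (tT_ m) (T_1 m) isT).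
Qed.

End grid_limit.

Lemma cvg_le_const (R : realType) (u : nat -> R) (l c : R) : u m @[m --> \oo] --> l ->
  (forall m, u m <= c) -> l <= c.
Proof.
move=> ul uc; rewrite -(cvg_lim _ ul)//; apply: limr_le; first exact: cvgP ul.
exact: nearW.
Qed.

Section gain_bound.
Context {R : realType} {d : measure_display} {Omega : measurableType d}.
Variables (P : probability Omega R) (W X : R -> Omega -> R) (t x : R).
Hypotheses (Ht : 0 <= t < 1) (HW : standard_BM P W) (HX : bridge_SDE W X t x).
Local Notation y0 := (x / (1 - t)).
Local Notation stopX := (fun N tau => stop_value X 1 tau N (fun r y => y / r)).

Definition horizon (m : nat) : R := 1 - (1 - t) / m.+2%:R.

Lemma horizon_gt m : t < horizon m.
Proof.
have t1 : t < 1 by case/andP: Ht.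
rewrite /horizon ltrBrDl addrC -ltrBrDl ltr_pdivrMr ?ltr0n// ltr_pMr ?subr_gt0//.
by rewrite ltr1n.
Qed.

Lemma horizon_lt1 m : horizon m < 1.
Proof. by rewrite gtrBl divr_gt0 ?ltr0n// subr_gt0; case/andP: Ht. Qed.

Lemma horizon_cvg : horizon m @[m --> \oo] --> (1 : R).
Proof.
rewrite -[X in _ --> X]subr0; apply: cvgB; first exact: cvg_cst.
rewrite -(mulr0 (1 - t)); apply: cvgM; first exact: cvg_cst.
by have := @cvg_harmonic R; rewrite -cvg_shiftS.
Qed.

Section pair.
Variables (tau1 tau2 : Omega -> R) (N : set Omega).
Hypotheses (st1 : stopping_time X t tau1) (st2 : stopping_time X t tau2).
Hypotheses (mN : measurable N) (N0 : P N = 0%E).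
Hypothesis tauN : forall w, ~ N w -> [/\ t <= tau1 w, tau1 w <= tau2 w & tau2 w < 1].

Let tau1N w : ~ N w -> t <= tau1 w /\ Num.min (tau1 w) 1 < 1.
Proof. by move=> /tauN[h1 h2 h3]; split => //; rewrite gt_min (le_lt_trans h2). Qed.

Let tau2N w : ~ N w -> t <= tau2 w /\ Num.min (tau2 w) 1 < 1.
Proof. by move=> /tauN[h1 h2 h3]; split => //; [exact: le_trans h2|rewrite gt_min h3]. Qed.

Let stopXE tau w : ~ N w -> tau w < 1 -> stopX N tau w = X (tau w) w.
Proof.
move=> nN t1; rewrite /stop_value indicE mem_set// mul1r /at_time (min_idPl _) ?ltW//.
by rewrite invrK /slope mulfVK// gt_eqF// subr_gt0.
Qed.

Let t_le1 : t <= 1. Proof. by apply/ltW; case/andP: Ht. Qed.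

Let limX tau : stopping_time X t tau -> (forall w, ~ N w -> t <= tau w /\ Num.min (tau w) 1 < 1) ->
  P.-integrable setT (EFin \o stopX N tau) /\
  \int[P]_w gridX X t (horizon m) m.+1 tau w @[m --> \oo] --> \int[P]_w stopX N tau w.
Proof.
move=> st hN; exact: (stop_value_X P W X t x Ht HW HX horizon 1 horizon_gt horizon_lt1
  horizon_cvg tau N st mN N0 hN).
Qed.

Lemma gain_stop_value :
  gain P X tau1 tau2 = (\int[P]_w stopX N tau2 w - \int[P]_w stopX N tau1 w)%:E.
Proof.
have [i1 _] := limX _ st1 tau1N; have [i2 _] := limX _ st2 tau2N.
rewrite /gain (eq_integral_off_null _ _ _ _ N mN N0 _
   (fun w => (stopX N tau2 w - stopX N tau1 w)%:E)).
  rewrite -RintegralB// /Rintegral fineK//; apply: integrable_fin_num => //.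
  exact: integrable_sub.
move=> w nN; have [h1 h2 h3] := tauN _ nN.
by rewrite !stopXE// (le_lt_trans h2).
Qed.

Variables B C a v : R.
Hypotheses (B0 : 0 < B) (aE : a = 1 - B ^+ 2) (lB : a * lap 0 B = B).
Hypotheses (C0 : C < 0) (vE : v = B ^+ 2 - C ^+ 2) (C1 : C ^+ 2 < 1).
Hypothesis vC : v * lap 0 (- C) = a * lap 0 C - C.

Lemma gain_le_Vf : (gain P X tau1 tau2 <= (Vf C a v (1 - t)^-1 y0)%:E)%E.
Proof.
rewrite gain_stop_value lee_fin.
pose tau w := Num.max (tau1 w) (tau2 w).
have st : stopping_time X t tau by exact: stopping_time_max.
have tauE w : ~ N w -> tau w = tau2 w by move=> /tauN[_ h _]; rewrite /tau (max_idPr _).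
have [i c] := limX _ st (fun w nN => eq_ind_r (fun z => t <= z /\ Num.min z 1 < 1) (tau2N w nN) (tauE w nN)).
have [i1 c1] := limX _ st1 tau1N; have [i2 _] := limX _ st2 tau2N.
have -> : \int[P]_w stopX N tau2 w = \int[P]_w stopX N tau w.
  rewrite /Rintegral; congr fine; apply: (eq_integral_off_null _ _ _ _ N mN N0) => w nN.
  have [_ _ h] := tauN _ nN.
  by rewrite !stopXE// ?tauE.
apply: (cvg_le_const _ (fun m => \int[P]_w gridX X t (horizon m) m.+1 tau w
  - \int[P]_w gridX X t (horizon m) m.+1 tau1 w)); first exact: cvgB.
move=> m; apply: (gridX_gain P W X t x Ht HW HX (horizon m) m.+1 _ _ isT B C a v B0) => //.
- exact: horizon_gt.
- exact: horizon_lt1.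
Qed.

End pair.
End gain_bound.

(** * Recurrence *)

Section increment_lower_bound.
Context {R : realType} {d : measure_display} {Omega : measurableType d}.
Variables (P : probability Omega R) (Gen : set (set Omega)).
Hypothesis sub : <<s Gen >> `<=` @measurable d Omega.
Variables (D : Omega -> R) (h : R).
Hypotheses (mD : measurable_fun setT D) (h0 : 0 < h).
Hypothesis hexp : forall l A, <<s Gen >> A ->
  (\int[P]_(w in A) (expR (l * D w))%:E = (expR (l ^+ 2 * h / 2))%:E * P A)%E.

(* Tilting by [expR (c * D / sqrt h)] forces mass above level [b]; the part above the level is
   bounded by AM-GM against the second exponential moment. *)
Lemma increment_lower b (c := 2 * b + 2) A : 1 <= b -> <<s Gen >> A ->
  4 * expR (- (2 * c ^+ 2)) * fine (P A) <= fine (P (A `&` [set w | b * Num.sqrt h <= D w])).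
Proof.
move=> b1 FA; have mA := sub _ FA; set L := [set w | _].
have sh0 : 0 < Num.sqrt h by rewrite sqrtr_gt0.
have mL : measurable L.
  rewrite (_ : L = D @^-1` `[b * Num.sqrt h, +oo[).
    by rewrite -[X in measurable X]setTI; exact: mD.
  by apply/seteqP; split => w; rewrite /L/= in_itv/= andbT.
pose l := c / Num.sqrt h.
have l2 : l ^+ 2 * h = c ^+ 2.
  by rewrite /l expr_div_n sqr_sqrtr ?(ltW h0)// mulfVK// gt_eqF.
have e1 : (\int[P]_(w in A) (expR (l * D w))%:E = (expR (c ^+ 2 / 2))%:E * P A)%E.
  by rewrite hexp// l2.
have e2 : (\int[P]_(w in A) (expR (2 * l * D w))%:E = (expR (2 * c ^+ 2))%:E * P A)%E.
  by rewrite hexp// -l2; congr ((expR _)%:E * _)%E; field.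
have mexp k : measurable_fun setT (fun w => expR (k * D w)).
  by apply: measurableT_comp => //; exact: measurable_funM.
pose K := expR (2 * c ^+ 2).
have K0 : 0 < K by exact: expR_gt0.
have m1L : measurable_fun setT (\1_L : Omega -> R) by exact: measurable_indic.
have pt w : expR (l * D w) <= expR (c * b) + (K^-1 * expR (2 * l * D w) + K / 4 * \1_L w).
  rewrite indicE; have [/set_mem wL|/negP nL] := boolP (w \in L).
    have -> : expR (2 * l * D w) = expR (l * D w) ^+ 2.
      by rewrite expr2 -expRD; congr expR; ring.
    rewrite mulr1; apply: ler_wpDl; first exact: expR_ge0.
    move: (expR (l * D w)) => y.
    have := sqr_ge0 (2 * y - K); rewrite -subr_ge0.
    have -> : K^-1 * y ^+ 2 + K / 4 - y = (2 * y - K) ^+ 2 / (4 * K) by field; rewrite gt_eqF.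
    by move=> hh; rewrite divr_ge0// mulr_ge0// ltW.
  rewrite mulr0 addr0 ler_wpDr//; first by rewrite mulr_ge0 ?invr_ge0 ?expR_ge0.
  rewrite ler_expR /l mulrAC ler_pdivrMr// -mulrA ler_wpM2l//; first by rewrite /c; lra.
  rewrite leNgt; apply/negP => h1; apply: nL; apply/mem_set; exact: ltW.
have key : expR (c ^+ 2 / 2) * fine (P A) <=
    expR (c * b) * fine (P A) + (fine (P A) + K / 4 * fine (P (A `&` L))).
  have mB : measurable_fun setT (fun w => K^-1 * expR (2 * l * D w) + K / 4 * \1_L w).
    by apply: measurable_funD; apply: measurable_funM => //; exact: mexp.
  have mC : measurable_fun setT
      (fun w => expR (c * b) + (K^-1 * expR (2 * l * D w) + K / 4 * \1_L w)).
    exact: measurable_funD.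
  have := ge0_le_integral_real _ _ _ P A _ _ mA (mexp l) mC (fun w _ => expR_ge0 _) (fun w _ => pt w).
  rewrite e1 ge0_integral_add//; last first.
    by move=> w _; rewrite addr_ge0 ?mulr_ge0 ?divr_ge0 ?invr_ge0 ?expR_ge0// indicE.
  rewrite integral_cst// ge0_integral_add//; last 4 first.
  - by apply: measurable_funM => //; exact: mexp.
  - exact: measurable_funM.
  - by move=> w _; rewrite mulr_ge0 ?invr_ge0 ?expR_ge0.
  - by move=> w _; rewrite mulr_ge0 ?divr_ge0 ?expR_ge0// indicE.
  rewrite ge0_integral_scale ?invr_ge0 ?expR_ge0//.
  rewrite ge0_integral_scale ?divr_ge0 ?expR_ge0//.
  rewrite e2 integral_indic// muleA -EFinM mulVf ?gt_eqF// mul1e setIC.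
  have mAL := measurableI _ _ mA mL.
  have [p pE] : exists p, P A = p%:E by exists (fine (P A)); rewrite fineK// fin_num_measure.
  have [q qE] : exists q, P (A `&` L) = q%:E.
    by exists (fine (P (A `&` L))); rewrite fineK// fin_num_measure.
  move=> H; have {H} : ((expR (c ^+ 2 / 2))%:E * p%:E <=
      (expR (c * b))%:E * p%:E + (p%:E + (K / 4)%:E * q%:E))%E.
    by rewrite -pE -qE; exact: H.
  by rewrite pE qE -!EFinM -!EFinD lee_fin.
(* This is the origin of c = 2 b + 2: then c^2/2 = c b + c, and the tilted mass exceeds the part
   below level [b] and the second-moment part together by at least P(A). *)
have big : expR (c * b) + 2 <= expR (c ^+ 2 / 2).
  have -> : c ^+ 2 / 2 = c * b + c by rewrite /c; field.
  rewrite expRD; have h1 := expR_ge1Dx c; have : 1 <= expR (c * b).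
    by rewrite -expR0 ler_expR mulr_ge0 /c; lra.
  by move: (expR (c * b)) (expR c) h1 => u z; rewrite /c; nra.
have p0 : 0 <= fine (P A) by rewrite fine_ge0.
rewrite expRN -/K -mulrA mulrCA -ler_pdivlMl ?invr_gt0// invrK.
have := ler_wpM2r p0 big; rewrite mulrDl.
lra.
Qed.

End increment_lower_bound.

Section recurrence.
Context {R : realType} {d : measure_display} {Omega : measurableType d}.
Variables (P : probability Omega R) (W X : R -> Omega -> R) (t x : R).
Hypotheses (Ht : 0 <= t < 1) (HW : standard_BM P W) (HX : bridge_SDE W X t x).
Local Notation Y := (slope X).
Local Notation rate u := (1 - u)^-1.
Local Notation F := (nat_filtration X t).
(** The sign serves both boundaries: -1 with b = -C for the lower one, 1 with b = B for the upper
    one. *)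
Variables (sg b s1 : R).
Hypotheses (sg1 : sg ^+ 2 = 1) (ts1 : t <= s1 < 1).
Local Notation V s w := (sg * Y s w).

Let E := [set w | forall s, s1 <= s < 1 -> V s w < b * Num.sqrt (rate s)].
Let b' := `|b| + 1.
Let delta := 4 * expR (- (2 * (2 * b' + 2) ^+ 2)).

Let F_meas s A : t <= s < 1 -> F s A -> measurable A.
Proof. by move=> ts FA; exact: (nat_filtration_measurable P W X t x Ht HW HX s ts). Qed.

Let V_F s B : t <= s < 1 -> measurable B -> F s [set w | B (V s w)].
Proof.
move=> ts mB.
have mV : measurable_fun setT ((fun w => V s w) : g_sigma_algebraType (nat_generators X t s) -> R).
  by apply: measurable_funM => //; exact: slope_adapted.
by have := mV measurableT B mB; rewrite setTI.
Qed.

Let prob_le A B : measurable A -> measurable B -> A `<=` B -> fine (P A) <= fine (P B).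
Proof.
move=> mA mB AB; apply: fine_le; [exact: fin_num_measure|exact: fin_num_measure|].
by apply: le_measure => //; rewrite inE.
Qed.

Let prob_split A B : measurable A -> measurable B ->
  fine (P A) = fine (P (A `&` B)) + fine (P (A `\` B)).
Proof.
move=> mA mB; rewrite -fineD ?fin_num_measure//; last 2 first.
- exact: measurableI.
- exact: measurableD.
rewrite addeC -measureU ?setDUIK//; last 3 first.
- exact: measurableD.
- exact: measurableI.
- by apply/seteqP; split => // w [[_ h1] [_ h2]].
by rewrite setUC setUIDK.
Qed.

(** The event [E] of no crossing after [s1] involves uncountably many times, so it is handled
    through covers [A] from the filtration. Looking at one sufficiently late time removes a fixed
    fraction [delta] of any cover, up to an arbitrarily small error. *)
Let recurrence_step s A e : t <= s < 1 -> F s A -> E `<=` A -> 0 < e ->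
  exists s' A', [/\ t <= s' < 1, F s' A', E `<=` A' &
    fine (P A') <= fine (P A) - delta * fine (P A) + 4 * e].
Proof.
move=> ts FA EA e0; have /andP[tles s_lt1] := ts; have /andP[_ s1lt] := ts1.
have mA := F_meas s A ts FA.
have mV u : t <= u < 1 -> measurable_fun setT (fun w => V u w).
  by move=> tu; apply: measurable_funM => //; exact: (measurable_slope P W X t x Ht HW HX).
have iV : P.-integrable setT (fun w => (V s w)%:E).
  apply: integrable_scale => //; exact: (slope_integrable P W X t x Ht HW HX).
pose M := fine (\int[P]_w `|(V s w)%:E|)%E.
have M0 : 0 <= M by rewrite fine_ge0// integral_ge0.
(* By Markov's inequality V s falls below -K with probability at most e; on the rest the start of
   the increment is under control. *)
pose K := (M + 1) / e; have K0 : 0 < K by rewrite divr_gt0// ltr_wpDl.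
pose AK := A `&` [set w | - K <= V s w].
have FAK : F s AK.
  apply: (@measurableI _ (g_sigma_algebraType (nat_generators X t s))) => //.
  have := V_F s `[- K, +oo[ ts (measurable_itv _); congr (F _ _).
  by apply/seteqP; split => w /=; rewrite in_itv/= andbT.
have mAK := F_meas s AK ts FAK.
have PAK : fine (P A) <= fine (P AK) + e.
  have mQ : measurable [set w | - K <= V s w].
    have := F_meas s _ ts (V_F s `[- K, +oo[ ts (measurable_itv _)); congr measurable.
    by apply/seteqP; split => w /=; rewrite in_itv/= andbT.
  rewrite (prob_split A [set w | - K <= V s w])// lerD2l.
  have mEV : measurable_fun setT (EFin \o (fun w => V s w)) by apply/measurable_EFinP; exact: mV.
  have := le_integral_abse P measurableT mEV K0; rewrite setTI.
  set Q := [set w | _]; move=> markov.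
  have mQ' : measurable Q.
    rewrite (_ : Q = (fun w => `|V s w|) @^-1` `[K, +oo[).
      rewrite -[X in measurable X]setTI.
      by apply: (measurableT_comp (@normr_measurable R setT) (mV s ts)).
    by apply/seteqP; split => w; rewrite /Q/= in_itv/= andbT lee_fin.
  apply: (@le_trans _ _ (fine (P Q))).
    apply: prob_le => //; first exact: measurableD.
    move=> w [_ /negP]; rewrite -ltNge => h; rewrite /Q/= lee_fin.
    by rewrite -normrN (le_trans _ (ler_norm _))// lerNr ltW.
  have : K * fine (P Q) <= M.
    rewrite -lee_fin EFinM fineK ?fin_num_measure// /M fineK//.
    by apply: integrable_fin_num => //; exact: integrable_abse iV.
  rewrite -ler_pdivlMl// => /le_trans; apply.
  rewrite /K invf_div mulrAC ler_pdivrMr ?ltr_wpDl//.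
  by rewrite ler_pM2l// lerDl.
have r0 : 0 < rate s by exact: rate_gt0.
(* The time [s'] is the one with sqrt (rate s') = q. As sqrt h >= q - sqrt (rate s), a large
   increment leads to V s' >= -K + b' (q - sqrt (rate s)) >= (b' - 1) q >= b q; this explains the
   first entry and the extra 1 in [b']. The other entries put [s'] after [s] and [s1]. *)
pose mx := Num.max (K + b' * Num.sqrt (rate s)) (Num.max (Num.sqrt (rate s)) (Num.sqrt (rate s1))).
pose q := mx + 1; have mxq : mx < q by rewrite /q ltrDl.
pose s' := 1 - (q ^+ 2)^-1.
have b'1 : 1 <= b' by rewrite lerDr.
have q1 : 1 <= q by rewrite lerDr le_max le_max sqrtr_ge0 !orbT.
have q0 : 0 < q by exact: lt_le_trans q1.
have q20 : 0 < q ^+ 2 by rewrite exprn_gt0.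
have rs' : rate s' = q ^+ 2 by rewrite /s' opprB addrC subrK invrK.
have s'1 : s' < 1 by rewrite gtrBl invr_gt0.
have far u : u < 1 -> Num.sqrt (rate u) < q -> u < s'.
  move=> u1 uq; rewrite /s' ltrBrDl -ltrBrDr -[1 - u]invrK ltf_pV2 ?posrE ?rate_gt0//.
  by rewrite -(sqr_sqrtr (ltW (rate_gt0 u u1))) ltr_pXn2r// ?nnegrE ?sqrtr_ge0 ?(ltW q0).
have ss' : s < s' by apply: far => //; apply: le_lt_trans mxq; rewrite !le_max lexx !orbT.
have s1s' : s1 < s' by apply: far => //; apply: le_lt_trans mxq; rewrite !le_max lexx !orbT.
have ts' : t <= s' < 1 by rewrite s'1 (le_trans tles)// ltW.
pose h := rate s' - rate s.
pose D w := sg * (Y s' w - Y s w).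
have sq : Num.sqrt (rate s) < q by apply: le_lt_trans mxq; rewrite !le_max lexx !orbT.
have h0 : 0 < h.
  rewrite subr_gt0 rs' -(sqr_sqrtr (ltW r0)) ltr_pXn2r// ?nnegrE ?sqrtr_ge0 ?(ltW q0)//.
have mD : measurable_fun setT D.
  by apply: measurable_funM => //; apply: measurable_funB; exact: (measurable_slope P W X t x Ht HW HX).
have hexp l A0 : <<s nat_generators X t s >> A0 ->
    (\int[P]_(w in A0) (expR (l * D w))%:E = (expR (l ^+ 2 * h / 2))%:E * P A0)%E.
  move=> FA0; have := slope_exp P W X t x Ht HW HX s s' (l * sg) A0 tles ss' s'1 FA0.
  rewrite exprMn sg1 mulr1 => <-; apply: eq_integral => w _.
  by rewrite /D mulrA.
have low := increment_lower P _ (nat_filtration_measurable P W X t x Ht HW HX s ts) D h mD h0 hexp b' AK b'1 FAK.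
pose H := [set w | b * Num.sqrt (rate s') <= V s' w].
have FH : F s' H.
  have := V_F s' `[b * Num.sqrt (rate s'), +oo[ ts' (measurable_itv _); congr (F _ _).
  by apply/seteqP; split => w /=; rewrite in_itv/= andbT.
have mH := F_meas s' H ts' FH.
exists s', (A `\` H); split => //.
- apply: (@measurableD _ (g_sigma_algebraType (nat_generators X t s'))) => //.
  exact: (nat_filtration_mono X t s s' (ltW ss')).
- move=> w Ew; split; first exact: EA.
  by apply/negP; rewrite -ltNge; apply: Ew; rewrite s'1 ltW.
have : fine (P (AK `&` [set w | b' * Num.sqrt h <= D w])) <= fine (P (A `&` H)).
  apply: prob_le.
  - apply: measurableI => //; rewrite (_ : [set w | _] = D @^-1` `[b' * Num.sqrt h, +oo[).
      by rewrite -[X in measurable X]setTI; exact: mD.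
    by apply/seteqP; split => w; rewrite /= in_itv/= andbT.
  - exact: measurableI.
  move=> w [[Aw /= Kw] Dw]; split => //=.
  rewrite /H/=; have -> : V s' w = V s w + D w by rewrite /D; ring.
  have hq : q - Num.sqrt (rate s) <= Num.sqrt h.
    rewrite -[leLHS]ger0_norm ?subr_ge0 ?(ltW sq)// -sqrtr_sqr ler_wsqrtr//.
    rewrite /h rs' sqrrB sqr_sqrtr ?(ltW r0)//.
    have := ler_wpM2r (sqrtr_ge0 (rate s)) (ltW sq); rewrite -expr2 sqr_sqrtr ?(ltW r0)//.
    lra.
  have Kq : K + b' * Num.sqrt (rate s) <= q by rewrite ltW// (le_lt_trans _ mxq)// le_max lexx.
  have bb : b + 1 <= b' by rewrite lerD2r ler_norm.
  have sE : Num.sqrt (rate s') = q by rewrite rs' sqrtr_sqr ger0_norm// ltW.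
  rewrite sE; have := Dw; rewrite /=.
  have := ler_wpM2l (le_trans ler01 b'1) hq; have := ler_wpM2r (ltW q0) bb.
  rewrite mulrBr mulrDl mul1r.
  move: (V s w) (D w) (b' * Num.sqrt h) (b' * Num.sqrt (rate s)) (b * q) (b' * q) Kw Kq.
  by move=> v1 v2 m1 m2 m3 m4; lra.
rewrite (prob_split A H)//.
have dl : delta <= 4.
  by rewrite /delta ger_pMr// -expR0 ler_expR oppr_le0 mulr_ge0 ?sqr_ge0.
have dl0 : 0 <= delta by rewrite mulr_ge0 ?expR_ge0.
rewrite (prob_split A H)// in PAK.
move: (fine (P (A `&` H))) (fine (P (A `\` H))) low PAK => p1 p2; rewrite -/delta.
move: (fine (P AK)) (fine (P (AK `&` _))) => p3 p4; nra.
Qed.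

Lemma recurrence : exists N, [/\ measurable N, P N = 0%E &
  forall w, ~ N w -> exists2 s, s1 <= s < 1 & b * Num.sqrt (rate s) <= V s w].
Proof.
(* The infimum replaces an iteration: for a nearly minimal cover, [recurrence_step] gives delta inf
   S <= 5 e for every e, hence inf S = 0. A countable intersection of small covers is then the null
   set. *)
pose S := [set p | exists s A, [/\ t <= s < 1, F s A, E `<=` A & p = fine (P A)]].
have S_T : S (fine (P setT)).
  exists t, setT; split => //; first by rewrite lexx; case/andP: Ht.
  exact: (@measurableT _ (g_sigma_algebraType (nat_generators X t t))).
have S0 p : S p -> 0 <= p by move=> [s [A [_ _ _ ->]]]; rewrite fine_ge0.
have hi : has_inf S by split; [exists (fine (P setT))|exists 0; move=> p /S0].
have dl0 : 0 < delta by rewrite mulr_gt0 ?expR_gt0.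
have step e : 0 < e -> delta * inf S <= 5 * e.
  move=> e0; have [p [s [A [ts FA EA pE]]] pS] := inf_adherent e0 hi.
  have [s' [A' [ts' FA' EA' le]]] := recurrence_step s A e ts FA EA e0.
  have h1 : inf S <= fine (P A').
    by apply: ge_inf; [case: hi|exists s', A'].
  have h2 : delta * inf S <= delta * fine (P A).
    rewrite ler_pM2l// -pE; apply: ge_inf; first by case: hi.
    by exists s, A.
  rewrite pE in pS; lra.
have infS : inf S <= 0.
  rewrite leNgt; apply/negP => i0.
  have p0 : 0 < delta * inf S by exact: mulr_gt0.
  have := step (delta * inf S / 10) (divr_gt0 p0 (ltr0n _ 10)).
  move: p0; move: (delta * inf S) => u; lra.
have /choice[A_ hA] : forall n : nat, exists A, [/\ measurable A, E `<=` A & fine (P A) < n.+1%:R^-1].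
  move=> n; have n0 : 0 < n.+1%:R^-1 :> R by rewrite invr_gt0 ltr0n.
  have [p [s [A [ts FA EA pE]]] pS] := inf_adherent n0 hi.
  exists A; split => //; first exact: F_meas FA.
  by rewrite -pE (lt_le_trans pS)// gerDr.
have mN : measurable (\bigcap_n A_ n) by apply: bigcapT_measurable => n; case: (hA n).
exists (\bigcap_n A_ n); split => //.
  apply/eqP; rewrite -(fineK (fin_num_measure P _ mN)); apply/eqP; congr EFin.
  apply/eqP; rewrite eq_le fine_ge0// andbT; apply/ler_addgt0Pr => e e0; rewrite add0r.
  have [n ne] : exists n : nat, n.+1%:R^-1 < e.
    exists (Num.truncn e^-1); rewrite invf_plt ?posrE ?ltr0n//.
    exact: truncnS_gt.
  have [mA _ pA] := hA n; apply/ltW/(le_lt_trans _ (lt_trans pA ne)).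
  by apply: prob_le => // w; apply.
move=> w nN; apply: contrapT => nE; apply: nN => n _.
have [_ EA _] := hA n; apply: EA => s ss1; rewrite ltNge; apply/negP => h.
by apply: nE; exists s.
Qed.

End recurrence.

(** * Hitting times *)

Section hitting_path.
Context {R : realType}.
Variables (h : R -> R) (t : R).
Hypothesis ch : forall T, t <= T < 1 -> {within `[t, T], continuous h}.

Let hS (s0 : R) := [set s : R | s0 <= s < 1 /\ h s <= 0].

Let near_h u e : t <= u < 1 -> 0 < e -> exists2 dl, 0 < dl &
  forall y, t <= y < 1 -> `|u - y| < dl -> `|h u - h y| < e.
Proof.
move=> /andP[tu u1] e0; pose T := (u + 1) / 2.
have T1 : T < 1 by rewrite /T; lra.
have uT : u < T by rewrite /T; lra.
have tT : t <= T < 1 by rewrite T1 (le_trans tu)// ltW.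
have uin : `[t, T]%classic u by rewrite /= in_itv/= tu ltW.
have [dl dl0 H] := (within_continuous_epsP _ _).1 (ch T tT) u e uin e0.
exists (Num.min dl (T - u)); first by rewrite lt_min dl0 subr_gt0.
move=> y /andP[ty y1]; rewrite lt_min => /andP[h1 h2]; apply: H => //.
by rewrite /= in_itv/= ty/=; move: h2; rewrite ltr_norml; lra.
Qed.

Lemma inf_hit_attained s0 : t <= s0 -> hS s0 !=set0 -> hS s0 (inf (hS s0)).
Proof.
move=> ts0 S0; have [s [/andP[s0s s1] hs]] := S0.
have lb : has_lbound (hS s0) by exists s0 => y [/andP[]].
have hi : has_inf (hS s0) by split.
have h1 : s0 <= inf (hS s0) by apply: lb_le_inf => // y [/andP[]].
have h2 : inf (hS s0) < 1.
  have Ss : hS s0 s by split => //; rewrite s0s.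
  exact: le_lt_trans (ge_inf lb Ss) s1.
split; first by rewrite h1.
rewrite leNgt; apply/negP => hpos.
have tu : t <= inf (hS s0) < 1 by rewrite h2 (le_trans ts0).
have [dl dl0 H] := near_h _ _ tu hpos.
have [y [/andP[s0y y1] hy] yl] := inf_adherent dl0 hi.
have Sy : hS s0 y by split => //; rewrite s0y.
have yu : inf (hS s0) <= y := ge_inf lb Sy.
have := H y; rewrite (le_trans ts0 s0y) y1 => /(_ isT).
rewrite ler0_norm ?subr_le0// => /(_ ltac:(lra)); rewrite ltr_norml; lra.
Qed.

Lemma inf_hit_before s0 s : s0 <= s < 1 -> s < inf (hS s0) -> 0 < h s.
Proof.
move=> ss si; rewrite ltNge; apply/negP => hs.
by have := ge_inf (ex_intro _ s0 (fun y '(conj Hy _) => (andP Hy).1) : has_lbound (hS s0))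
   (conj ss hs : hS s0 s); rewrite leNgt si.
Qed.

Lemma inf_hit_zero s0 : t <= s0 -> hS s0 !=set0 -> 0 < h s0 -> h (inf (hS s0)) = 0.
Proof.
move=> ts0 S0 hs0; have [/andP[h1 h2] h3] := inf_hit_attained s0 ts0 S0.
apply/eqP; rewrite eq_le h3/= leNgt; apply/negP => hneg.
set u := inf (hS s0) in h1 h2 h3 hneg *.
have su : s0 < u by rewrite lt_neqAle h1 andbT; apply/eqP => su; rewrite -su in h3; lra.
have tu : t <= u < 1 by rewrite h2 (le_trans ts0).
have hneg' : 0 < - h u by rewrite oppr_gt0.
have [dl dl0 H] := near_h _ _ tu hneg'.
pose y := Num.max s0 (u - dl / 2).
have yu : y < u by rewrite gt_max su/= gtrBl divr_gt0.
have sy : s0 <= y by rewrite le_max lexx.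
have hy : 0 < h y by apply: (inf_hit_before s0); [rewrite sy (lt_trans yu)|].
have := H y; rewrite (le_trans ts0 sy) (lt_trans yu h2) => /(_ isT).
have ud : u - dl / 2 <= y by rewrite le_max lexx orbT.
rewrite ger0_norm ?subr_ge0 ?(ltW yu)// => /(_ ltac:(lra)); rewrite ltr_norml; lra.
Qed.

(** Describes a hit by countably many times. A hit at v > q is approached by rationals in ]q, v[; v
    = q leaves no such room and is listed apart. Conversely the minimum of [h] on [q, s] is attained
    and lies below every n.+1%:R^-1. *)
Lemma rational_hit q s : t <= q -> q <= s -> s < 1 ->
  (exists2 v, q <= v <= s & h v <= 0) <->
  h q <= 0 \/ forall n : nat, exists2 r : rat, q <= ratr r <= s & h (ratr r) < n.+1%:R^-1.
Proof.
move=> tq qs s1; split => [[v /andP[qv vs] hv]|].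
  have [->|vq] := eqVneq q v; [by left|right => n].
  have ltqv : q < v by rewrite lt_neqAle vq.
  have n0 : 0 < n.+1%:R^-1 :> R by rewrite invr_gt0 ltr0n.
  have tv : t <= v < 1 by rewrite (le_trans tq qv) (le_lt_trans vs).
  have [dl dl0 H] := near_h _ _ tv n0.
  have [r] : exists r : rat, ratr r \in `]Num.max q (v - dl), v[%R.
    by apply: rat_in_itvoo; rewrite gt_max ltqv/= gtrBl.
  rewrite in_itv/= gt_max => /andP[/andP[qr vr] rv].
  exists r; first by rewrite (ltW qr) (le_trans (ltW rv)).
  have := H (ratr r); rewrite (le_trans tq (ltW qr)) (lt_le_trans rv (le_trans vs (ltW s1))).
  move=> /(_ isT); rewrite ger0_norm ?subr_ge0 ?(ltW rv)// => /(_ ltac:(lra)).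
  by move: (n.+1%:R^-1) (h (ratr r)) => e y; rewrite ltr_norml; lra.
move=> [hq|H]; first by exists q; rewrite ?lexx.
have tT : t <= s < 1 by rewrite s1 (le_trans tq).
have cqs : {within `[q, s], continuous h}.
  apply: continuous_subspaceW (ch s tT) => y /=; rewrite !in_itv/= => /andP[h1 ->].
  by rewrite (le_trans tq).
have [v] := EVT_min qs cqs; rewrite in_itv/= => qvs hmin; exists v => //.
apply/ler_addgt0Pr => e e0; rewrite add0r.
have [n ne] : exists n : nat, n.+1%:R^-1 < e.
  by exists (Num.truncn e^-1); rewrite invf_plt ?posrE ?ltr0n//; exact: truncnS_gt.
have [r qr hr] := H n; apply: le_trans (ltW ne); apply: le_trans (ltW hr).
by apply: hmin; rewrite in_itv/=.
Qed.

End hitting_path.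

Section hitting_events.
Context {R : realType} {d : measure_display} {Omega : measurableType d}.
Variables (P : probability Omega R) (W X : R -> Omega -> R) (t x : R).
Hypotheses (Ht : 0 <= t < 1) (HW : standard_BM P W) (HX : bridge_SDE W X t x).
Local Notation F := (nat_filtration X t).
Local Notation sig s := (g_sigma_algebraType (nat_generators X t s)).

Lemma hit_event (h : R -> Omega -> R) q s :
  (forall w T, t <= T < 1 -> {within `[t, T], continuous (h ^~ w)}) ->
  (forall u c, t <= u < 1 -> F u [set w | h u w < c]) ->
  (forall u, t <= u < 1 -> F u [set w | h u w <= 0]) ->
  t <= q -> q <= s -> s < 1 -> F s [set w | exists2 v, q <= v <= s & h v w <= 0].
Proof.
move=> ch hlt hle tq qs s1.
pose Q n (r : rat) := if q <= ratr r <= s then [set w | h (ratr r) w < n.+1%:R^-1] else set0.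
have -> : [set w | exists2 v, q <= v <= s & h v w <= 0] =
    [set w | h q w <= 0] `|` \bigcap_n \bigcup_r Q n r.
  apply/seteqP; split => w /=.
    move=> /(rational_hit (h ^~ w) t (ch w) q s tq qs s1)[hq|H]; [by left|right => n _].
    by have [r qr hr] := H n; exists r => //; rewrite /Q qr.
  move=> H; apply/(rational_hit (h ^~ w) t (ch w) q s tq qs s1).
  case: H => [hq|H]; [by left|right => n].
  have [r _] := H n I; rewrite /Q; case: ifP => // qr hr; by exists r.
apply: (@measurableU _ (sig s)).
  by apply: (nat_filtration_mono X t q s qs); apply: hle; rewrite tq (le_lt_trans qs).
apply: (@bigcapT_measurable _ (sig s)) => n.
apply: (@bigcupT_measurable_rat _ (sig s)) => r; rewrite /Q.
case: ifP => [/andP[qr rs]|_]; last exact: (@measurable0 _ (sig s)).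
apply: (nat_filtration_mono X t (ratr r) s rs); apply: hlt.
by rewrite (le_trans tq qr) (le_lt_trans rs).
Qed.

Lemma X_F u B : t <= u < 1 -> measurable B -> F u [set w | B (X u w)].
Proof.
move=> /andP[tu u1] mB; apply: sub_sigma_algebra; exists u, B; split => //.
by rewrite tu lexx.
Qed.

Lemma X_continuous w T : t <= T < 1 -> {within `[t, T], continuous (X ^~ w)}.
Proof.
move=> tT; have cY := slope_continuous P W X t x Ht HW HX T w tT.
have c1 : {within `[t, T], continuous (fun s => slope X s w * (1 - s))}.
  move=> s; apply: cvgM; first exact: cY.
  have : {within `[t, T], continuous (fun s : R => 1 - s)}.
    apply: continuous_subspaceT => y; apply: cvgB; [exact: cvg_cst|exact: cvg_id].
  exact.
have XE s : `[t, T]%classic s -> X s w = slope X s w * (1 - s).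
  rewrite /= in_itv/= => /andP[_ sT].
  by rewrite /slope mulfVK// gt_eqF// subr_gt0 (le_lt_trans sT)//; case/andP: tT.
apply/within_continuous_epsP => s e As e0.
have [dl dl0 H] := (within_continuous_epsP _ _).1 c1 s e As e0.
by exists dl => // y Ay sy; rewrite !XE//; exact: H.
Qed.

Lemma boundary_continuous b (w : Omega) T :
  {within `[t, T], continuous (fun s => b * Num.sqrt (1 - s))}.
Proof.
apply: continuous_subspaceT => y; apply: cvgM; first exact: cvg_cst.
apply: (@continuous_comp _ _ _ (fun s : R => 1 - s) Num.sqrt); last exact: sqrt_continuous.
by apply: cvgB; [exact: cvg_cst|exact: cvg_id].
Qed.

Variables B C : R.
Hypotheses (B0 : 0 < B) (C0 : C < 0).

(** With [above], oriented so that both boundaries are hit when the function becomes nonpositive;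
    one analysis of hitting times then serves both. *)
Definition below s w := X s w - C * Num.sqrt (1 - s).
Definition above s w := B * Num.sqrt (1 - s) - X s w.

Lemma below_continuous w T : t <= T < 1 -> {within `[t, T], continuous (below ^~ w)}.
Proof.
move=> tT s; apply: cvgB; first exact: (X_continuous w T tT).
exact: (boundary_continuous C w T).
Qed.

Lemma above_continuous w T : t <= T < 1 -> {within `[t, T], continuous (above ^~ w)}.
Proof.
move=> tT s; apply: cvgB; first exact: (boundary_continuous B w T).
exact: (X_continuous w T tT).
Qed.

Local Notation tau1 := (tau1_star X C t).
Local Notation tau2 := (tau2_star X B C t).

Let S1 w := [set s : R | t <= s < 1 /\ below s w <= 0].
Let S2 w := [set s : R | tau1 w <= s < 1 /\ above s w <= 0].

Lemma tau1E w : tau1 w = if pselect (S1 w !=set0) is left _ then inf (S1 w) else 1.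
Proof.
have e : [set s | t <= s < 1 /\ X s w <= C * Num.sqrt (1 - s)] = S1 w.
  by apply/seteqP; split => s /= [? h]; split => //; move: h; rewrite /below subr_le0.
by rewrite /tau1_star /hit_time e.
Qed.

Lemma tau2E w : tau2 w = if pselect (S2 w !=set0) is left _ then inf (S2 w) else 1.
Proof.
have e : [set s | tau1 w <= s < 1 /\ B * Num.sqrt (1 - s) <= X s w] = S2 w.
  by apply/seteqP; split => s /= [? h]; split => //; move: h; rewrite /above subr_le0.
by rewrite /tau2_star /hit_time e.
Qed.

Lemma tau1_hit w : S1 w !=set0 -> S1 w (tau1 w).
Proof.
move=> h; rewrite tau1E; case: pselect => // _.
by apply: (inf_hit_attained (below ^~ w) t) => //; exact: below_continuous.
Qed.

Lemma tau1_empty w : ~ (S1 w !=set0) -> tau1 w = 1.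
Proof. by move=> h; rewrite tau1E; case: pselect. Qed.

Lemma tau1_ge w : t <= tau1 w.
Proof.
have [/tau1_hit[/andP[]]//|/tau1_empty ->] := pselect (S1 w !=set0).
by apply/ltW; case/andP: Ht.
Qed.

Lemma tau2_hit w : S2 w !=set0 -> S2 w (tau2 w).
Proof.
move=> h; rewrite tau2E; case: pselect => // _.
by apply: (inf_hit_attained (above ^~ w) t); [exact: above_continuous|exact: tau1_ge|].
Qed.

Lemma tau2_empty w : ~ (S2 w !=set0) -> tau2 w = 1.
Proof. by move=> h; rewrite tau2E; case: pselect. Qed.

Lemma tau1_le w s : t <= s < 1 -> tau1 w <= s <-> exists2 v, t <= v <= s & below v w <= 0.
Proof.
move=> /andP[ts s1]; split => [h|[v /andP[tv vs] hv]].
  have [/tau1_hit[/andP[h1 h2] h3]|/tau1_empty e] := pselect (S1 w !=set0).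
    by exists (tau1 w) => //; rewrite h1.
  by move: h; rewrite e leNgt s1.
have Sv : S1 w v by split => //; rewrite tv (le_lt_trans vs).
rewrite tau1E; case: pselect => [_|]; last by case; exists v.
by apply: le_trans vs; apply: ge_inf => //; exists t => y [/andP[]].
Qed.

Lemma tau2_le w s : t <= s < 1 ->
  tau2 w <= s <-> exists2 v, tau1 w <= v <= s & above v w <= 0.
Proof.
move=> /andP[ts s1]; split => [h|[v /andP[tv vs] hv]].
  have [/tau2_hit[/andP[h1 h2] h3]|/tau2_empty e] := pselect (S2 w !=set0).
    by exists (tau2 w) => //; rewrite h1.
  by move: h; rewrite e leNgt s1.
have Sv : S2 w v by split => //; rewrite tv (le_lt_trans vs).
rewrite tau2E; case: pselect => [_|]; last by case; exists v.
by apply: le_trans vs; apply: ge_inf => //; exists (tau1 w) => y [/andP[]].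
Qed.

Lemma tau1_stopping : stopping_time X t tau1.
Proof.
move=> s ts; have /andP[tles s1] := ts.
have -> : [set w | tau1 w <= s] = [set w | exists2 v, t <= v <= s & below v w <= 0].
  by apply/seteqP; split => w /= /(tau1_le w s ts).
apply: hit_event => //; first exact: below_continuous.
- move=> u c tu; have := X_F u `]-oo, c + C * Num.sqrt (1 - u)[ tu (measurable_itv _).
  by congr (F _ _); apply/seteqP; split => w; rewrite /below/= in_itv/= ltrBlDr.
- move=> u tu; have := X_F u `]-oo, C * Num.sqrt (1 - u)] tu (measurable_itv _).
  by congr (F _ _); apply/seteqP; split => w; rewrite /below/= in_itv/= subr_le0.
Qed.

Lemma tau2_stopping : stopping_time X t tau2.
Proof.
move=> s ts; have /andP[tles s1] := ts.
(* A rational time separates [tau1] from the later hit. It exists because the two cannot coincide: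
   at [tau1] the path is at most C sqrt (1 - s) < 0, strictly below the upper boundary. *)
pose Q (r : rat) := if t <= ratr r <= s then
  [set w | tau1 w <= ratr r] `&` [set w | exists2 v, ratr r <= v <= s & above v w <= 0] else set0.
have -> : [set w | tau2 w <= s] = \bigcup_r Q r.
  apply/seteqP; split => w /=.
    move=> /(tau2_le w s ts)[v /andP[uv vs] hv].
    have v1 : v < 1 by exact: le_lt_trans s1.
    have t1v : tau1 w < v.
      rewrite lt_neqAle uv andbT; apply/eqP => uE.
      have S1w : S1 w !=set0.
        by apply: contrapT => /tau1_empty e; move: v1; rewrite -uE e ltxx.
      have [_] := tau1_hit w S1w; rewrite uE => h1.
      have sv : 0 < Num.sqrt (1 - v) by rewrite sqrtr_gt0 subr_gt0.
      have := mulr_gt0 B0 sv; have := nmulr_rlt0 (Num.sqrt (1 - v)) C0; rewrite sv.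
      by move: h1 hv; rewrite /below /above; move: (X v w) (B * _) (C * _) => y1 y2 y3; lra.
    have [r] := rat_in_itvoo t1v; rewrite in_itv/= => /andP[h1 h2].
    exists r => //; rewrite /Q (le_trans (tau1_ge w) (ltW h1)) (le_trans (ltW h2) vs)/=.
    by split; [exact: ltW|exists v => //; rewrite (ltW h2)].
  move=> [r _]; rewrite /Q; case: ifP => // _ [/= h1 [v /andP[rv vs] hv]].
  by apply/(tau2_le w s ts); exists v => //; rewrite (le_trans h1 rv).
apply: (@bigcupT_measurable_rat _ (sig s)) => r; rewrite /Q.
case: ifP => [/andP[tr rs]|_]; last exact: (@measurable0 _ (sig s)).
have tr1 : t <= (ratr r : R) < 1 by apply/andP; split => //; exact: le_lt_trans rs s1.
apply: (@measurableI _ (sig s)).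
  by apply: (nat_filtration_mono X t (ratr r) s rs); exact: tau1_stopping.
apply: hit_event => //; first exact: above_continuous.
- move=> u c tu; have := X_F u `]B * Num.sqrt (1 - u) - c, +oo[ tu (measurable_itv _).
  congr (F _ _); apply/seteqP; split => w; rewrite /above/= in_itv/= andbT;
    by move: (X u w) (B * _) => y z; lra.
- move=> u tu; have := X_F u `[B * Num.sqrt (1 - u), +oo[ tu (measurable_itv _).
  by congr (F _ _); apply/seteqP; split => w; rewrite /above/= in_itv/= andbT subr_le0.
Qed.

Lemma tau1_before w s : t <= s < 1 -> s < tau1 w -> 0 < below s w.
Proof.
move=> ts; rewrite ltNge => /negP h; rewrite ltNge; apply/negP => hs; apply: h.
by apply/(tau1_le w s ts); exists s => //; rewrite lexx; case/andP: ts => ->.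
Qed.

Lemma tau2_before w s : tau1 w <= s < 1 -> s < tau2 w -> 0 < above s w.
Proof.
move=> /andP[t1s s1]; have ts : t <= s < 1 by rewrite s1 (le_trans (tau1_ge w)).
rewrite ltNge => /negP h; rewrite ltNge; apply/negP => hs; apply: h.
by apply/(tau2_le w s ts); exists s => //; rewrite lexx t1s.
Qed.

Lemma tau1_start w : below t w <= 0 -> tau1 w = t.
Proof.
move=> h; have t1 : t <= t < 1 by rewrite lexx; case/andP: Ht.
apply/eqP; rewrite eq_le tau1_ge andbT; apply/(tau1_le w t t1).
by exists t; rewrite ?lexx.
Qed.

Lemma tau1_zero w : tau1 w < 1 -> 0 < below t w -> below (tau1 w) w = 0.
Proof.
move=> t1 ht; have S1w : S1 w !=set0 by apply: contrapT => /tau1_empty e; move: t1; rewrite e ltxx.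
rewrite tau1E; case: pselect => // _.
by apply: (inf_hit_zero (below ^~ w) t) => //; exact: below_continuous.
Qed.

Lemma below_above w s : s < 1 -> below s w <= 0 -> 0 < above s w.
Proof.
move=> s1; have s0 : 0 < Num.sqrt (1 - s) by rewrite sqrtr_gt0 subr_gt0.
have := mulr_gt0 B0 s0; have := nmulr_rlt0 (Num.sqrt (1 - s)) C0; rewrite s0.
by rewrite /below /above; move: (X s w) (B * _) (C * _) => y1 y2 y3; lra.
Qed.

Let cross_event sg b s : sg ^+ 2 = 1 -> t <= s < 1 -> exists N, [/\ measurable N, P N = 0%E &
  forall w, ~ N w -> exists2 u, s <= u < 1 & b * Num.sqrt (1 - u) <= sg * X u w].
Proof.
move=> sg1 ts; have [N [mN N0 H]] := recurrence P W X t x Ht HW HX sg b s sg1 ts.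
exists N; split => // w /H[u /andP[su u1] hu]; exists u; first by rewrite su.
have u0 : 0 < 1 - u by rewrite subr_gt0.
have := ler_wpM2r (ltW u0) hu; rewrite /slope -!mulrA mulVf ?gt_eqF// mulr1.
by rewrite sqrtrV ?(ltW u0)// -{2}(sqr_sqrtr (ltW u0)) expr2 mulKf// gt_eqF// sqrtr_gt0.
Qed.

Lemma hitting_ae : exists N, [/\ measurable N, P N = 0%E & forall w, ~ N w ->
  [/\ tau1 w <= tau2 w, tau2 w < 1, below (tau1 w) w <= 0 & above (tau2 w) w = 0]].
Proof.
have t1 : t <= t < 1 by rewrite lexx; case/andP: Ht.
have [N1 [mN1 N10 H1]] := cross_event (-1) (- C) t (etrans (sqrrN _) (expr1n _ _)) t1.
(* [recurrence] starts from a deterministic time while [tau1] is random; it is applied from every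
   horizon, one of which lies beyond [tau1]. *)
have hor m : t <= horizon t m < 1 by rewrite ltW ?horizon_gt// horizon_lt1.
have /choice[N2 hN2] := fun m => cross_event 1 B (horizon t m) (expr1n _ _) (hor m).
have mN2 : measurable (\bigcup_m N2 m) by apply: bigcupT_measurable => m; case: (hN2 m).
exists (N1 `|` \bigcup_m N2 m); split; first exact: measurableU.
  apply/negligibleP; first exact: measurableU.
  apply: negligibleU; first exact/negligibleP.
  by apply: negligible_bigcup => m; have [mm m0 _] := hN2 m; exact/negligibleP.
move=> w nN.
have S1w : S1 w !=set0.
  have [|u /andP[tu u1] hu] := H1 w _; first by move=> h; apply: nN; left.
  exists u; split; first by rewrite tu.
  by rewrite /below; move: hu; rewrite mulN1r mulNr lerN2 subr_le0.
have [/andP[_ t11] hb] := tau1_hit w S1w.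
have S2w : S2 w !=set0.
  have [m hm] : exists m, tau1 w <= horizon t m.
    have := @horizon_cvg R t => /cvgr_gt /(_ _ t11) [m _ /(_ m (leqnn _))] h.
    by exists m; exact: ltW.
  have [_ _ /(_ w)] := hN2 m; case; first by move=> h; apply: nN; right; exists m.
  move=> u /andP[mu u1] hu; exists u; split; first by rewrite u1 (le_trans hm).
  by rewrite /above; move: hu; rewrite mul1r subr_le0.
have [/andP[t12 t21] ha] := tau2_hit w S2w.
split => //.
rewrite tau2E; case: pselect => // _.
apply: (inf_hit_zero (above ^~ w) t) => //; first exact: above_continuous.
- exact: tau1_ge.
- exact: below_above.
Qed.

End hitting_events.

(** * The optimal pair *)

Lemma integrable_excess d (T : measurableType d) (R : realType) (P : probability T R) (g : T -> R) e :
  P.-integrable setT (EFin \o g) -> (forall w, 0 <= g w) -> 0 < e ->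
  exists2 c, 0 <= c & (\int[P]_w (Num.max (g w - c) 0)%:E <= e%:E)%E.
Proof.
move=> ig g0 e0.
have mg : measurable_fun setT g by exact/measurable_EFinP/(measurable_int _ ig).
pose f n w := Num.max (g w - n%:R) 0.
have mf n : measurable_fun setT (f n) by apply: measurable_maxr => //; exact: measurable_funB.
have [] := @dominated_convergence _ _ _ P setT measurableT (fun n => EFin \o f n) (EFin \o cst 0) (EFin \o g).
- by move=> n; exact/measurable_EFinP.
- exact/measurable_EFinP.
- apply: aeW => w _; apply: cvg_near_cst; near=> n; rewrite /= /f (max_idPr _)// subr_le0.
  by near: n; exact: nbhs_infty_ger.
- exact: ig.
- apply: aeW => w n _; rewrite /= lee_fin ger0_norm /f ?le_max ?lexx ?orbT// ge_max g0 andbT.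
  by rewrite gerBl.
move=> _ _; rewrite integral0 => /fine_cvgP[_ /cvgrPdist_lt /(_ _ e0) [n _ /(_ n (leqnn n))]].
rewrite /= sub0r normrN => h; exists n%:R => //.
have i0 : (0 <= \int[P]_w (f n w)%:E)%E.
  by apply: integral_ge0 => w _; rewrite lee_fin le_max lexx orbT.
have ifin : (\int[P]_w (f n w)%:E)%E \is a fin_num.
  rewrite ge0_fin_numE//; have /integrableP[_] := ig; apply: le_lt_trans.
  apply: ge0_le_integral => //.
  - by move=> w _; rewrite lee_fin le_max lexx orbT.
  - exact/measurable_EFinP.
  - exact: measurableT_comp (measurable_int _ ig).
  - move=> w _; rewrite /= lee_fin ger0_norm// /f ge_max g0 andbT; by rewrite gerBl.
by rewrite -(fineK ifin) lee_fin ltW// (le_lt_trans (ler_norm _)).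
Unshelve. all: by end_near. Qed.

Section stopped_martingale.
Context {R : realType} {d : measure_display} {Omega : measurableType d}.
Variables (P : probability Omega R) (W X : R -> Omega -> R) (t x : R).
Hypotheses (Ht : 0 <= t < 1) (HW : standard_BM P W) (HX : bridge_SDE W X t x).
Local Notation Y := (slope X).
Local Notation rate u := (1 - u)^-1.
Local Notation F := (nat_filtration X t).
Local Notation y0 := (x / (1 - t)).
Variable phi : R -> R -> R.
Hypotheses (mphi : forall r, measurable_fun setT (phi r)).
Hypotheses (phi0 : forall r y, 0 < r -> 0 <= phi r y).
Hypothesis (cphi : path_continuous X t phi).
Hypothesis mart : forall s s' A, t <= s -> s < s' -> s' < 1 -> F s A ->
  (\int[P]_(w in A) (phi (rate s') (Y s' w))%:E = \int[P]_(w in A) (phi (rate s) (Y s w))%:E)%E.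
Variables (tau : Omega -> R) (N : set Omega).
Hypotheses (st : stopping_time X t tau) (mN : measurable N) (N0 : P N = 0%E).
Hypothesis tauN : forall w, ~ N w -> t <= tau w.

Let FT s : F s setT.
Proof. exact: (@measurableT _ (g_sigma_algebraType (nat_generators X t s))). Qed.

(** Optional stopping at min (tau, T). Uniform integrability of the grid values comes from
    [stopped_excess]: their excess over a level never exceeds that of the single integrable value at
    [T]. *)
Lemma stopped_martingale T : t < T -> T < 1 ->
  P.-integrable setT (EFin \o stop_value X T tau N phi) /\
  \int[P]_w stop_value X T tau N phi w = phi (rate t) y0.
Proof.
move=> tT T1; have tT1 : t <= T < 1 by rewrite T1 ltW.
pose T_ := fun _ : nat => T.
have cT : T_ m @[m --> \oo] --> T by exact: cvg_cst.
have tT_ m : t < T_ m by []. have T_1 m : T_ m < 1 by [].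
have tauT w : ~ N w -> t <= tau w /\ Num.min (tau w) T < 1.
  by move=> nN; split; [exact: tauN|rewrite gt_min T1 orbT].
pose f m w := at_time X phi (grid_time t T_ tau m w) w.
have mf m : measurable_fun setT (f m).
  exact: (grid_value_measurable P W X t x Ht HW HX T_ tT_ T_1 tau st phi m mphi).
have f0 m w : 0 <= f m w.
  by apply: phi0; apply: rate_gt0; have /andP[] := grid_time_bound t T_ tT_ T_1 tau m w.
have g0 w : 0 <= stop_value X T tau N phi w.
  rewrite /stop_value indicE; have [/set_mem nN|_] := boolP (w \in ~` N); last by rewrite mul0r.
  by rewrite mul1r; apply: phi0; apply: rate_gt0; have [] := tauT w nN.
have iT : P.-integrable setT (fun w => (phi (rate T) (Y T w))%:E).
  apply/integrableP; split.
    by apply/measurable_EFinP; apply: measurableT_comp => //; exact: (measurable_slope P W X t x Ht HW HX).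
  have -> : (\int[P]_w `|(phi (rate T) (Y T w))%:E| = \int[P]_w (phi (rate T) (Y T w))%:E)%E.
    by apply: eq_integral => w _; rewrite /= ger0_norm// phi0// rate_gt0.
  rewrite (mart t T)//.
  rewrite (_ : (fun w => _) = cst (phi (rate t) y0)%:E); last first.
    by apply/funext => w; rewrite (slope_start W X t x Ht HX).
  by rewrite (_ : integral _ _ _ = (phi (rate t) y0)%:E) ?ltry// -[RHS]mule1
    -(@probability_setT _ _ _ P) -integral_cst.
have [ig cg] := @cvg_Rintegral_ui _ _ _ P f (stop_value X T tau N phi) mf
  (stop_value_measurable P W X t x Ht HW HX T_ T tT_ T_1 cT tau N st mN tauT (ltW tT) phi mphi cphi)
  f0 g0
  (stop_value_ae_cvg P X t T_ T tT_ T_1 cT tau N mN N0 tauT (ltW tT) phi cphi)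
  (fun e e0 => let: ex_intro2 c c0 hc := integrable_excess _ _ _ P _ e iT (fun w => phi0 _ _ (rate_gt0 _ T1)) e0 in
    ex_intro2 _ _ c c0 (fun m => le_trans
      (stopped_excess P W X t x Ht HW HX T m.+1 tT T1 isT phi tau c mphi phi0 mart c0 st) hc)).
split => //; apply: (cvg_unique _ cg) => //.
rewrite (_ : (fun m => _) = cst (phi (rate t) y0)); first exact: cvg_cst.
apply/funext => m; rewrite /Rintegral.
have -> : (\int[P]_w (f m w)%:E = (phi (rate t) y0)%:E)%E; last by [].
apply: (grid_stop_start P W X t x Ht HW HX T m.+1 tT T1 isT eq phi tau) => //.
- by move=> ? ? ? -> ->.
- by move=> ? ? ? ->.
Qed.

End stopped_martingale.

Section optimal_pair.
Context {R : realType} {d : measure_display} {Omega : measurableType d}.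
Variables (P : probability Omega R) (W X : R -> Omega -> R) (t x : R).
Hypotheses (Ht : 0 <= t < 1) (HW : standard_BM P W) (HX : bridge_SDE W X t x).
Local Notation rate u := (1 - u)^-1.
Local Notation y0 := (x / (1 - t)).
Variables B C a v : R.
Hypotheses (B0 : 0 < B) (aE : a = 1 - B ^+ 2) (lB : a * lap 0 B = B).
Hypotheses (C0 : C < 0) (vE : v = B ^+ 2 - C ^+ 2) (C1 : C ^+ 2 < 1).
Hypothesis vC : v * lap 0 (- C) = a * lap 0 C - C.
Local Notation tau1 := (tau1_star X C t).
Local Notation tau2 := (tau2_star X B C t).
Local Notation GN := (fun r y => G r (- y)).
Local Notation below := (below X C).
Local Notation above := (above X B).
Local Notation z s w := (X s w / Num.sqrt (1 - s)).

Let sqrt_gt0 (s : R) : s < 1 -> 0 < Num.sqrt (1 - s).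
Proof. by move=> s1; rewrite sqrtr_gt0 subr_gt0. Qed.

Let slope_div s w : s < 1 -> slope X s w / Num.sqrt (rate s) = z s w.
Proof.
move=> s1; have s0 := sqrt_gt0 s s1; have s10 : 0 <= 1 - s by rewrite subr_ge0 ltW.
rewrite /slope sqrtrV// invrK -{1}(sqr_sqrtr s10) expr2 invfM mulrA mulfVK// gt_eqF//.
Qed.

Let at_timeG s w : s < 1 -> at_time X G s w = lap 0 (z s w) * Num.sqrt (1 - s).
Proof.
move=> s1; rewrite /at_time /G slope_div// sqrtrV ?invrK// subr_ge0 ltW//.
Qed.

Let at_timeGN s w : s < 1 -> at_time X GN s w = lap 0 (- z s w) * Num.sqrt (1 - s).
Proof.
move=> s1; rewrite /at_time /G mulNr slope_div// sqrtrV ?invrK// subr_ge0 ltW//.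
Qed.

Let at_timeX s w : s < 1 -> at_time X (fun r y => y / r) s w = X s w.
Proof. by move=> s1; rewrite /at_time invrK /slope mulfVK// gt_eqF// subr_gt0. Qed.

Let lap0_mono (z1 z2 : R) : z1 <= z2 -> lap 0 z1 <= lap 0 z2.
Proof.
move=> h; apply: le_trans (lap0_ge_tangent z2 z1).
by rewrite lerDl mulr_ge0 ?lap_ge0// subr_ge0.
Qed.

Let sqrt_le1 s : t <= s -> Num.sqrt (1 - s) <= 1.
Proof.
move=> ts; rewrite -[leRHS]sqrtr1 ler_wsqrtr// gerBl (le_trans _ ts)//.
by case/andP: Ht.
Qed.

Let G_bound s w : t <= s < 1 -> 0 <= above s w -> 0 <= at_time X G s w <= lap 0 B.
Proof.
move=> /andP[ts s1]; rewrite /above subr_ge0 => h; rewrite at_timeG//.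
rewrite mulr_ge0 ?lap_ge0 ?sqrtr_ge0//=.
rewrite -[leRHS]mulr1 ler_pM ?lap_ge0 ?sqrtr_ge0 ?sqrt_le1//.
by apply: lap0_mono; rewrite ler_pdivrMr ?sqrt_gt0.
Qed.

Let GN_bound s w : t <= s < 1 -> 0 <= below s w -> 0 <= at_time X GN s w <= lap 0 (- C).
Proof.
move=> /andP[ts s1]; rewrite /below subr_ge0 => h; rewrite at_timeGN//.
rewrite mulr_ge0 ?lap_ge0 ?sqrtr_ge0//=.
rewrite -[leRHS]mulr1 ler_pM ?lap_ge0 ?sqrtr_ge0 ?sqrt_le1//.
by apply: lap0_mono; rewrite lerN2 ler_pdivlMr ?sqrt_gt0.
Qed.

Variable N : set Omega.
Hypotheses (mN : measurable N) (N0 : P N = 0%E).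
Hypothesis tauN : forall w, ~ N w ->
  [/\ tau1 w <= tau2 w, tau2 w < 1, below (tau1 w) w <= 0 & above (tau2 w) w = 0].
Local Notation S T tau phi := (stop_value X T tau N phi).

Let st1 : stopping_time X t tau1. Proof. exact: (tau1_stopping P W X t x Ht HW HX). Qed.
Let st2 : stopping_time X t tau2. Proof. exact: (tau2_stopping P W X t x Ht HW HX). Qed.
Let t_tau1 w : t <= tau1 w. Proof. exact: (tau1_ge P W X t x Ht HW HX). Qed.
Let tau1_lt1 w : ~ N w -> tau1 w < 1.
Proof. by move=> /tauN[h1 h2 _ _]; exact: le_lt_trans h2. Qed.
Let t_tau2 w : ~ N w -> t <= tau2 w.
Proof. by move=> /tauN[h1 _ _ _]; exact: le_trans h1. Qed.
Let above_tau1 w : ~ N w -> 0 <= above (tau1 w) w.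
Proof.
move=> nN; have [_ _ h _] := tauN w nN.
by apply/ltW/(below_above X B C B0 C0 w (tau1 w) _ h); exact: tau1_lt1.
Qed.

Let above_between w s : ~ N w -> tau1 w <= s -> s <= tau2 w -> 0 <= above s w.
Proof.
move=> nN h1; rewrite le_eqVlt => /predU1P[->|h2]; first by have [_ _ _ ->] := tauN w nN.
apply/ltW/(tau2_before P W X t x Ht HW HX B C) => //.
by rewrite h1 (lt_trans h2)//; have [] := tauN w nN.
Qed.

Let S_off T tau phi w : ~ N w -> S T tau phi w = at_time X phi (Num.min (tau w) T) w.
Proof. by move=> nN; rewrite /stop_value indicE mem_set// mul1r. Qed.

Let S_on T tau phi w : N w -> S T tau phi w = 0.
Proof. by move=> Nw; rewrite /stop_value indicE memNset ?mul0r//; exact. Qed.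

Let tau_hyp tau : (forall w, ~ N w -> t <= tau w) -> (forall w, ~ N w -> tau w < 1) ->
  forall w, ~ N w -> t <= tau w /\ Num.min (tau w) 1 < 1.
Proof. by move=> h1 h2 w nN; rewrite gt_min h2//; split => //; exact: h1. Qed.

Let t_le1 : t <= 1. Proof. by apply/ltW; case/andP: Ht. Qed.

Let S_measurable tau phi : stopping_time X t tau -> (forall w, ~ N w -> t <= tau w) ->
  (forall w, ~ N w -> tau w < 1) -> (forall r, measurable_fun setT (phi r)) ->
  path_continuous X t phi -> measurable_fun setT (S 1 tau phi).
Proof.
move=> st h1 h2 mphi cphi.
exact: (stop_value_measurable P W X t x Ht HW HX (horizon t) 1 (horizon_gt t Ht)
  (horizon_lt1 t Ht) (horizon_cvg t) tau N st mN (tau_hyp tau h1 h2) t_le1 phi mphi cphi).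
Qed.

Let S_cvg tau phi : (forall w, ~ N w -> t <= tau w) ->
  (forall w, ~ N w -> tau w < 1) -> path_continuous X t phi -> forall w,
  S (horizon t m) tau phi w @[m --> \oo] --> S 1 tau phi w.
Proof.
move=> h1 h2 cphi w; have [Nw|nN] := pselect (N w).
  rewrite S_on// (_ : (fun m => _) = cst 0); first exact: cvg_cst.
  by apply/funext => m; rewrite S_on.
rewrite S_off// (_ : (fun m => _) = (fun m => at_time X phi (Num.min (tau w) (horizon t m)) w)).
  apply: cphi.
  - by move=> m; rewrite le_min h1//= (ltW (horizon_gt t Ht m)) gt_min h2.
  - by rewrite le_min h1// gt_min h2// t_le1.
  - apply: (@continuous_cvg _ _ _ _ _ _ (Num.min (tau w))); last exact: horizon_cvg.
    by move=> ?; apply: (@continuous_min _ _ (cst (tau w)) id) => //; exact: cst_continuous.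
by apply/funext => m; rewrite S_off.
Qed.

Let cG : path_continuous X t G. Proof. exact: (path_continuous_G P W X t x Ht HW HX). Qed.
Let cGN : path_continuous X t GN. Proof. exact: (path_continuous_GN P W X t x Ht HW HX). Qed.
Let mGr (r : R) : measurable_fun setT (G r : R -> R). Proof. exact: measurable_G. Qed.
Let mGN (r : R) : measurable_fun setT (fun y : R => G r (- y)).
Proof. by apply: measurableT_comp => //; exact: measurable_G. Qed.

Let bounded_integrable (f : Omega -> R) K : measurable_fun setT f -> (forall w, `|f w| <= K) ->
  P.-integrable setT (EFin \o f).
Proof.
move=> mf fK; have iK := finite_measure_integrable_cst P K measurableT.
apply: (le_integrable _ _ _ iK) => //; first exact/measurable_EFinP.
by move=> w _; rewrite /= lee_fin (le_trans (fK w))// ler_norm.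
Qed.

Let tau2_lt1 w : ~ N w -> tau2 w < 1. Proof. by move=> /tauN[]. Qed.
Let t_tau1' w : ~ N w -> t <= tau1 w. Proof. by []. Qed.

Let SG_integrable tau : stopping_time X t tau -> (forall w, ~ N w -> t <= tau w) ->
  (forall w, ~ N w -> tau w < 1) -> (forall w, ~ N w -> 0 <= above (tau w) w) ->
  P.-integrable setT (EFin \o S 1 tau G).
Proof.
move=> st h1 h2 h3; apply: (bounded_integrable _ (lap 0 B)); first exact: S_measurable.
move=> w; have [Nw|nN] := pselect (N w); first by rewrite S_on// normr0 lap_ge0.
rewrite S_off// (min_idPl _) ?(ltW (h2 w nN))//.
have ts : t <= tau w < 1 by rewrite h1// h2.
by have /andP[h4 h5] := G_bound _ w ts (h3 w nN); rewrite ger0_norm.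
Qed.

Let iG1 : P.-integrable setT (EFin \o S 1 tau1 G). Proof. exact: SG_integrable. Qed.
Let iG2 : P.-integrable setT (EFin \o S 1 tau2 G).
Proof. by apply: SG_integrable => // w nN; have [_ _ _ ->] := tauN w nN. Qed.

Let stopped_G_mart tau T : stopping_time X t tau -> (forall w, ~ N w -> t <= tau w) ->
  t < T -> T < 1 ->
  P.-integrable setT (EFin \o S T tau G) /\ \int[P]_w S T tau G w = G (rate t) y0.
Proof.
move=> st h1; apply: (stopped_martingale P W X t x Ht HW HX G) => //.
- by move=> r y r0; exact/ltW/G_gt0.
- by move=> s s' A ts ss' s'1 FA; apply: (slope_G P W X t x Ht HW HX).
Qed.

(* Before the second hitting time [z <= B], so the martingale [G] is bounded there. *)
Let G_tau12 : \int[P]_w S 1 tau2 G w = \int[P]_w S 1 tau1 G w.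
Proof.
apply/eqP; rewrite -subr_eq0 -(RintegralB measurableT iG2 iG1); apply/eqP.
(* Before [tau1] the values of [G] need not be bounded, so dominated convergence is applied to the
   difference: it is 0 as long as the horizon precedes [tau1], and afterwards both terms lie in
   [0, lap 0 B]. *)
pose D T w := S T tau2 G w - S T tau1 G w.
have mS T tau : stopping_time X t tau -> (forall w, ~ N w -> t <= tau w) ->
    t < T -> T < 1 -> P.-integrable setT (EFin \o S T tau G).
  by move=> st h1 tT T1; have [] := stopped_G_mart tau T st h1 tT T1.
have iD m : P.-integrable setT (EFin \o D (horizon t m)).
  by apply: integrable_sub => //; apply: mS => //;
    [exact: horizon_gt|exact: horizon_lt1|exact: horizon_gt|exact: horizon_lt1].
have [_ cD] : P.-integrable setT (EFin \o D 1) /\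
    \int[P]_w D (horizon t m) w @[m --> \oo] --> \int[P]_w D 1 w.
  apply: (cvg_Rintegral_bounded _ _ _ P (fun m => D (horizon t m)) (D 1) (lap 0 B)).
  - by move=> m; exact/measurable_EFinP/(measurable_int _ (iD m)).
  - by apply: measurable_funB; exact: S_measurable.
  - by apply: aeW => w; apply: cvgB; exact: S_cvg.
  move=> m w; have tT := horizon_gt t Ht m; have T1 := horizon_lt1 t Ht m; rewrite /D.
  have [Nw|nN] := pselect (N w); first by rewrite !S_on// subrr normr0 lap_ge0.
  have [h12 _ _ _] := tauN w nN.
  rewrite !S_off//; have [hT|hT] := leP (tau1 w) (horizon t m); last first.
    by rewrite (min_idPr _) ?(le_trans (ltW hT))// subrr normr0 lap_ge0.
  have ts1 : t <= tau1 w < 1 by rewrite t_tau1 tau1_lt1.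
  have /andP[g1 g2] := G_bound _ w ts1 (above_tau1 w nN).
  have ts2 : t <= Num.min (tau2 w) (horizon t m) < 1.
    by rewrite le_min t_tau2//= (ltW tT) gt_min T1 orbT.
  have /andP[g3 g4] : 0 <= at_time X G (Num.min (tau2 w) (horizon t m)) w <= lap 0 B.
    by apply: G_bound => //; apply: above_between => //; [rewrite le_min h12 hT|rewrite ge_min lexx].
  move: g1 g2 g3 g4; move: (at_time _ _ _ _) (at_time _ _ _ _) (lap 0 B) => u1 u2 K *.
  by rewrite ler_norml; apply/andP; split; lra.
apply: (cvg_unique _ cD) => //.
rewrite (_ : (fun m => _) = cst 0); first exact: cvg_cst.
apply/funext => m; have tT := horizon_gt t Ht m; have T1 := horizon_lt1 t Ht m.
have [i2 e2] := stopped_G_mart tau2 _ st2 t_tau2 tT T1.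
have [i1 e1] := stopped_G_mart tau1 _ st1 t_tau1' tT T1.
by rewrite /D (RintegralB measurableT i2 i1) e1 e2 subrr.
Qed.

Let GN_tau1 : C * Num.sqrt (1 - t) < x -> P.-integrable setT (EFin \o S 1 tau1 GN) /\
  \int[P]_w S 1 tau1 GN w = G (rate t) (- y0).
Proof.
move=> hx; have tt : t <= t < 1 by rewrite lexx; case/andP: Ht.
have hb w : 0 < below t w by rewrite /below subr_gt0 (bridge_start (X ^~ w) (W ^~ w) t x Ht (HX w)).
have bnd T w : t <= T -> `|S T tau1 GN w| <= lap 0 (- C).
  move=> tT; have [Nw|nN] := pselect (N w); first by rewrite S_on// normr0 lap_ge0.
  have ts : t <= Num.min (tau1 w) T < 1 by rewrite le_min t_tau1 tT gt_min tau1_lt1.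
  rewrite S_off//; have /andP[g1 g2] : 0 <= at_time X GN (Num.min (tau1 w) T) w <= lap 0 (- C).
    apply: GN_bound => //; have [h|h] := leP (tau1 w) T.
      by rewrite (tau1_zero P W X t x Ht HW HX)// tau1_lt1.
    by apply/ltW/(tau1_before P W X t x Ht HW HX C) => //; rewrite tT (lt_trans h)// tau1_lt1.
  by rewrite ger0_norm.
have mart m : P.-integrable setT (EFin \o S (horizon t m) tau1 GN) /\
    \int[P]_w S (horizon t m) tau1 GN w = G (rate t) (- y0).
  apply: (stopped_martingale P W X t x Ht HW HX GN) => //.
  - by move=> r y r0; exact/ltW/G_gt0.
  - by move=> s s' A ts ss' s'1 FA; apply: (slope_GN P W X t x Ht HW HX).
  - exact: horizon_gt.
  - exact: horizon_lt1.
have [iGN cD] : P.-integrable setT (EFin \o S 1 tau1 GN) /\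
    \int[P]_w S (horizon t m) tau1 GN w @[m --> \oo] --> \int[P]_w S 1 tau1 GN w.
  apply: (cvg_Rintegral_bounded _ _ _ P (fun m => S (horizon t m) tau1 GN) _ (lap 0 (- C))).
  - by move=> m; exact/measurable_EFinP/(measurable_int _ (mart m).1).
  - exact: S_measurable.
  - by apply: aeW => w; exact: S_cvg.
  - by move=> m w; apply: bnd; exact/ltW/horizon_gt.
split; first exact: iGN.
have c2 : \int[P]_w S (horizon t m) tau1 GN w @[m --> \oo] --> G (rate t) (- y0).
  rewrite (_ : (fun m => _) = cst (G (rate t) (- y0))); first exact: cvg_cst.
  by apply/funext => m; rewrite (mart m).2.
exact: (cvg_unique (@Rhausdorff R) cD c2).
Qed.

Lemma gain_optimal : gain P X tau1 tau2 = (Vf C a v (rate t) y0)%:E.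
Proof.
pose pX r y : R := y / r.
have tN w : ~ N w -> [/\ t <= tau1 w, tau1 w <= tau2 w & tau2 w < 1].
  by move=> nN; have [h1 h2 _ _] := tauN w nN.
rewrite (gain_stop_value P W X t x Ht HW HX tau1 tau2 N st1 st2 mN N0 tN); congr EFin.
rewrite -/pX.
have E2 : \int[P]_w S 1 tau2 pX w = a * \int[P]_w S 1 tau1 G w.
  rewrite -G_tau12 -(RintegralZl a measurableT iG2); apply: eq_Rintegral => w _.
  have [Nw|nN] := pselect (N w); first by rewrite !S_on// mulr0.
  rewrite !S_off// (min_idPl _) ?(ltW (tau2_lt1 w nN))//.
  rewrite at_timeX ?at_timeG ?tau2_lt1//; have [_ _ _ /eqP] := tauN w nN.
  rewrite /above subr_eq0 => /eqP <-.
  by rewrite mulfK ?gt_eqF ?sqrt_gt0 ?tau2_lt1// mulrA lB.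
have iX1 : P.-integrable setT (EFin \o S 1 tau1 pX).
  have [] // := stop_value_X P W X t x Ht HW HX (horizon t) 1 (horizon_gt t Ht)
    (horizon_lt1 t Ht) (horizon_cvg t) tau1 N st1 mN N0
    (tau_hyp tau1 t_tau1' tau1_lt1) t_le1.
have iaG1 : P.-integrable setT (fun w => (a * S 1 tau1 G w)%:E) by exact: integrable_scale.
rewrite E2 -(RintegralZl a measurableT iG1) -(RintegralB measurableT iaG1 iX1).
have r0 : 0 < rate t by rewrite rate_gt0//; case/andP: Ht.
have t1 : 0 < 1 - t by rewrite subr_gt0; case/andP: Ht.
have cond : (C * Num.sqrt (rate t) < y0) = (C * Num.sqrt (1 - t) < x).
  rewrite sqrtrV ?(ltW t1)// ltr_pdivlMr// -mulrA; congr (C * _ < _).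
  by rewrite -{2}(sqr_sqrtr (ltW t1)) expr2 mulKf// gt_eqF// sqrtr_gt0.
have Xt w : X t w = x by exact: (bridge_start (X ^~ w) (W ^~ w) t x Ht (HX w)).
rewrite /Vf cond; case: ltP => hx.
  have [iGN <-] := GN_tau1 hx.
  rewrite -(RintegralZl v measurableT iGN); apply: eq_Rintegral => w _.
  have [Nw|nN] := pselect (N w); first by rewrite !S_on// !mulr0 subrr.
  rewrite !S_off// (min_idPl _) ?(ltW (tau1_lt1 w nN))//.
  have s1 := tau1_lt1 w nN; have s0 := sqrt_gt0 _ s1.
  rewrite at_timeX ?at_timeG ?at_timeGN//.
  have hb : 0 < below t w by rewrite /below subr_gt0 Xt.
  have /eqP := tau1_zero P W X t x Ht HW HX C w s1 hb; rewrite /below subr_eq0 => /eqP ->.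
  by rewrite mulfK ?gt_eqF// !mulrA vC mulrBl.
have tau1t w : tau1 w = t.
  by apply: (tau1_start P W X t x Ht HW HX); rewrite /below subr_le0 Xt.
rewrite (_ : a * G (rate t) y0 - y0 / rate t = \int[P]_w (a * G (rate t) y0 - y0 / rate t)).
  rewrite /Rintegral; congr fine; apply: (eq_integral_off_null _ _ _ _ N mN N0) => w nN.
  rewrite !S_off// tau1t (min_idPl _) ?t_le1// /at_time /slope Xt//.
have p1 : fine (P setT) = 1 by rewrite probability_setT.
rewrite Rintegral_cst// (_ : fine _ = 1) ?mulr1//; exact: p1.
Qed.

End optimal_pair.

(** * Return to the original coordinates and conclusion *)

Lemma VstarE (R : realType) (B C t x : R) : 0 < B -> C < 0 -> t < 1 ->
  Vstar B C t x = Vf C (1 - B ^+ 2) (v_fun B C) (1 - t)^-1 (x / (1 - t)).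
Proof.
move=> B0 C0 t1; have t0 : 0 < 1 - t by rewrite subr_gt0.
pose s := Num.sqrt (1 - t); have s0 : 0 < s by rewrite sqrtr_gt0.
have s2 : 1 - t = s ^+ 2 by rewrite sqr_sqrtr ?ltW.
have sr : Num.sqrt (1 - t)^-1 = s^-1 by rewrite sqrtrV ?ltW.
have sN0 : s != 0 by rewrite gt_eqF.
have zE : x / s ^+ 2 / s^-1 = x / s by field.
have sqE : (x / s) ^+ 2 / 2 = x ^+ 2 / ((1 - t) *+ 2).
  by rewrite -mulr_natr s2; field.
rewrite /Vstar /Vf /f_fun /U_fun /G sr -/s s2 ltr_pdivlMr ?exprn_gt0//.
have -> : C / s * s ^+ 2 = C * s by field.
rewrite mulNr zE !lap0_Phi sqrrN sqE s2.
case: ltP => hx; first by field.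
(* As C < 0 < B, a point below the lower boundary is below the upper one, so only the first branch
   of [U_fun] occurs inside [f_fun]. *)
have Bs : x < B * s by rewrite (le_lt_trans hx)// ltr_pM2r// (lt_trans C0).
have -> : Num.sqrt (pi *+ 2 * s ^+ 2) = Num.sqrt (pi *+ 2) * s.
  have p0 : 0 <= pi *+ 2 :> R by rewrite mulrn_wge0// pi_ge0.
  by rewrite (sqrtrM _ p0) sqrtr_sqr ger0_norm// ltW.
rewrite Bs.
by field.
Qed.

Theorem theorem3p5 (R : realType) (B C : R)
  (HB : 0 < B /\
        Num.sqrt (pi *+ 2) * (1 - B ^+ 2) * expR (B ^+ 2 / 2) * Phi B = B)
  (HC : C < 0 /\ u_fun B C = 0)
  (d : measure_display) (Omega : measurableType d) (P : probability Omega R)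
  (W X : R -> Omega -> R) (t x : R)
  (Ht : 0 <= t < 1)
  (HW : standard_BM P W)
  (HX : bridge_SDE W X t x) :
  value P X t = (Vstar B C t x)%:E /\
  admissible P X t (tau1_star X C t) (tau2_star X B C t) /\
  gain P X (tau1_star X C t) (tau2_star X B C t) = value P X t.
Proof.
have [B0 hB] := HB; have [C0 hC] := HC.
have lB : (1 - B ^+ 2) * lap 0 B = B by exact: upper_boundary_eq.
have vE := v_fun_eq B C hC.
have vC := v_fun_lap B C.
have C1 : C ^+ 2 < 1 by apply: (lower_boundary_gtN1 B C C0 hC); exact: (a_gt0 B _ B0 lB).
have t1 : t < 1 by case/andP: Ht.
have vC' : v_fun B C * lap 0 (- C) = (1 - B ^+ 2) * lap 0 C - C by [].
have [N [mN N0 hN]] := hitting_ae P W X t x Ht HW HX B C B0 C0.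
have st1 := tau1_stopping P W X t x Ht HW HX C.
have st2 := tau2_stopping P W X t x Ht HW HX B C B0 C0.
have gE : gain P X (tau1_star X C t) (tau2_star X B C t) = (Vstar B C t x)%:E.
  rewrite VstarE//; exact: (gain_optimal P W X t x Ht HW HX B C _ _ B0 lB C0 vC' N mN N0 hN).
have adm : admissible P X t (tau1_star X C t) (tau2_star X B C t).
  split => //; exists N; split => // w /= h; apply: contrapT => nN; apply: h.
  have [h1 h2 _ _] := hN w nN; split; first exact: (tau1_ge P W X t x Ht HW HX).
  by split.
have vE' : value P X t = (Vstar B C t x)%:E.
  apply/eqP; rewrite eq_le; apply/andP; split; last first.
    by rewrite -gE; apply: ereal_sup_ubound; exists (tau1_star X C t), (tau2_star X B C t).
  apply: ge_ereal_sup => _ [tau1 [tau2 [[s1 s2 [M [mM M0 hM]]] ->]]].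
  rewrite VstarE//; apply: (gain_le_Vf P W X t x Ht HW HX tau1 tau2 M s1 s2 mM M0 _ B C _ _ B0 erefl lB C0 vE C1 vC').
  move=> w nM; apply: contrapT => h; apply: nM; apply: hM => -[h1 [h2 h3]].
  by apply: h.
by split => //; split => //; rewrite vE'.
Qed.
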